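(* Assume that $\rho$ satisfies (H0) and (H1). Then for every $(t,x)\in(0,T]\times\Omega$ and every bounded measurable $\phi:(-\infty,0]\times\Omega\to\mathbb R$, $$\mathbf E\left[\phi\left(-X^{t,(\rho)}(\tau_0(t)),B^x(\tau_0(t))\right)\mathbf 1_{\{\tau_0(t)<\tau_\Omega(x)\}}\right]=\int_{-\infty}^0\int_\Omega\phi(r,y)H_{t,x}(r,y)\,dy\,dr,$$ where $$H_{t,x}(r,y)=\int_0^t\rho(z,z-r)\left(\int_0^\infty p_s^\Omega(x,y)\,p_s^{(\rho)}(t,z)\,ds\right)dz.$$
   Context: Fix $T>0$ and a bounded open set $\Omega\subset\mathbb R^d$ that is regular: for every $z\in\partial\Omega$ there is a finite right circular cone $V_z$ with vertex $z$ and $V_z\subset\Omega^c$. (H0): $\rho:\mathbb R\times(0,\infty)\to[0,\infty)$ is continuous and continuously differentiable in the first variable; $\int_0^\infty(1\wedge r)\sup_t\rho(t,r)\,dr<\infty$; $\int_0^\infty(1\wedge r)\sup_t|\partial_t\rho(t,r)|\,dr<\infty$; $\lim_{\delta\to0}\sup_t\int_{0<r\le\delta}r\rho(t,r)\,dr=0$; and there are $\epsilon,\gamma>0$ with $\rho(t,r)\ge\gamma$ for all $t$ and $0<r<\epsilon$. Let $D_\infty^{(\rho)}u(t):=\int_0^\infty(u(t)-u(t-r))\rho(t,r)\,dr$. Let $C_\infty(-\infty,T]$ be the continuous functions on $(-\infty,T]$ vanishing at $-\infty$ (supremum norm), and $C^1_\infty(-\infty,T]$ the set of $f\in C^1(-\infty,T]$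 with $f,f'\in C_\infty(-\infty,T]$. Under (H0) it is known that the closure of $(-D_\infty^{(\rho)},C^1_\infty(-\infty,T])$ in $C_\infty(-\infty,T]$ generates a Feller semigroup; for $t\in(-\infty,T]$, $-X^{t,(\rho)}=\{-X^{t,(\rho)}(s)\}_{s\ge0}$ is the induced (càdlàg, non-increasing) Feller process started at $t$, and $\tau_0(t):=\inf\{s>0:-X^{t,(\rho)}(s)\le0\}$. (H1): for each $t\in[0,T]$ and $s>0$ the law of $-X^{t,(\rho)}(s)$ is absolutely continuous with respect to Lebesgue measure, with density denoted $z\mapsto p_s^{(\rho)}(t,z)$; and $\mathbf P[-X^{t,(\rho)}(\tau_0(t))=0]=0$ for each $t\in(0,T]$. For $x\in\Omega$, $B^x(s)=x+B(2s)$ with $B$ a standard $d$-dimensional Brownian motion, $\tau_\Omega(x):=\inf\{s>0:B^x(s)\notin\Omega\}$, and $p^\Omega_s(x,y)$ is the density on $\Omega$ of $B^x(s)$ killed at $\tau_\Omega(x)$, i.e. $\mathbf E[h(B^x(s))\mathbf 1_{\{s<\tau_\Omega(x)\}}]=\int_\Omega h(y)p_s^\Omega(x,y)\,dy$. The processes $-X^{t,(\rho)}$ and $B^x$ are independent. *)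

(* Defs.v *)
From HB Require Import structures.
From mathcomp Require Import all_boot all_order all_algebra.
From mathcomp Require Import all_classical all_reals all_analysis.

Set Implicit Arguments.
Unset Strict Implicit.
Unset Printing Implicit Defensive.

Import Order.TTheory GRing.Theory Num.Theory.
Import numFieldNormedType.Exports.

Local Open Scope classical_set_scope.
Local Open Scope ring_scope.

(* 'rV[T]_n carries the product sigma-algebra, generated by the coordinates;
   for T = R this is the Borel sigma-algebra of R^n. *)
Definition measure_rV_display : measure_display -> measure_display.
Proof. exact. Qed.

Section measurable_rV.
Context {d} {T : sigmaRingType d}.
Variable n : nat.

Let coors : 'I_n -> 'rV[T]_n -> T := fun i v => v ord0 i.

Let rV_set0 : g_sigma_preimage coors set0.
Proof. exact: sigma_algebra0. Qed.

Let rV_setC A : g_sigma_preimage coors A -> g_sigma_preimage coors (~` A).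
Proof. exact: sigma_algebraC. Qed.

Let rV_bigcup (F : _^nat) : (forall i, g_sigma_preimage coors (F i)) ->
  g_sigma_preimage coors (\bigcup_i (F i)).
Proof. exact: sigma_algebra_bigcup. Qed.

HB.instance Definition _ := @isMeasurable.Build (measure_rV_display d)
  'rV[T]_n (g_sigma_preimage coors) rV_set0 rV_setC rV_bigcup.

End measurable_rV.

Lemma measurable_coord_rV d (T : sigmaRingType d) n (i : 'I_n) :
  measurable_fun [set: 'rV[T]_n] (fun v : 'rV[T]_n => v ord0 i).
Proof.
move=> _ Y mY; rewrite setTI; apply: sub_sigma_algebra => /=.
rewrite -bigcup_seq/=; exists i => /=; first by rewrite mem_index_enum.
by exists Y => //; rewrite setTI.
Qed.

Lemma measurable_fun_rVP d1 d2 (T1 : measurableType d1) (T2 : measurableType d2)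
    n (f : T1 -> 'rV[T2]_n) :
  measurable_fun [set: T1] f <->
  forall i, measurable_fun [set: T1] (fun x => f x ord0 i).
Proof.
split=> [mf i|mf _ A mA].
  exact: measurableT_comp (measurable_coord_rV i) mf.
rewrite setTI; suff : preimage_set_system setT f measurable `<=` measurable.
  by move=> + => /(_ (f @^-1` A)); apply; exists A; rewrite ?setTI.
rewrite -g_sigma_preimage_comp.
apply: smallest_sub; first exact: sigma_algebra_measurable.
move=> B; rewrite -bigcup_seq/= => -[i _ [C mC <-]].
exact: mf.
Qed.

Section lebesgue_measure_rV.
Context {R : realType}.
Local Open Scope ereal_scope.

Definition cons_rV n (xv : measurableTypeR R * 'rV[R]_n) : 'rV[R]_n.+1 :=
  \row_(i < n.+1) (if unlift ord0 i is Some j then xv.2 ord0 j else xv.1).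

Lemma measurable_cons_rV n : measurable_fun setT (@cons_rV n).
Proof.
apply/measurable_fun_rVP => i; case: (unliftP ord0 i) => [j|] ->.
- rewrite (_ : (fun _ => _) = (fun v : 'rV[R]_n => v ord0 j) \o snd).
    by apply: measurableT_comp => //; exact: measurable_coord_rV.
  by apply/funext => xv /=; rewrite mxE liftK.
- rewrite (_ : (fun _ => _) = fst) //.
  by apply/funext => xv /=; rewrite mxE unlift_none.
Qed.

Section step.
Variables (n : nat) (m : {sigma_finite_measure set 'rV[R]_n -> \bar R}).

Definition cons_measure := pushforward (lebesgue_measure \x m) (@cons_rV n).

Let mcons (A : set 'rV[R]_n.+1) : measurable A ->
  measurable (@cons_rV n @^-1` A).
Proof. by move=> mA; rewrite -[X in measurable X]setTI; exact: measurable_cons_rV. Qed.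

Let cons_measure0 : cons_measure set0 = 0.
Proof. by rewrite /cons_measure /pushforward preimage_set0 measure0. Qed.

Let cons_measure_ge0 A : 0 <= cons_measure A.
Proof. by rewrite /cons_measure /pushforward; exact: measure_ge0. Qed.

Let cons_measure_sigma_additive : semi_sigma_additive cons_measure.
Proof.
move=> F mF tF mUF; rewrite /cons_measure /pushforward preimage_bigcup.
apply: measure_semi_sigma_additive.
- by move=> k; exact: mcons.
- apply/trivIsetP => /= i j _ _ ij; rewrite -preimage_setI.
  by move/trivIsetP : tF => /(_ _ _ _ _ ij) ->//; rewrite preimage_set0.
- by rewrite -preimage_bigcup; exact: mcons.
Qed.

HB.instance Definition _ := isMeasure.Build _ _ _ cons_measure
  cons_measure0 cons_measure_ge0 cons_measure_sigma_additive.

Let cons_measure_sigma_finite : sigma_finite setT cons_measure.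
Proof.
have [F TF Foo] : sigma_finite setT (lebesgue_measure \x m).
  have /sigma_finiteP[F [TF ndF Foo]] := sigma_finiteT (@lebesgue_measure R).
  have /sigma_finiteP[G [TG ndG Goo]] := sigma_finiteT m.
  exists (fun k => F k `*` G k).
    rewrite -setXTT TF TG predeqE => -[x y]; split.
      move=> [/= [i _ Fix] [j _ Gjy]]; exists (maxn i j) => //; split.
      - by move: x Fix; exact/subsetPset/ndF/leq_maxl.
      - by move: y Gjy; exact/subsetPset/ndG/leq_maxr.
    by move=> [i _ []/= ? ?]; split; exists i.
  move=> k; have [? ?] := Foo k; have [? ?] := Goo k.
  split; first exact: measurableX.
  by rewrite product_measure1E// lte_mul_pinfty// ge0_fin_numE.
pose g (v : 'rV[R]_n.+1) : measurableTypeR R * 'rV[R]_n :=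
  (v ord0 ord0, \row_j v ord0 (lift ord0 j)).
have gK xv : g (cons_rV xv) = xv.
  case: xv => x v; rewrite /g mxE unlift_none; congr pair.
  by apply/rowP => j; rewrite !mxE liftK.
have mg : measurable_fun setT g.
  apply/measurable_fun_pairP; split; first exact: measurable_coord_rV.
  apply/measurable_fun_rVP => j.
  rewrite (_ : (fun _ => _) = (fun v : 'rV[R]_n.+1 => v ord0 (lift ord0 j))).
    exact: measurable_coord_rV.
  by apply/funext => v /=; rewrite mxE.
exists (fun k => g @^-1` F k).
  by rewrite -preimage_bigcup -TF preimage_setT.
move=> k; have [mFk Fkoo] := Foo k; split.
  by rewrite -[X in measurable X]setTI; exact: mg.
rewrite /cons_measure /pushforward (_ : _ @^-1` _ = F k)//.
by apply/seteqP; split=> xv /=; rewrite gK.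
Qed.

HB.instance Definition _ := Measure_isSigmaFinite.Build _ _ _ cons_measure
  cons_measure_sigma_finite.

End step.

Fixpoint lebesgue_rV n : {sigma_finite_measure set 'rV[R]_n -> \bar R} :=
  if n is k.+1 then cons_measure (lebesgue_rV k) else \d_(0%R : 'rV[R]_0).

End lebesgue_measure_rV.

Lemma lebesgue_rV_box (R : realType) n (A : 'I_n -> set R) :
  (forall i, measurable (A i)) ->
  lebesgue_rV n [set v : 'rV[R]_n | forall i, A i (v ord0 i)] =
  (\prod_(i < n) lebesgue_measure (A i))%E.
Proof.
elim: n A => [|n IHn] A mA /=.
  by rewrite big_ord0 diracE mem_set// => -[].
rewrite /cons_measure /pushforward big_ord_recl -IHn//.
set C := [set v : 'rV[R]_n | forall i, A (lift ord0 i) (v ord0 i)].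
have mC : measurable C.
  rewrite (_ : C = \bigcap_(i in [set: 'I_n])
      ((fun v : 'rV[R]_n => v ord0 i) @^-1` A (lift ord0 i))).
    apply: fin_bigcap_measurable => // i _.
    by rewrite -[X in measurable X]setTI; exact: measurable_coord_rV.
  by apply/seteqP; split=> v /= h i; [move=> _; exact: h|exact: (h i I)].
suff -> : @cons_rV R n @^-1` [set v | forall i, A i (v ord0 i)] = A ord0 `*` C.
  by rewrite (product_measure1E (@lebesgue_measure R) (lebesgue_rV n) (mA ord0) mC).
apply/seteqP; split=> -[x v] /=.
  move=> h; split; first by have := h ord0; rewrite mxE unlift_none.
  by move=> i /=; have := h (lift ord0 i); rewrite mxE liftK.
move=> [/= h0 h] i; rewrite mxE; case: (unliftP ord0 i) => [j ->|->] //.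
Qed.

Section domains.
Context {R : realType} {n : nat}.
Implicit Types (u v z e : 'rV[R]_n) (Omega : set 'rV[R]_n).

(* the library norm on 'rV[R]_n is the sup norm, cones need the Euclidean one *)
Definition dot u v : R := \sum_(i < n) u ord0 i * v ord0 i.
Definition enorm u : R := Num.sqrt (dot u u).

(* closed finite right circular cone with vertex z, axis e (a unit vector),
   height h and half-aperture of cosine c *)
Definition finite_cone z e (c h : R) : set 'rV[R]_n :=
  [set y | dot (y - z) e <= h /\ c * enorm (y - z) <= dot (y - z) e].

Definition regular_domain Omega : Prop :=
  forall z, (closure Omega `\` interior Omega) z ->
  exists e (c h : R), [/\ enorm e = 1, 0 < c < 1, 0 < h &
    finite_cone z e c h `<=` ~` Omega].

End domains.

Section operator.
Context {R : realType}.
Implicit Types (rho : R -> R -> R) (T : R) (f g u : R -> R).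

(* rho t r is only meaningful for r > 0 *)
Record hypothesis_H0 rho : Prop := {
  H0_ge0 : forall t r : R, 0 < r -> 0 <= rho t r ;
  H0_continuous : {within [set q : R * R | 0 < q.2],
    continuous (fun q : R * R => rho q.1 q.2)} ;
  H0_derivable : forall t r : R, 0 < r -> derivable (rho^~ r) t 1 ;
  H0_continuous_derive : forall r : R, 0 < r -> continuous (derive1 (rho^~ r)) ;
  H0_int : (\int[lebesgue_measure]_(r in `]0%R, +oo[)
    ((Num.min 1%R r)%:E * ereal_sup (range (fun t => (rho t r)%:E))) < +oo)%E ;
  H0_int_derive : (\int[lebesgue_measure]_(r in `]0%R, +oo[)
    ((Num.min 1%R r)%:E * ereal_sup (range (fun t => (`|derive1 (rho^~ r) t|)%:E)))
      < +oo)%E ;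
  H0_lim : ereal_sup (range (fun t =>
      \int[lebesgue_measure]_(r in `]0%R, delta]) (r * rho t r)%:E)%E)
    @[delta --> 0^'+] --> 0%E ;
  H0_lower : exists epsilon gamma : R, [/\ 0 < epsilon, 0 < gamma &
    forall t r : R, 0 < r -> r < epsilon -> gamma <= rho t r] }.

Definition D_infty rho u : R -> R := fun t =>
  \int[lebesgue_measure]_(r in `]0%R, +oo[) ((u t - u (t - r)) * rho t r).

(* Functions on (-oo, T] are represented by functions R -> R of which only the
   restriction to (-oo, T] matters. *)
Definition C_infty T f : Prop :=
  {within `]-oo, T], continuous f} /\ f x @[x --> -oo] --> 0.

(* one-sided at T *)
Definition is_derivative_upto T f g : Prop := forall t, t <= T ->
  (f x - f t) / (x - t) @[x --> within `]-oo, T] t^'] --> g t.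

Definition C1_infty T f : Prop :=
  C_infty T f /\ exists2 g, is_derivative_upto T f g & C_infty T g.

Record feller_semigroup T (Q : R -> (R -> R) -> (R -> R)) : Prop := {
  feller_stable : forall s f, 0 <= s -> C_infty T f -> C_infty T (Q s f) ;
  feller_linear : forall s a f g, 0 <= s -> C_infty T f -> C_infty T g ->
    forall t, t <= T ->
    Q s (fun x => a * f x + g x) t = a * Q s f t + Q s g t ;
  feller_positive : forall s f, 0 <= s -> C_infty T f ->
    (forall t, t <= T -> 0 <= f t) -> forall t, t <= T -> 0 <= Q s f t ;
  feller_contraction : forall s f M, 0 <= s -> C_infty T f ->
    (forall t, t <= T -> `|f t| <= M) -> forall t, t <= T -> `|Q s f t| <= M ;
  feller_id : forall f, C_infty T f -> forall t, t <= T -> Q 0 f t = f t ;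
  feller_semigroupD : forall s s' f, 0 <= s -> 0 <= s' -> C_infty T f ->
    forall t, t <= T -> Q (s + s') f t = Q s (Q s' f) t ;
  feller_continuous : forall f, C_infty T f ->
    {uniform `]-oo, T], (fun s => Q s f) @ 0^'+ --> f} }.

Definition generator T (Q : R -> (R -> R) -> (R -> R)) : set ((R -> R) * (R -> R)) :=
  [set fg | [/\ C_infty T fg.1, C_infty T fg.2 & {uniform `]-oo, T],
    (fun s t => (Q s fg.1 t - fg.1 t) / s) @ 0^'+ --> fg.2}]].

(* graph of the closure of (A, D) in C_infty(-oo, T] *)
Definition closed_graph T (A : (R -> R) -> (R -> R)) (D : set (R -> R)) :
    set ((R -> R) * (R -> R)) :=
  [set fg | [/\ C_infty T fg.1, C_infty T fg.2 &
    exists u_ : nat -> R -> R, [/\ forall k, D (u_ k),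
      {uniform `]-oo, T], u_ @ \oo --> fg.1} &
      {uniform `]-oo, T], (A \o u_) @ \oo --> fg.2}]]].

Definition generated_by_closure T (Q : R -> (R -> R) -> (R -> R))
    (A : (R -> R) -> (R -> R)) (D : set (R -> R)) : Prop :=
  feller_semigroup T Q /\ generator T Q = closed_graph T A D.

End operator.

Section processes.
Context {R : realType} {d : measure_display} {W : measurableType d}.
Variable P : probability W R.

(* Processes are maps R -> W -> E, only used at nonnegative times. *)

Definition process_sigma {d'} {E : measurableType d'} (I : set R)
    (X : R -> W -> E) : set (set W) :=
  <<s \bigcup_(s in I) preimage_set_system setT (X s) measurable >>.

Definition independent_processes {d1 d2} {E1 : measurableType d1}
    {E2 : measurableType d2} (X : R -> W -> E1) (Y : R -> W -> E2) : Prop :=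
  forall A B, process_sigma `[0, +oo[ X A -> process_sigma `[0, +oo[ Y B ->
  P (A `&` B) = (P A * P B)%E.

(* inf {s > 0 : X s \in A}, equal to +oo if there is no such s *)
Definition hitting_time {E : Type} (X : R -> W -> E) (A : set E) (w : W) : \bar R :=
  ereal_inf [set s%:E | s in [set s : R | 0 < s /\ A (X s w)]].

Record feller_process (T : R) (Q : R -> (R -> R) -> (R -> R)) (t : R)
    (Y : R -> W -> R) : Prop := {
  feller_measurable : forall s, 0 <= s -> measurable_fun setT (Y s) ;
  feller_start : forall w, Y 0 w = t ;
  feller_right_continuous : forall w s, 0 <= s -> Y v w @[v --> s^'+] --> Y s w ;
  feller_left_limits : forall w s, 0 < s -> cvg (Y v w @[v --> s^'-]) ;
  feller_nonincreasing : forall w s s', 0 <= s -> s <= s' -> Y s' w <= Y s w ;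
  feller_markov : forall s v f A, 0 <= s -> 0 <= v -> C_infty T f ->
    process_sigma `[0, s] Y A ->
    (\int[P]_(w in A) (f (Y (s + v) w))%:E =
     \int[P]_(w in A) (Q v f (Y s w))%:E)%E }.

Record hypothesis_H1 (T : R) (Y : R -> R -> W -> R) (p : R -> R -> R -> R) : Prop := {
  H1_abs_continuous : forall t s : R, 0 <= t <= T -> 0 < s ->
    pushforward P (Y t s : W -> measurableTypeR R) `<< lebesgue_measure ;
  H1_density_ge0 : forall t s z : R, 0 <= t <= T -> 0 < s -> 0 <= p s t z ;
  (* joint measurability of the chosen version of the densities, without which
     the integrals over s of p s t z make no sense *)
  H1_density_measurable : forall t : R, 0 <= t <= T ->
    measurable_fun ((`]0, +oo[ : set R) `*` [set: R]) (fun q : R * R => p q.1 t q.2) ;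
  H1_density : forall t s A, 0 <= t <= T -> 0 < s -> measurable A ->
    P (Y t s @^-1` A) = (\int[lebesgue_measure]_(z in A) (p s t z)%:E)%E ;
  H1_jump : forall t : R, 0 < t <= T ->
    let tau0 := hitting_time (Y t) `]-oo, 0] in
    P [set w | (tau0 w < +oo)%E /\ Y t (fine (tau0 w)) w = 0] = 0%E }.

Record brownian_motion n (B : R -> W -> 'rV[R]_n) : Prop := {
  brownian_measurable : forall s, 0 <= s -> measurable_fun setT (B s) ;
  brownian_start : forall w, B 0 w = 0 ;
  brownian_continuous : forall w, {within `[0, +oo[, continuous (B^~ w)} ;
  brownian_independent : forall k (s : nat -> R) (U : nat -> set 'rV[R]_n),
    0 <= s 0%N -> {homo s : i j / (i < j)%N >-> i < j} ->
    (forall i, measurable (U i)) ->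
    P [set w | forall i, (i < k)%N -> U i (B (s i.+1) w - B (s i) w)] =
    (\prod_(i < k) P [set w | U i (B (s i.+1) w - B (s i) w)%R])%E ;
  (* increments are N(0, (s' - s) I) *)
  brownian_gaussian : forall s s' (V : 'I_n -> set R), 0 <= s -> s < s' ->
    (forall i, measurable (V i)) ->
    P [set w | forall i, V i ((B s' w - B s w) ord0 i)] =
    (\prod_(i < n) normal_prob 0%R (Num.sqrt (s' - s)%R) (V i))%E }.

Definition shifted_brownian n (B : R -> W -> 'rV[R]_n) (x : 'rV[R]_n) :
  R -> W -> 'rV[R]_n := fun s w => x + B (2 * s) w.

(* p s x y is the density on Omega at time s of X x killed on leaving Omega *)
Record killed_density n (Omega : set 'rV[R]_n)
    (X : 'rV[R]_n -> R -> W -> 'rV[R]_n)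
    (p : R -> 'rV[R]_n -> 'rV[R]_n -> R) : Prop := {
  killed_density_ge0 : forall s x y, 0 < s -> Omega x -> Omega y ->
    0 <= p s x y ;
  (* joint measurability of the chosen version of the densities, as above *)
  killed_density_measurable : forall x, Omega x ->
    measurable_fun ((`]0, +oo[ : set R) `*` Omega)
      (fun q : R * 'rV[R]_n => p q.1 x q.2) ;
  killed_densityE : forall s x (h : 'rV[R]_n -> R), 0 < s -> Omega x ->
    measurable_fun Omega h -> [bounded h y | y in Omega] ->
    let tau := hitting_time (X x) (~` Omega) in
    ('E_P[fun w => (h (X x s w) * \1_[set w | (s%:E < tau w)%E] w)%R] =
     \int[lebesgue_rV n]_(y in Omega) (h y * p s x y)%:E)%E }.

End processes.

(* The kernel H_{t,x}(r,y); it may take the value +oo (on a null set). *)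
Definition kernel_H {R : realType} {n : nat} (rho : R -> R -> R)
    (pY : R -> R -> R -> R) (pOmega : R -> 'rV[R]_n -> 'rV[R]_n -> R)
    (t : R) (x : 'rV[R]_n) (r : R) (y : 'rV[R]_n) : \bar R :=
  (\int[lebesgue_measure]_(z in `]0%R, t[)
    ((rho z (z - r))%:E *
     \int[lebesgue_measure]_(s in `]0%R, +oo[) (pOmega s x y * pY s t z)%:E))%E.

(* Main.v *)
(** Let [Y] be [-X^{t,(rho)}], [tau0] its first passage below [0], [f] a C^1
    function vanishing outside a bounded interval of negative numbers and [h]
    continuous.  Integrate over [s] the expectation of
    [1_{Y_s > 0} f(Y_{s+e}) h(B_{s+e}) 1_{s+e < tau_Omega} / e].  Pathwise only
    the [s] between [tau0 - e] and [tau0] contribute, so by right continuity the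
    limit as [e -> 0] is [E(f(Y_tau0) h(B_tau0) 1_{tau0 < tau_Omega})].  On the
    other hand, by independence and the Markov property the expectation is that
    of [1_{Y_s > 0} (Q_e f)(Y_s) / e] times a factor depending on [B] only;
    [(Q_e f)/e] converges to [- D_infty f] uniformly on [z > 0], where
    [- D_infty f (z)] is the integral over [r < 0] of [f(r) rho(z, z - r)].
    Tonelli's theorem identifies the limit with the integral of [f h] against
    [H_{t,x}]; a monotone class argument on boxes extends this to bounded
    measurable functions, and (H1) excludes that [Y_tau0] charges [0]. *)
From HB Require Import structures.
Require Import Defs.
From mathcomp Require Import all_boot all_order all_algebra.
From mathcomp Require Import all_classical all_reals all_analysis.
From mathcomp Require Import measurable_realfun.
From mathcomp Require Import lra ring.

Set Implicit Arguments.
Unset Strict Implicit.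
Unset Printing Implicit Defensive.

Import Order.TTheory GRing.Theory Num.Theory.
Import numFieldNormedType.Exports.

Local Open Scope classical_set_scope.
Local Open Scope ring_scope.

(** The random time [tau0] is never conditioned upon: averaging over [s] replaces it by fixed times,
    where the densities, the independence and the simple Markov property apply, so that neither the
    strong Markov property nor a compensator of the jumps enters. The price is an exchange of limit
    and integral on both sides of a Tonelli identity. For each path the average is at most 1,
    because a window of length e carries the weight 1/e; for each [s] the expectation is at most a
    constant, because the generator converges uniformly and [f] vanishes where the jump starts. The
    second bound is integrable in [s] only over a bounded interval, hence an additional killing at a
    deterministic horizon [S], removed at the end by dominated convergence on one side and monotone
    convergence on the other. The kernel may take the value +oo and no bound on it is available
    beforehand; the identities are therefore proved for nonnegative integrands, and the total mass
    of the kernel is read off them before Fubini's theorem is applied to a signed [phi]. *)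

(** * Joint measurability of right-continuous processes *)

Lemma right_continuous_jointly_measurable (R : realType) d
    (W : measurableType d) (X : R -> W -> R) :
  (forall s, measurable_fun setT (X s)) ->
  (forall w s, X v w @[v --> s^'+] --> X s w) ->
  measurable_fun setT (fun q : R * W => X q.1 q.2).
Proof.
move=> mX rcX.
(* [c n s] is the first point of the grid of mesh 1/(n+1) strictly to the right of [s]: at each
   level only countably many times occur, each on a measurable strip, and strictness lets right
   continuity give the limit. *)
pose c (n : nat) (s : R) : R := ((Num.floor (n.+1%:R * s) + 1)%:~R / n.+1%:R).
apply: (@measurable_fun_cvg _ _ _ _ (fun n q => X (c n q.1) q.2)).
- move=> n mT A mA; rewrite setTI.
  rewrite (_ : _ @^-1` A = \bigcup_(k in [set: int])
     (((fun s : R => n.+1%:R * s) @^-1` [set x | Num.floor x = k]) `*`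
       (X ((k + 1)%:~R / n.+1%:R) @^-1` A))); last first.
    apply/seteqP; split=> -[s w]/=.
      by move=> h; exists (Num.floor (n.+1%:R * s)).
    by case=> k _ [/= + +]; rewrite /c /= => ->.
  apply: countable_bigcupT_measurable => [|k]; first exact: countableP.
  apply: measurableX.
    rewrite -[X in measurable X]setTI; apply: (mulrl_measurable n.+1%:R) => //.
    rewrite (_ : [set x | _] = `[k%:~R, (k + 1)%:~R[%classic)//.
    apply/seteqP; split => x /=; rewrite in_itv /=.
      by move=> <-; rewrite floor_le floorD1_gt.
    by move=> h; apply/floor_def.
  by rewrite -[X in measurable X]setTI; exact: mX.
- move=> [s w] _ /=.
  move/cvg_at_rightP : (rcX w s) => /(_ (fun n => c n s)); apply.
  have cb n : s < c n s <= s + n.+1%:R^-1.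
    rewrite /c ltr_pdivlMr// mulrC floorD1_gt /=.
    rewrite ler_pdivrMr// mulrDl mulVf// intrD lerD2r mulrC.
    exact: floor_le.
  split; first by move=> n; have /andP[] := cb n.
  apply: (@squeeze_cvgr _ _ _ _ (fun=> s) (fun n => s + n.+1%:R^-1)).
  - by near=> n; have /andP[/ltW -> ->] := cb n.
  - exact: cvg_cst.
  - rewrite -[X in _ --> X]addr0; apply: cvgD; first exact: cvg_cst.
    exact: cvg_harmonic.
Unshelve. all: by end_near. Qed.

(** Freezing the process at its initial value on negative times keeps it right-continuous and
    defines it on the whole line. *)
Lemma right_continuous_nneg_jointly_measurable (R : realType) d
    (W : measurableType d) (X : R -> W -> R) :
  (forall s, 0 <= s -> measurable_fun setT (X s)) ->
  (forall w s, 0 <= s -> X v w @[v --> s^'+] --> X s w) ->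
  measurable_fun setT (fun q : R * W => X (Num.max 0 q.1) q.2).
Proof.
move=> mX rcX.
apply: (@right_continuous_jointly_measurable _ _ _ (fun s => X (Num.max 0 s))).
  by move=> s; apply: mX; rewrite le_max lexx.
move=> w s; have [s0|s0] := leP 0 s.
  apply: cvg_trans (rcX w s s0); apply: near_eq_cvg; near=> v.
  by rewrite max_r// (le_trans s0)// ltW.
apply: cvg_near_cst; near=> v.
by rewrite max_l//; apply: ltW; near: v; exact: nbhs_right_lt.
Unshelve. all: by end_near. Qed.

Lemma right_continuous_indicator_lt (R : realType) (e : \bar R) (s : R) :
  ((v%:E < e)%E%:R : R) @[v --> s^'+] --> ((s%:E < e)%E%:R : R).
Proof.
apply: cvg_near_cst; have [se|es] := ltP s%:E e; near=> v.
  rewrite (_ : (v%:E < e)%E = true)//; near: v.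
  case: e se => [r| |]//; first by rewrite lte_fin => sr; exact: nbhs_right_lt.
  by move=> _; apply: nearW => v; rewrite ltry.
rewrite (_ : (v%:E < e)%E = false)//; apply/negbTE; rewrite -leNgt.
by rewrite (le_trans es)// lee_fin ltW.
Unshelve. all: by end_near. Qed.

(** * Measurability of open sets of row vectors *)

Lemma measurable_ball_rV (R : realType) n (v : 'rV[R]_n) (e : R) :
  measurable (ball v e : set 'rV[R]_n).
Proof.
have [e0|e0] := ltP 0 e; last first.
  rewrite (_ : (ball v e : set _) = set0)//; apply/seteqP; split => // u [].
  by rewrite ltNge e0.
rewrite (_ : (ball v e : set 'rV[R]_n) = \bigcap_(i in [set: 'I_n])
    ((fun u : 'rV[R]_n => u ord0 i) @^-1` ball (v ord0 i) e)).
  apply: fin_bigcap_measurable => // i _.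
  rewrite -[X in measurable X]setTI; apply: measurable_coord_rV => //.
  exact: measurable_ball.
apply/seteqP; split => u; rewrite /ball/= /mx_ball.
  by move=> [_ h] i _; exact: h.
by move=> h; split => // i j; rewrite ord1; exact: h.
Qed.

(** The sigma-algebra comes from the coordinates and not from the topology. Balls of the sup norm
    are boxes, hence measurable, and an open set is the countable union of the balls of rational
    centre and radius 1/(k+1) that it contains. *)
Lemma open_measurable_rV (R : realType) n (U : set 'rV[R]_n) :
  open U -> measurable U.
Proof.
move=> oU.
pose D := [set qk : 'rV[rat]_n * nat |
  ball (map_mx ratr qk.1 : 'rV[R]_n) qk.2.+1%:R^-1 `<=` U].
rewrite (_ : U = \bigcup_(qk in [set: 'rV[rat]_n * nat])
   (if `[< D qk >] then
   (ball (map_mx ratr qk.1 : 'rV[R]_n) qk.2.+1%:R^-1 : set 'rV[R]_n) else set0)).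
  apply: countable_bigcupT_measurable => [|k]; first exact: countableP.
  by case: ifP => // _; exact: measurable_ball_rV.
apply/seteqP; split=> [y Uy|y [qk _]]; last first.
  by case: ifPn => // /asboolP; apply.
have /nbhs_ballP[e /= e0 yeU] := open_nbhs_nbhs (conj oU Uy).
have [k ke] : exists k, k.+1%:R^-1 < e / 2.
  have [k] := @ltr_add_invr R 0 (e/2) (divr_gt0 e0 (ltr0Sn _ 1)).
  by rewrite add0r; exists k.
have /choice[q hq] : forall i, exists q : rat, ball (y ord0 i) k.+1%:R^-1 (ratr q : R).
  move=> i.
  have [q] := @rat_in_itvoo R (y ord0 i) (y ord0 i + k.+1%:R^-1) ltac:(by rewrite ltrDl).
  rewrite in_itv/= => /andP[q1 q2]; exists q; rewrite /ball/= distrC ger0_norm ?subr_ge0 ?ltrBlDl ?ltW//.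
exists (\row_i q i, k) => //.
rewrite ifT; last first.
  apply/asboolP => z /= qz; apply: yeU.
  rewrite /ball/= /mx_ball; split => // i j; rewrite ord1.
  have := qz.2 ord0 j; have := hq j; rewrite !mxE /ball/=.
  move=> h1 h2.
  rewrite (le_lt_trans (ler_distD (ratr (q j)) _ _))// (splitr e).
  by rewrite ltrD// ?(lt_trans h1)// (lt_trans h2).
by split => // i j; rewrite ord1 !mxE; exact/ball_sym.
Qed.

(** * First passage of a nonincreasing path *)

Section hitting_time_nonincreasing.
Context {R : realType} {d} {W : measurableType d}.
Variables (Y : R -> W -> R) (w : W).
Hypothesis Y0 : 0 < Y 0 w.
Hypothesis rcY : forall s : R, 0 <= s -> Y v w @[v --> s^'+] --> Y s w.
Hypothesis niY : forall s s' : R, 0 <= s -> s <= s' -> Y s' w <= Y s w.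
Let tau := hitting_time Y `]-oo, 0] w.

(** A nonincreasing path that is <= 0 once stays so, and right continuity forbids [tau = s] when
    [Y s w > 0]. Every event about [tau] thus becomes one about the process at a fixed time. *)
Lemma lt_hitting_time_nonincreasing s : 0 <= s -> (s%:E < tau)%E = (0 < Y s w).
Proof.
move=> s0; apply/idP/idP => [|Ys].
  apply: contraTT; rewrite -!leNgt => Ys.
  have sgt0 : 0 < s by rewrite lt_neqAle s0 andbT; apply/eqP => s00; move: Ys; rewrite -s00 leNgt Y0.
  by apply: ereal_inf_lbound; exists s => //=; rewrite in_itv.
have : \forall v \near s^'+, 0 < Y v w.
  by apply: (cvgr_gt _ (rcY s0)).
move=> [e /= e0 he].
have se : s < s + e / 2 by rewrite ltrDl divr_gt0.
have : 0 < Y (s + e/2) w.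
  apply: he => //=; rewrite /ball_/= distrC ger0_norm; lra.
move=> hse; apply: (@lt_le_trans _ _ (s + e / 2)%:E); first by rewrite lte_fin.
apply: le_ereal_inf_tmp => _ [u /= [u0 +] <-]; rewrite in_itv /= => Yu.
rewrite lee_fin leNgt; apply/negP => ule.
have := niY (ltW u0) (ltW ule); lra.
Qed.

Lemma hitting_time_nonincreasing_gt0 : (0 < tau)%E.
Proof. by rewrite lt_hitting_time_nonincreasing. Qed.

Lemma hitting_time_nonincreasing_le0 : (tau < +oo)%E -> Y (fine tau) w <= 0.
Proof.
move=> ty; have t0 := hitting_time_nonincreasing_gt0.
have tf : tau \is a fin_num by rewrite ge0_fin_numE// ltW.
rewrite leNgt; apply/negP; rewrite -lt_hitting_time_nonincreasing ?fine_ge0 ?ltW//.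
by rewrite fineK// ltxx.
Qed.

End hitting_time_nonincreasing.

(** * Exit time of a continuous path from an open set *)

Section exit_time.
Context {R : realType} {d} {W : measurableType d} {n : nat}.
Variables (X : R -> W -> 'rV[R]_n) (U : set 'rV[R]_n).
Hypothesis oU : open U.
Hypothesis cX : forall w : W, {within `[0, +oo[, continuous (X^~ w)}.
Hypothesis X0 : forall w, U (X 0 w).
Let tau := hitting_time X (~` U).

Let near_path w (s : R) (A : set 'rV[R]_n) : 0 <= s -> open A -> A (X s w) ->
  exists2 e : R, 0 < e & forall v : R, 0 <= v -> `|s - v| < e -> A (X v w).
Proof.
move=> s0 oA As; have cw : {within `[0, +oo[, continuous (X^~ w)} by exact: cX.
move/subspace_continuousP : cw => /(_ s).
have s0' : `[0, +oo[%classic s by rewrite /= in_itv/= s0.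
move=> /(_ s0') /(_ A (open_nbhs_nbhs (conj oA As))).
move=> /nbhs_ballP[e /= e0 he]; exists e => // v v0 sv.
by apply: he => //=; rewrite in_itv/= v0.
Qed.

Lemma lt_exit_time w (s : R) : 0 < s -> (s%:E < tau w)%E -> U (X s w).
Proof.
move=> s0; apply: contraPP => nU; apply/negP; rewrite -leNgt.
by apply: ereal_inf_lbound; exists s.
Qed.

(** Since [U] is open, a path in [U] on [0, s] stays there a little longer, which makes the
    inequality strict. [X0] covers time 0, which the infimum over positive times does not see. *)
Lemma lt_exit_timeP w (s : R) : 0 <= s ->
  (s%:E < tau w)%E <-> forall u : R, 0 <= u <= s -> U (X u w).
Proof.
move=> s0; split=> [st u /andP[u0 us]|h].
  move: u0; rewrite le_eqVlt => /predU1P[<-//|u0].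
  by apply: lt_exit_time => //; apply: le_lt_trans st; rewrite lee_fin.
have [e e0 he] := near_path s0 oU (h s ltac:(rewrite s0 lexx//)).
apply: (@lt_le_trans _ _ (s + e)%:E); first by rewrite lte_fin ltrDl.
apply: le_ereal_inf_tmp => _ [u /= [u0 nU] <-].
rewrite lee_fin leNgt; apply/negP => us; apply: nU.
have [{}us'|su] := leP u s; first by apply: h; rewrite us' ltW.
apply: he; first exact: ltW.
by rewrite distrC gtr0_norm ?subr_gt0// ltrBlDl.
Qed.

Lemma exit_time_gt0 w : (0 < tau w)%E.
Proof.
by apply/(lt_exit_timeP _ (lexx 0)) => u /le_anti <-.
Qed.

Let nbd (k : nat) : set 'rV[R]_n := \bigcup_(c in ~` U) ball c k.+1%:R^-1.

Let open_nbd k : open (nbd k).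
Proof. by apply: bigcup_open => c _; exact: ball_open. Qed.

(* By compactness of [[0, s]], a path that stays in [U] up to time [s] keeps a
   positive distance to the complement, which rational times detect. *)
Lemma measurable_lt_exit_time (s : R) :
  (forall s : R, 0 <= s -> measurable_fun setT (X s)) -> 0 <= s ->
  measurable [set w | (s%:E < tau w)%E].
Proof.
move=> mX s0.
rewrite (_ : [set w | _] = \bigcup_k \bigcap_(q in [set: rat])
   [set w | 0 <= (ratr q : R) <= s -> (~` nbd k) (X (ratr q) w)]).
  apply: bigcupT_measurable => k; rewrite -[X in measurable X]setCK setC_bigcap; apply: measurableC.
  apply: countable_bigcupT_measurable => [|q]; first exact: countableP.
  apply: measurableC.
  have [/andP[q0 qs]|nqs] := pselect (0 <= (ratr q : R) <= s); last first.
    rewrite (_ : [set w | _] = setT); first exact: measurableT.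
    by apply/seteqP; split => // w _ /nqs.
  rewrite (_ : [set w | _] = X (ratr q) @^-1` (~` nbd k)); last first.
    by apply/seteqP; split=> w /= h => [|_]; [apply: h; rewrite q0|].
  rewrite -[X in measurable X]setTI; apply: mX => //; apply: measurableC.
  exact: open_measurable_rV.
apply/seteqP; split=> w /=.
  move=> /(lt_exit_timeP _ s0) h.
  have : compact `[0, s] by exact: segment_compact.
  (* Compactness in covering form: what holds near each [u] for all large [k] holds on the whole of
     [0, s] for one [k]. *)
  move/compact_near_coveringP => /(_ nat \oo (fun k u => 0 <= u <= s -> (~` nbd k) (X u w)) _).
  case.
    move=> u /=; rewrite in_itv/= => us.
    have Uu := h u us.
    have /nbhs_ballP[e /= e0 he] := open_nbhs_nbhs (conj oU Uu).
    have e20 : 0 < e / 2 by rewrite divr_gt0.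
    have [r r0 hr] := near_path (andP us).1 (ball_open (X u w) (e / 2)) (ballxx (X u w) e20).
    have [k] := @ltr_add_invr R 0 (e/2) e20; rewrite add0r => ke.
    exists (ball u r, [set m | (k <= m)%N]).
      by split; [exact: nbhsx_ballx|exists k].
    move=> [v m] /= [uv km] /andP[v0 vs] [c nUc cv].
    apply: nUc; apply: he.
    apply: (@ball_split _ _ (X v w)).
      by apply: hr.
    apply: ball_sym; apply: (le_ball _ cv); apply: le_trans (ltW ke).
    by rewrite lef_pV2 ?posrE// ler_nat.
  move=> k _ /(_ k (leqnn k)) hk; exists k => // q _ qs; exact: hk.
move=> [k _ h]; apply/(lt_exit_timeP _ s0) => u /andP[u0 us].
apply: contrapT => nUu.
move: u0; rewrite le_eqVlt => /predU1P[u0|u0]; first by apply: nUu; rewrite -u0.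
have nuk : nbd k (X u w) by exists (X u w) => //; exact: ballxx.
have [e e0 he] := near_path (ltW u0) (@open_nbd k) nuk.
(* The rational time is taken to the left of [u], so that it remains in [0, s] also when [u = s]. *)
have [q] := @rat_in_itvoo R (Num.max 0 (u - e)) u ltac:(by rewrite gt_max u0 ltrBlDr ltrDl).
rewrite in_itv/= gt_max => /andP[/andP[q0 q1] q2].
have := h q I; rewrite (ltW q0) (ltW (lt_le_trans q2 us)) => /(_ isT); apply.
by apply: he; rewrite ?(ltW q0)// gtr0_norm ?subr_gt0// ltrBlDr -ltrBlDl.
Qed.

End exit_time.

(** * Densities, Tonelli's theorem and independence for nonnegative integrands *)

Section generic_integration.
Local Open Scope ereal_scope.
Context {R : realType}.
Import HBNNSimple.

(** Simple functions first, then monotone convergence. It serves with [Z] the identity for a law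
    that has a density, and with general [Z] for weighted images. *)
Lemma ge0_integral_density d' d (T' : measurableType d') (T : measurableType d)
    (m : {measure set T -> \bar R}) (mu : {measure set T' -> \bar R})
    (Z : T' -> T) (p : T' -> \bar R) (F : T -> \bar R) :
  measurable_fun setT Z ->
  measurable_fun setT p -> (forall x, 0 <= p x) ->
  (forall A, measurable A -> m A = \int[mu]_(x in Z @^-1` A) p x) ->
  measurable_fun setT F -> (forall x, 0 <= F x) ->
  \int[m]_x F x = \int[mu]_x (F (Z x) * p x).
Proof.
move=> mZ mp p0 mE mF F0.
pose F_ := nnsfun_approx measurableT mF.
have nd : nondecreasing_seq (F_ : (T -> R)^nat) by exact: nd_nnsfun_approx.
have cF x : EFin \o F_ ^~ x @ \oo --> F x.
  by apply: cvg_nnsfun_approx => //.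
have mFZ m' : measurable_fun setT (fun x => (F_ m' (Z x))%:E).
  apply/measurable_EFinP; apply: (measurableT_comp _ mZ); exact: measurable_funP.
transitivity (limn (fun n => \int[m]_x (F_ n x)%:E)).
  rewrite -monotone_convergence//.
  - by apply: eq_integral => x _; apply/esym/cvg_lim => //; exact: cF.
  - by move=> n; exact/measurable_EFinP/measurable_funP.
  - by move=> n x _; rewrite lee_fin; apply: fun_ge0.
  - by move=> x _ a b ab; rewrite lee_fin; exact/lefP/nd.
transitivity (limn (fun n => \int[mu]_x ((F_ n (Z x))%:E * p x))); last first.
  rewrite -monotone_convergence//.
  - apply: eq_integral => x _; apply/cvg_lim => //.
    (* The product of extended limits requires that 0 times infinity be excluded, so a vanishing
       factor is treated separately. *)
    have [px0|px0] := eqVneq (p x) 0.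
      by rewrite px0 mule0; under eq_fun do rewrite mule0; exact: cvg_cst.
    have [Fx0|Fx0] := eqVneq (F (Z x)) 0.
      rewrite Fx0 mul0e (_ : (fun _ => _) = cst 0); first exact: cvg_cst.
      apply/funext => n; rewrite (_ : (F_ n (Z x))%:E = 0) ?mul0e//.
      apply/eqP; rewrite eq_le; apply/andP; split.
        by rewrite -Fx0 /F_ nnsfun_approxE le_approx.
      by rewrite lee_fin; apply: fun_ge0.
    apply: cvgeM; [|exact: cF|exact: cvg_cst].
    by rewrite mule_defE (negbTE px0) (negbTE Fx0).
  - by move=> n; apply: emeasurable_funM.
  - by move=> n x _; rewrite mule_ge0// lee_fin; apply: fun_ge0.
  - move=> x _ a b ab; apply: lee_wpmul2r => //.
    by rewrite lee_fin; exact/lefP/nd.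
congr (limn _); apply/funext => n.
rewrite integralT_nnsfun sintegralE.
have mZk j : measurable (Z @^-1` (F_ n @^-1` [set j])).
  by rewrite -[X in measurable X]setTI; exact: mZ.
transitivity (\sum_(k \in range (F_ n))
    \int[mu]_x ((k * \1_(F_ n @^-1` [set k]) (Z x))%:E * p x)).
  apply: eq_fsbigr => k; rewrite inE => -[t _ <-].
  under eq_integral do rewrite EFinM -muleA.
  rewrite ge0_integralZl//.
  - congr (_ * _); rewrite mE//.
    rewrite integral_mkcond; apply: eq_integral => x _.
    rewrite patchE indicE (_ : (x \in _) = (Z x \in F_ n @^-1` [set F_ n t])).
      by case: ifP => _; rewrite ?mul1e ?mul0e.
    by apply/idP/idP; rewrite !inE.
  - apply: emeasurable_funM => //; apply/measurable_EFinP.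
    by apply: measurableT_comp => //; exact: measurable_indic.
  - by move=> x _; rewrite mule_ge0// lee_fin.
  - by rewrite lee_fin; apply: fun_ge0.
rewrite -ge0_integral_fsum//.
- apply: eq_integral => x _; rewrite -ge0_mule_fsuml; last first.
    by move=> k; rewrite nnfun_muleindic_ge0.
  by rewrite fsumEFin// -fimfunE.
- move=> k; apply: emeasurable_funM => //; apply/measurable_EFinP.
  apply: measurable_funM => //.
  by apply: measurableT_comp => //; exact: measurable_indic.
- by move=> k x _; rewrite mule_ge0// nnfun_muleindic_ge0.
Qed.

Section tonelli.
Context d1 d2 (T1 : measurableType d1) (T2 : measurableType d2).
Variables (m1 : {sigma_finite_measure set T1 -> \bar R})
  (m2 : {sigma_finite_measure set T2 -> \bar R}).
Variable f : T1 -> T2 -> \bar R.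
Hypothesis mf : measurable_fun setT (fun q : T1 * T2 => f q.1 q.2).
Hypothesis f0 : forall x y, 0 <= f x y.

Lemma tonelli_swap : \int[m1]_x \int[m2]_y f x y = \int[m2]_y \int[m1]_x f x y.
Proof. exact: (@fubini_tonelli _ _ _ _ _ m1 m2 (fun q => f q.1 q.2)). Qed.

Lemma measurable_tonelli : measurable_fun setT (fun x => \int[m2]_y f x y).
Proof.
exact: (@measurable_fun_fubini_tonelli_F _ _ _ _ _ m2 (fun q => f q.1 q.2)).
Qed.

End tonelli.

(** In the application [s] is time, [y] the position of the killed path, [z] the position before the
    jump and [u] the landing point; up to test functions, [A], [B] and [C] are the killed density,
    the density of the process and the jump rate. The measurability part also justifies the exchange
    of [u] and [y]. *)
Lemma tonelli_kernel dS dY dZ dU (S : measurableType dS) (Y : measurableType dY)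
    (Z : measurableType dZ) (U : measurableType dU)
    (mS : {sigma_finite_measure set S -> \bar R})
    (mY : {sigma_finite_measure set Y -> \bar R})
    (mZ : {sigma_finite_measure set Z -> \bar R})
    (mU : {sigma_finite_measure set U -> \bar R})
    (A : S -> Y -> \bar R) (B : S -> Z -> \bar R) (C : Z -> U -> \bar R) :
  measurable_fun setT (fun q : S * Y => A q.1 q.2) -> (forall s y, 0 <= A s y) ->
  measurable_fun setT (fun q : S * Z => B q.1 q.2) -> (forall s z, 0 <= B s z) ->
  measurable_fun setT (fun q : Z * U => C q.1 q.2) -> (forall z u, 0 <= C z u) ->
  measurable_fun setT
    (fun q : U * Y => \int[mZ]_z (C z q.1 * \int[mS]_s (A s q.2 * B s z))) /\
  \int[mS]_s ((\int[mY]_y A s y) * \int[mZ]_z (B s z * \int[mU]_u C z u)) =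
  \int[mU]_u \int[mY]_y \int[mZ]_z (C z u * \int[mS]_s (A s y * B s z)).
Proof.
move=> mA A0 mB B0 mC C0.
have comp2 d' (T' : measurableType d') d1 (T1 : measurableType d1) d2
    (T2 : measurableType d2) (f : T1 -> T2 -> \bar R) (g : T' -> T1) (h : T' -> T2) :
    measurable_fun setT (fun q : T1 * T2 => f q.1 q.2) ->
    measurable_fun setT g -> measurable_fun setT h ->
    measurable_fun setT (fun x => f (g x) (h x)).
  by move=> mf mg mh; exact: (measurableT_comp mf (measurable_fun_pair mg mh)).
have p11 d' d1 d2 (T1 : measurableType d') (T2 : measurableType d1) (T3 : measurableType d2) :
    measurable_fun setT (fun q : T1 * T2 * T3 => q.1.1).
  exact: measurableT_comp measurable_fst measurable_fst.
have p12 d' d1 d2 (T1 : measurableType d') (T2 : measurableType d1) (T3 : measurableType d2) :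
    measurable_fun setT (fun q : T1 * T2 * T3 => q.1.2).
  exact: measurableT_comp measurable_snd measurable_fst.
pose c z := \int[mU]_u C z u.
have mc : measurable_fun setT c by exact: measurable_tonelli.
have c0 z : 0 <= c z by apply: integral_ge0.
pose K y z := \int[mS]_s (A s y * B s z).
have K0 y z : 0 <= K y z by apply: integral_ge0 => s _; exact: mule_ge0.
have mK : measurable_fun setT (fun q : Y * Z => K q.1 q.2).
  apply: (@measurable_tonelli _ _ _ _ mS (fun (q : Y * Z) s => A s q.1 * B s q.2)).
    apply: emeasurable_funM.
      exact: (comp2 _ _ _ _ _ _ A _ _ mA measurable_snd (p11 _ _ _ _ _ _)).
    exact: (comp2 _ _ _ _ _ _ B _ _ mB measurable_snd (p12 _ _ _ _ _ _)).
  by move=> *; exact: mule_ge0.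
have mAs s : measurable_fun setT (A s) by exact: (comp2 _ _ _ _ _ _ A _ _ mA (@measurable_cst _ _ _ _ _ _) (@measurable_id _ _ _)).
have mAy y : measurable_fun setT (A ^~ y) by exact: (comp2 _ _ _ _ _ _ A _ _ mA (@measurable_id _ _ _) (@measurable_cst _ _ _ _ _ _)).
have mBs s : measurable_fun setT (B s) by exact: (comp2 _ _ _ _ _ _ B _ _ mB (@measurable_cst _ _ _ _ _ _) (@measurable_id _ _ _)).
have mBz z : measurable_fun setT (B ^~ z) by exact: (comp2 _ _ _ _ _ _ B _ _ mB (@measurable_id _ _ _) (@measurable_cst _ _ _ _ _ _)).
have mCz z : measurable_fun setT (C z) by exact: (comp2 _ _ _ _ _ _ C _ _ mC (@measurable_cst _ _ _ _ _ _) (@measurable_id _ _ _)).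
have mKy y : measurable_fun setT (K y) by exact: (comp2 _ _ _ _ _ _ K _ _ mK (@measurable_cst _ _ _ _ _ _) (@measurable_id _ _ _)).
have mJ : measurable_fun setT (fun q : U * Y => \int[mZ]_z (C z q.1 * K q.2 z)).
  apply: (@measurable_tonelli _ _ _ _ mZ (fun (q : U * Y) z => C z q.1 * K q.2 z)).
    apply: emeasurable_funM.
      exact: (comp2 _ _ _ _ _ _ C _ _ mC measurable_snd (p11 _ _ _ _ _ _)).
    exact: (comp2 _ _ _ _ _ _ K _ _ mK (p12 _ _ _ _ _ _) measurable_snd).
  by move=> *; exact: mule_ge0.
split; first exact: mJ.
pose b s := \int[mZ]_z (B s z * c z).
have b0 s : 0 <= b s by apply: integral_ge0 => z _; exact: mule_ge0.
have mb : measurable_fun setT b.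
  apply: (@measurable_tonelli _ _ _ _ mZ (fun s z => B s z * c z)).
    by apply: emeasurable_funM => //; exact: measurableT_comp.
  by move=> *; exact: mule_ge0.
transitivity (\int[mS]_s \int[mY]_y (A s y * b s)).
  by apply: eq_integral => s _; rewrite ge0_integralZr.
rewrite tonelli_swap; last first.
- by move=> *; exact: mule_ge0.
- by apply: emeasurable_funM => //; exact: measurableT_comp.
transitivity (\int[mY]_y \int[mU]_u \int[mZ]_z (C z u * K y z)); last first.
  rewrite tonelli_swap//.
  - by apply: (comp2 _ _ _ _ _ _ (fun u y => \int[mZ]_z (C z u * K y z))).
  - by move=> y u; apply: integral_ge0 => z _; exact: mule_ge0.
apply: eq_integral => y _.
transitivity (\int[mS]_s \int[mZ]_z (A s y * (B s z * c z))).
  apply: eq_integral => s _; rewrite ge0_integralZl//.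
  - by apply: emeasurable_funM.
  - by move=> z _; exact: mule_ge0.
rewrite tonelli_swap; last first.
- by move=> s z; rewrite !mule_ge0.
- apply: emeasurable_funM; first exact: comp2.
  by apply: emeasurable_funM => //; exact: measurableT_comp.
transitivity (\int[mZ]_z \int[mU]_u (C z u * K y z)); last first.
  rewrite tonelli_swap//.
  - by apply: emeasurable_funM => //; exact: measurableT_comp.
  - by move=> z u; exact: mule_ge0.
apply: eq_integral => z _.
rewrite ge0_integralZr// muleC -ge0_integralZr//.
- by apply: eq_integral => s _; rewrite muleA.
- by apply: emeasurable_funM.
- by move=> s _; exact: mule_ge0.
- exact: c0.
Qed.

(** The law of the pair is the product of the two laws, as both agree on rectangles; Tonelli's
    theorem then splits the integral. *)
Lemma ge0_integral_independentM d (W : measurableType d) (P : probability W R)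
    (U V : W -> R) :
  measurable_fun setT U -> measurable_fun setT V ->
  (forall w, 0 <= U w)%R -> (forall w, 0 <= V w)%R ->
  (forall A B, measurable A -> measurable B ->
    P (U @^-1` A `&` V @^-1` B) = P (U @^-1` A) * P (V @^-1` B)) ->
  \int[P]_w (U w * V w)%:E = \int[P]_w (U w)%:E * \int[P]_w (V w)%:E.
Proof.
move=> mU mV U0 V0 UV.
pose fU : {mfun W >-> R} := HB.pack U (isMeasurableFun.Build _ _ _ _ _ mU).
pose fV : {mfun W >-> R} := HB.pack V (isMeasurableFun.Build _ _ _ _ _ mV).
have mUV := measurable_fun_pair mU mV.
pose fUV : {mfun W >-> (R * R)%type} :=
  HB.pack (fun w => (U w, V w)) (isMeasurableFun.Build _ _ _ _ _ mUV).
pose PU := distribution P fU. pose PV := distribution P fV.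
pose PUV := distribution P fUV.
(* The absolute value makes the integrand nonnegative on the whole line and changes nothing on the
   values of [U] and [V]. *)
pose a (x : R) := `|x|%:E.
have ma : measurable_fun setT a by apply: measurableT_comp => //; exact/measurable_EFinP/normr_measurable.
have a0 x : 0 <= a x by rewrite lee_fin.
transitivity (\int[PUV]_q (a q.1 * a q.2)).
  rewrite /PUV ge0_integral_distribution//=.
  - by apply: eq_integral => w _; rewrite /a /= !ger0_norm// EFinM.
  - by apply: emeasurable_funM; exact: measurableT_comp.
  - by move=> q; exact: mule_ge0.
transitivity (\int[PU \x PV]_q (a q.1 * a q.2)).
  apply: eq_measure_integral => A mA _; apply/esym.
  by apply: product_measure_unique => // A1 A2 mA1 mA2; exact: UV.
rewrite fubini_tonelli1/=; last 2 first.
- by apply: emeasurable_funM; exact: measurableT_comp.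
- by move=> q; exact: mule_ge0.
transitivity (\int[PU]_x (a x * \int[PV]_y a y)).
  by apply: eq_integral => x _; rewrite -ge0_integralZl.
rewrite ge0_integralZr//; last by apply: integral_ge0.
congr (_ * _); rewrite ge0_integral_distribution//;
  by apply: eq_integral => w _; rewrite /a/= ger0_norm.
Qed.

End generic_integration.

(** * C^1 approximation of indicators of open intervals *)

Section test_functions.
Context {R : realType}.
Implicit Types a b x : R.

(** Squaring removes the kink of the positive part: the first-order error for an increment z is at
    most z^2, whatever the signs. [c] is 1 or -1, which covers both factors of [bump]. *)
Let is_derive_sqr_max0 (c k x : R) : c ^+ 2 = 1 ->
  is_derive x 1 (fun x : R => Num.max 0 (c * x + k) ^+ 2)
    (2 * c * Num.max 0 (c * x + k)).
Proof.
move=> c1.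
have cv : h^-1 *: (Num.max 0 (c * (h *: 1 + x) + k) ^+ 2 - Num.max 0 (c * x + k) ^+ 2)
    @[h --> 0^'] --> 2 * c * Num.max 0 (c * x + k).
  apply/cvgrPdist_le => e e0.
  near=> h.
  have h0 : h != 0 by near: h; exact: nbhs_dnbhs_neq.
  have he : `|h| <= e.
    near: h; apply: nbhs_dnbhs; apply/nbhs_ballP; exists e => // h.
    by rewrite /ball/= sub0r normrN => /ltW.
  apply: le_trans he; rewrite /GRing.scale/= mulr1.
  set y := c * x + k.
  have -> : c * (h + x) + k = y + c * h by rewrite /y; ring.
  have -> : 2 * c * Num.max 0 y - h^-1 * (Num.max 0 (y + c * h) ^+ 2 - Num.max 0 y ^+ 2) =
    h^-1 * (2 * c * Num.max 0 y * h - (Num.max 0 (y + c * h) ^+ 2 - Num.max 0 y ^+ 2)).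
    by field.
  rewrite normrM normfV ler_pdivrMl ?normr_gt0// -normrM -expr2 [X in _ <= X]ger0_norm ?sqr_ge0//.
  have -> : 2 * c * Num.max 0 y * h = 2 * Num.max 0 y * (c * h) by ring.
  have -> : h ^+ 2 = (c * h) ^+ 2 by rewrite exprMn c1 mul1r.
  move: (c * h) => z; rewrite ler_norml.
  by have [y0|y0] := leP 0 y; have [hx|hx] := leP 0 (y + z); nra.
apply: DeriveDef; first by apply/cvg_ex; exists (2 * c * Num.max 0 (c * x + k)).
exact: cvg_lim cv.
Unshelve. all: by end_near. Qed.

Definition bump a b x : R := Num.max 0 (x - a) ^+ 2 * Num.max 0 (b - x) ^+ 2.

Definition dbump a b x : R :=
  2 * Num.max 0 (x - a) * Num.max 0 (b - x) ^+ 2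
  - 2 * Num.max 0 (x - a) ^+ 2 * Num.max 0 (b - x).

(** With u for [bump a b x], the quotient n u / (1 + n u) increases with n to 1 where u > 0 and
    stays 0 elsewhere: the indicator of ]a, b[ is approximated from below by C^1 functions with
    values in [0, 1]. *)
Definition test_fun a b n x : R := n%:R * bump a b x / (1 + n%:R * bump a b x).

Definition dtest_fun a b n x : R :=
  n%:R * dbump a b x / (1 + n%:R * bump a b x) ^+ 2.

Lemma bump_ge0 a b x : 0 <= bump a b x.
Proof. by rewrite mulr_ge0// sqr_ge0. Qed.

Lemma test_fun_den_gt0 a b n x : 0 < 1 + n%:R * bump a b x.
Proof. by rewrite ltr_pwDl// mulr_ge0// bump_ge0. Qed.

Lemma test_fun_ge0 a b n x : 0 <= test_fun a b n x.
Proof.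
apply: divr_ge0; last exact/ltW/test_fun_den_gt0.
by rewrite mulr_ge0// bump_ge0.
Qed.

Lemma test_fun_le1 a b n x : test_fun a b n x <= 1.
Proof. by rewrite ler_pdivrMr ?test_fun_den_gt0// mul1r lerDr. Qed.

Lemma bump_out a b x : x <= a \/ b <= x -> bump a b x = 0 /\ dbump a b x = 0.
Proof.
rewrite /bump /dbump => -[h|h].
  by rewrite (_ : Num.max 0 (x - a) = 0) ?expr0n/= ?mul0r ?mulr0 ?mul0r ?subr0//;
    apply/max_idPl; rewrite subr_le0.
by rewrite (_ : Num.max 0 (b - x) = 0) ?expr0n/= ?mul0r ?mulr0 ?mul0r ?subr0//;
    apply/max_idPl; rewrite subr_le0.
Qed.

Lemma test_fun_out a b n x : x <= a \/ b <= x -> test_fun a b n x = 0.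
Proof. by move=> /bump_out[h _]; rewrite /test_fun h mulr0 mul0r. Qed.

Lemma dtest_fun_out a b n x : x <= a \/ b <= x -> dtest_fun a b n x = 0.
Proof. by move=> /bump_out[_ h]; rewrite /dtest_fun h mulr0 mul0r. Qed.

Lemma test_funE a b n x : test_fun a b n x = 1 - (1 + n%:R * bump a b x)^-1.
Proof.
rewrite /test_fun; have := lt0r_neq0 (test_fun_den_gt0 a b n x).
move=> h; rewrite -[X in _ = X - _](divff h) -[X in _ = _ - X]mul1r -mulrBl.
by rewrite addrAC subrr add0r.
Qed.

Lemma test_fun_nd a b x : nondecreasing_seq (test_fun a b ^~ x).
Proof.
move=> m n mn; rewrite !test_funE lerD2l lerN2 lef_pV2 ?posrE ?test_fun_den_gt0//.
by rewrite lerD2l ler_wpM2r ?bump_ge0// ler_nat.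
Qed.

Lemma test_fun_cvg a b x : test_fun a b n x @[n --> \oo] --> (\1_(`]a, b[) x : R).
Proof.
rewrite indicE mem_setE in_itv/=.
have [/andP[ax xb]|] := boolP (a < x < b); last first.
  rewrite negb_and -!leNgt => /orP h.
  by under eq_fun do rewrite test_fun_out//; exact: cvg_cst.
have u0 : 0 < bump a b x.
  by rewrite mulr_gt0// exprn_gt0// lt_max subr_gt0 ?ax ?xb orbT.
suff : 1 - (1 + n%:R * bump a b x)^-1 @[n --> \oo] --> 1 - (0 : R).
  by rewrite subr0; under eq_fun do rewrite -test_funE.
apply: cvgB; first exact: cvg_cst.
apply/gtr0_cvgV0; first by apply: nearW => n; exact: test_fun_den_gt0.
apply/cvgryPge => A.
have /cvgryPge/(_ (A / bump a b x)) := @cvgr_idn R.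
apply: filterS => n; rewrite ler_pdivrMr// => /le_trans; apply.
by rewrite lerDr.
Qed.

Lemma is_derive_test_fun a b n x :
  is_derive x 1 (test_fun a b n) (dtest_fun a b n x).
Proof.
have d1 := @is_derive_sqr_max0 1 (- a) x (expr1n _ _).
have d2 := @is_derive_sqr_max0 (-1) b x (etrans (sqrrN 1) (expr1n _ _)).
have den := lt0r_neq0 (test_fun_den_gt0 a b n x).
pose u1 : R -> R := fun x => Num.max 0 (1 * x - a) ^+ 2.
pose u2 : R -> R := fun x => Num.max 0 (-1 * x + b) ^+ 2.
have uE y : u1 y * u2 y = bump a b y.
  by rewrite /u1 /u2 /bump mul1r mulN1r (addrC (- y)).
pose D : R -> R := cst 1 + n%:R *: (u1 * u2).
have DE y : D y = 1 + n%:R * bump a b y by rewrite /D/= -uE.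
have Dx : D x != 0 by rewrite DE.
have du1 : is_derive x 1 u1 (2 * 1 * Num.max 0 (1 * x - a)) := d1.
have du2 : is_derive x 1 u2 (2 * (-1) * Num.max 0 (-1 * x + b)) := d2.
have dD : is_derive x 1 D (n%:R * dbump a b x).
  apply: (is_derive_eq (is_deriveD (is_derive_cst (1 : R) x 1)
    (is_deriveZ n%:R (is_deriveM du1 du2)))).
  rewrite /u1 /u2 /dbump /GRing.scale/= mul1r mulN1r.
  by rewrite (addrC (- x)); ring.
rewrite (_ : test_fun a b n = cst 1 - (fun y => (D y)^-1)); last first.
  by apply/funext => y; rewrite test_funE /= -DE.
have dDV := is_deriveV Dx dD.
apply: is_derive_eq. rewrite /dtest_fun -DE /GRing.scale/=. field.
exact: Dx.
Qed.

Lemma continuous_dtest_fun a b n : continuous (dtest_fun a b n).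
Proof.
have c1 (c k : R) : continuous (fun x : R => Num.max 0 (c * x + k)).
  move=> x; apply: (@continuous_max _ _ (cst 0) (fun x : R => c * x + k)).
    exact: cst_continuous.
  by apply: cvgD; [apply: cvgMr; exact: cvg_id|exact: cvg_cst].
move=> x.
have ca : {for x, continuous (fun x => Num.max 0 (x - a))}.
  by have := c1 1 (- a) x; under eq_fun do rewrite mul1r.
have cb : {for x, continuous (fun x => Num.max 0 (b - x))}.
  by have := c1 (-1) b x; under eq_fun do rewrite mulN1r addrC.
have cx2 (f : R -> R) : {for x, continuous f} -> {for x, continuous (fun x => f x ^+ 2)}.
  by move=> cf; exact: (cvgM cf cf).
have cu : {for x, continuous (bump a b)} by apply: cvgM; exact: cx2.
have cD : {for x, continuous (fun x => 1 + n%:R * bump a b x)}.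
  by apply: cvgD; [exact: cvg_cst|apply: cvgMr].
apply: cvgM.
  apply: cvgMr; apply: cvgB.
    by apply: cvgM; [apply: cvgMr|exact: cx2].
  by apply: cvgM => //; apply: cvgMr; exact: cx2.
apply: cvgV; last exact: cx2.
by rewrite expf_neq0// lt0r_neq0// test_fun_den_gt0.
Qed.

End test_functions.

(** * The operator [D_infty] on compactly supported functions *)

Section compactly_supported.
Context {R : realType}.
Variables (f df : R -> R) (a b : R).
Hypothesis f_df : forall x : R, is_derive x 1 f (df x).
Hypothesis cdf : continuous df.
Hypothesis f_ge0 : forall x, 0 <= f x.
Hypothesis f_le1 : forall x, f x <= 1.
Hypothesis f_out : forall x, x <= a \/ b <= x -> f x = 0.
Hypothesis df_out : forall x, x <= a \/ b <= x -> df x = 0.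

Let cf : continuous f.
Proof.
move=> x; apply: differentiable_continuous; apply/derivable1_diffP.
by have [] := f_df x.
Qed.

(** The mean value theorem handles r < 1 and the bounds 0 <= f <= 1 handle r >= 1. The factor
    [Num.min 1 r] is the weight against which (H0) makes the supremum of [rho] integrable. *)
Lemma bounded_increment : exists2 K : R, 0 < K &
  forall x r, 0 < r -> `|f x - f (x - r)| <= K * Num.min 1 r.
Proof.
have [C [C0 dfC]] : exists C, 0 <= C /\ forall x, `|df x| <= C.
  have [ba|ab] := ltP b a.
    exists 0; split => // x; rewrite df_out ?normr0//.
    by have [|/ltW] := leP x a; [left|right; exact: le_trans (ltW ba) _].
  have cn : {within `[a, b], continuous (fun x => `|df x|)}.
    by apply: continuous_subspaceT => x; apply: cvg_norm; exact: cdf.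
  have [c _ hc] := EVT_max ab cn.
  exists `|df c|; split => // x.
  have [/andP[ax xb]|] := boolP (a <= x <= b).
    by apply: hc; rewrite in_itv/= ax xb.
  rewrite negb_and -!ltNge => /orP h; rewrite df_out ?normr0//.
  by case: h => /ltW; [left|right].
(* [C] bounds the derivative and 1 the oscillation of [f]; the sum is also positive. *)
exists (C + 1); first by rewrite ltr_wpDl.
move=> x r r0.
rewrite minEle; case: ifPn => _.
  rewrite mulr1; apply: (@le_trans _ _ 1); last by rewrite lerDr.
  have := f_ge0 x; have := f_le1 x; have := f_ge0 (x - r); have := f_le1 (x - r).
  by rewrite ler_norml; lra.
have xr : x - r <= x by rewrite gerBl ltW.
have cfx : {within `[x - r, x], continuous f}.
  by apply: continuous_subspaceT => y; exact: cf.
have [c _ ->] := MVT_segment xr (fun y _ => f_df y) cfx.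
rewrite normrM subKr (gtr0_norm r0) ler_wpM2r ?ltW//.
by rewrite (le_lt_trans (dfC c))// ltrDl.
Qed.

Lemma C_infty_compact (T : R) (g : R -> R) : continuous g ->
  (forall x, x <= a -> g x = 0) -> C_infty T g.
Proof.
move=> cg ga; split; first exact: continuous_subspaceT.
apply/cvgrPdist_le => e e0; near=> x.
rewrite ga ?subrr ?normr0 ?ltW//; near: x.
by apply: nbhs_ninfty_lt; exact: num_real.
Unshelve. all: by end_near. Qed.

Lemma C1_infty_compact (T : R) : C1_infty T f.
Proof.
split; first by apply: C_infty_compact => // x xa; apply: f_out; left.
exists df; last by apply: C_infty_compact => // x xa; apply: df_out; left.
move=> t tT; have [dt dft] := f_df t.
have : (f x - f t) / (x - t) @[x --> t^'] --> df t.
  have : h^-1 *: (f (h *: 1 + t) - f t) @[h --> 0^'] --> df t.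
    by rewrite -dft; exact: dt.
  move/cvgrPdist_le => dl; apply/cvgrPdist_le => e e0.
  have [d /= d0 hd] := dl e e0; exists d => //= x tx xt.
  have := hd (x - t); rewrite /ball_/= sub0r opprB => /(_ tx).
  by rewrite subr_eq0 => /(_ xt); rewrite /GRing.scale/= mulr1 subrK mulrC.
apply: cvg_trans; apply: cvg_app; exact: cvg_within.
Qed.

Variable rho : R -> R -> R.
Hypothesis rho_H0 : hypothesis_H0 rho.

Let D2 : set (R * R) := [set q | 0 < q.2].
Let oD2 : open D2.
Proof.
rewrite (_ : D2 = snd @^-1` [set x | 0 < x])//.
apply: open_comp => [q _|]; first exact: cvg_snd.
rewrite (_ : [set x | _] = `]0, +oo[%classic); first exact: interval_open.
by apply/seteqP; split => x /=; rewrite in_itv/= andbT.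
Qed.

Lemma H0_continuous_at (t r : R) : 0 < r ->
  rho q.1 q.2 @[q --> (t, r)] --> rho t r.
Proof.
move=> r0; have := H0_continuous rho_H0.
by rewrite continuous_open_subspace// => /(_ (t, r)); apply; rewrite inE.
Qed.

Lemma H0_continuous_time (r : R) : 0 < r -> continuous (rho ^~ r).
Proof.
move=> r0 t; apply: differentiable_continuous; apply/derivable1_diffP.
exact: (H0_derivable rho_H0).
Qed.

Lemma H0_continuous_jump (t r : R) : 0 < r -> {for r, continuous (rho t)}.
Proof.
move=> r0.
have c2 : (t, s) @[s --> r] --> (t, r) by apply: (@cvg_pair _ _ _ (nbhs r) (nbhs t) (nbhs r)); [exact: cvg_cst|exact: cvg_id].
exact: (cvg_comp _ (fun q : R * R => rho q.1 q.2) c2 (H0_continuous_at r0)).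
Qed.

Lemma H0_measurable_jump (t : R) : measurable_fun (`]0, +oo[ : set R) (rho t).
Proof.
apply: subspace_continuous_measurable_fun => //.
rewrite continuous_open_subspace; last exact: interval_open.
by move=> r; rewrite inE/= in_itv/= andbT => r0; exact: H0_continuous_jump.
Qed.

Let S (r : R) : \bar R := ereal_sup (range (fun t => (rho t r)%:E)).

(* The supremum is over uncountably many [t], but a supremum of functions
   continuous in [r] is lower semicontinuous. *)
Let measurable_S : measurable_fun (`]0, +oo[ : set R) S.
Proof.
(* The value -oo off the positive half-line imposes no condition there, so lower semicontinuity can
   be checked on the whole line. *)
pose S' (r : R) : \bar R := if 0 < r then S r else -oo%E.
apply: (@eq_measurable_fun _ _ _ _ _ S').
  by move=> r; rewrite inE/= in_itv/= andbT /S' => ->.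
apply: measurable_funTS; apply: lower_semicontinuous_measurable => r c.
rewrite /S'; case: ifPn => // r0 /ereal_sup_gt[_ [t _ <-]].
rewrite lte_fin => crho.
exists [set s | 0 < s /\ c < rho t s].
  apply: filterI; first exact: lt_nbhsr.
  have ct : rho t s @[s --> r] --> rho t r by exact: H0_continuous_jump.
  exact: (cvgr_gt _ ct).
by move=> s [/= s0 cs]; rewrite s0; apply: lt_le_trans (ereal_sup_ubound _); [|by exists t].
Qed.

Let h (r : R) : \bar R := ((Num.min 1 r)%:E * S r)%E.

Let S_ge0 r : 0 < r -> (0 <= S r)%E.
Proof.
move=> r0; apply: le_trans (ereal_sup_ubound _); last by exists 0.
by rewrite lee_fin (H0_ge0 rho_H0).
Qed.

Let integrable_h : lebesgue_measure.-integrable `]0%R, +oo[ h.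
Proof.
apply/integrableP; split.
  apply: emeasurable_funM; last exact: measurable_S.
  apply/measurable_EFinP; apply: measurable_minr => //.
apply: le_lt_trans (H0_int rho_H0).
rewrite le_eqVlt; apply/orP; left; apply/eqP; apply: eq_integral => r.
rewrite inE/= in_itv/= andbT => r0.
by rewrite gee0_abs// mule_ge0 ?S_ge0// lee_fin le_min ler01 ltW.
Qed.

(** The supremum over time in (H0) provides one dominating function for all [x], as continuity in
    [x] under the integral demands. *)
Lemma D_infty_domination : exists g : R -> R,
  lebesgue_measure.-integrable `]0%R, +oo[ (EFin \o g) /\
  forall x, {ae lebesgue_measure, forall r : R, `]0, +oo[%classic r ->
    `|(f x - f (x - r)) * rho x r| <= g r}.
Proof.
have [K K0 fK] := bounded_increment.
(* [fine] turns a value +oo into 0; integrability makes [h] finite almost everywhere, so the bound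
   survives almost everywhere. *)
exists (fun r => K * fine (h r)); split.
  have : lebesgue_measure.-integrable `]0%R, +oo[ (fun r => K%:E * h r)%E.
    by apply: integrableZl.
  apply: le_integrable => //.
    apply/measurable_EFinP; apply: measurable_funM => //.
    apply: (@measurableT_comp _ _ _ _ _ _ fine); first exact: fine_measurable.
    exact: measurable_int integrable_h.
  move=> r _ /=; rewrite normrM EFinM abseM/=; apply: lee_wpmul2l => //.
  by case: (h r) => //= *; rewrite normr0 leey.
have mI : measurable (`]0, +oo[ : set (measurableTypeR R)) by exact: measurable_itv.
have := integrable_ae mI integrable_h.
move=> /[swap] x; apply: filterS => r /[swap] r0 /(_ r0) hfin.
move: r0; rewrite /= in_itv/= andbT => r0.
rewrite normrM (ger0_norm (H0_ge0 rho_H0 _ r0)).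
have mr : 0 < Num.min 1 r by rewrite lt_min ltr01.
apply: (@le_trans _ _ (K * Num.min 1 r * rho x r)).
  by rewrite ler_wpM2r ?fK// (H0_ge0 rho_H0).
rewrite -mulrA ler_pM2l// -lee_fin fineK// EFinM /h.
have {}mr := ltW mr.
by apply: lee_wpmul2l; [rewrite lee_fin|apply: ereal_sup_ubound; exists x].
Qed.

Lemma measurable_D_infty_integrand (x : R) :
  measurable_fun (`]0, +oo[ : set R) (fun r => (f x - f (x - r)) * rho x r).
Proof.
apply: measurable_funM; last exact: H0_measurable_jump.
apply: measurable_funTS; apply: measurable_funB => //.
apply: measurableT_comp; first exact: continuous_measurable_fun.
by apply: measurable_funB.
Qed.

Lemma integrable_D_infty_integrand (x : R) :
  lebesgue_measure.-integrable `]0%R, +oo[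
    (fun r => ((f x - f (x - r)) * rho x r)%:E).
Proof.
have [g [ig hg]] := D_infty_domination.
apply/integrableP; split.
  by apply/measurable_EFinP; exact: measurable_D_infty_integrand.
move/integrableP : ig => [mg]; apply: le_lt_trans.
apply: ae_ge0_le_integral => //.
- by apply: measurableT_comp => //; apply/measurable_EFinP; exact: measurable_D_infty_integrand.
- exact: measurableT_comp.
- have [N [mN N0 sN]] := hg x; exists N; split => // r /= nr; apply: sN => /= hr.
  apply: nr => r0; rewrite lee_fin (le_trans (hr r0))//; exact: ler_norm.
Qed.

(** Continuity places [- D_infty rho f] in [C_infty], which membership in the graph of the generator
    requires, and later bounds it on [0, T]. *)
Lemma continuous_D_infty : continuous (D_infty rho f).
Proof.
have [g [ig hg]] := D_infty_domination.
move=> x.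
suff : {in (`]x - 1, x + 1[%classic : set R), continuous (D_infty rho f)}.
  by apply; rewrite inE/= in_itv/= ltrBlDr ltrDl ltr01.
apply: (@continuity_under_integral _ _ _ lebesgue_measure
  (fun x r => (f x - f (x - r)) * rho x r) _ _ (x - 1) (x + 1) _ _ g) => //.
- by move=> y _; exact: integrable_D_infty_integrand.
- apply: aeW => r; rewrite /= in_itv/= andbT => r0 y _.
  apply: cvgM; last exact: H0_continuous_time.
  apply: cvgB; first exact: cf.
  have c2 : y0 - r @[y0 --> y] --> y - r by apply: cvgB; [exact: cvg_id|exact: cvg_cst].
  have cfy : f z @[z --> y - r] --> f (y - r) by exact: cf.
  exact: (cvg_comp _ f c2 cfy).
Qed.

(** The operator looks only to the left of [x], where [f] vanishes as well. *)
Lemma D_infty_out (x : R) : x <= a -> D_infty rho f x = 0.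
Proof.
move=> xa; rewrite /D_infty /Rintegral (_ : integral _ _ _ = 0%E)//.
apply: integral0_eq => r /=; rewrite in_itv/= andbT => r0.
rewrite !f_out ?subrr ?mul0r//; left => //.
by rewrite (le_trans _ xa)// gerBl ltW.
Qed.

End compactly_supported.

(** * Generator and jump intensity on the test functions *)

Section test_fun_operator.
Context {R : realType}.
Variable rho : R -> R -> R.
Hypothesis rho_H0 : hypothesis_H0 rho.
Variables (a b : R) (n : nat).
Let f := test_fun a b n.

Lemma C_infty_test_fun T : C_infty T f.
Proof.
by have [] := C1_infty_compact (@is_derive_test_fun _ a b n)
  (@continuous_dtest_fun _ a b n) (@test_fun_out _ a b n)
  (@dtest_fun_out _ a b n) T.
Qed.

Lemma continuous_test_fun : continuous f.
Proof.
move=> x; apply: differentiable_continuous; apply/derivable1_diffP.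
by have [] := is_derive_test_fun a b n x.
Qed.

Lemma continuous_D_infty_test_fun : continuous (D_infty rho f).
Proof.
exact: (continuous_D_infty (@is_derive_test_fun _ a b n)
  (@continuous_dtest_fun _ a b n) (@test_fun_ge0 _ a b n) (@test_fun_le1 _ a b n)
  (@dtest_fun_out _ a b n)).
Qed.

(** [f] already lies in [C1_infty], so a constant sequence puts it in the graph of the closure, that
    is, of the generator; the rest unfolds uniform convergence. One [d0] for all z <= T is what
    later gives a uniform bound. *)
Lemma test_fun_generator T (Q : R -> (R -> R) -> (R -> R)) :
  generated_by_closure T Q (fun u t => - D_infty rho u t) (C1_infty T) ->
  forall e : R, 0 < e -> exists2 d0 : R, 0 < d0 &
  forall d z : R, 0 < d < d0 -> z <= T ->
    `|(Q d f z - f z) / d - (- D_infty rho f z)| < e.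
Proof.
move=> [_ QE] e e0.
have : generator T Q (f, fun t => - D_infty rho f t).
  rewrite QE; split => /=.
  - exact: C_infty_test_fun.
  - apply: (@C_infty_compact _ a).
      by move=> x; apply: continuousN; exact: continuous_D_infty_test_fun.
    move=> x xa; rewrite (@D_infty_out _ _ a b)// ?oppr0//.
    exact: test_fun_out.
  - exists (fun=> f); split.
    + move=> _; exact: C1_infty_compact (@is_derive_test_fun _ a b n)
        (@continuous_dtest_fun _ a b n) (@test_fun_out _ a b n)
        (@dtest_fun_out _ a b n) T.
    + by move=> P /nbhs_singleton Pf; exists 0%N.
    + by move=> P /nbhs_singleton Pf; exists 0%N.
case=> _ _ /=.
move=> /(_ [set g | forall z, z <= T -> `|g z - (- D_infty rho f z)| < e]).
case.
  apply/uniform_nbhs.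
  exists [set xy | `|xy.2 - xy.1| < e]; split.
    rewrite -entourage_ballE; exists e => // -[u v] /=; rewrite /ball/= distrC//.
  by move=> g hg z zT; apply: hg; rewrite /= in_itv/=.
move=> d0 /= d00 hd; exists d0 => // d z /andP[dgt0 dd0] zT.
by apply: hd => //; rewrite /= sub0r normrN gtr0_norm.
Qed.

(** As [f] vanishes at z > 0, only the term [f (z - r)] survives; the reflection of r into z - r
    turns the jump size into the landing point, which is negative because [f] lives there. *)
Lemma D_infty_test_funE (z : R) : b <= 0 -> 0 < z ->
  ((- D_infty rho f z)%:E =
   \int[lebesgue_measure]_r
     (f r * (if r < 0 then rho z (z - r) else 0))%:E)%E.
Proof.
move=> b0 z0.
have fz : f z = 0 by apply: test_fun_out; right; exact: le_trans (ltW z0).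
have mrefl : measurable_fun setT ((fun r => z - r) : measurableTypeR R -> measurableTypeR R).
  exact: measurable_funB.
pose frefl : {mfun measurableTypeR R >-> measurableTypeR R} :=
  HB.pack ((fun r => z - r) : measurableTypeR R -> measurableTypeR R)
    (isMeasurableFun.Build _ _ _ _ _ mrefl).
have refl (A : set R) : measurable A ->
    pushforward lebesgue_measure frefl A = lebesgue_measure A.
  (* Lebesgue measure is determined by its values on half-open intervals, whose length a reflection
     preserves. *)
  move=> mA; apply/esym/lebesgue_measure_unique => //= _ [[u v]] _ <-.
  rewrite /pushforward (_ : _ @^-1` _ = `[z - v, z - u[%classic); last first.
    by apply/seteqP; split => r /=; rewrite !in_itv/= => /andP[*]; apply/andP; split; lra.
  rewrite /= !lebesgue_measure_itv/= !lte_fin ltrD2l ltrN2; case: ifP => // _.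
  by rewrite -!EFinB; congr EFin; ring.
(* (H0) says nothing about [rho] at nonpositive jump sizes; cutting it there gives a total,
   measurable and nonnegative function. *)
pose rhoz : R -> R := rho z \_ `]0, +oo[.
have mrhoz : measurable_fun setT rhoz.
  by apply/(measurable_restrictT _ _).1 => //; exact: H0_measurable_jump.
have rhoz_ge0 r : 0 <= rhoz r.
  rewrite /rhoz patchE mem_setE in_itv/= andbT; case: ifPn => // r0.
  exact: (H0_ge0 rho_H0).
pose K (r : R) : \bar R := (f r * rhoz (z - r))%:E.
have mK : measurable_fun setT K.
  apply/measurable_EFinP; apply: measurable_funM.
    exact: continuous_measurable_fun continuous_test_fun.
  by apply: measurableT_comp => //; exact: measurable_funB.
have K0 r : (0 <= K r)%E by rewrite lee_fin mulr_ge0// test_fun_ge0.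
transitivity (\int[lebesgue_measure]_r K r)%E; last first.
  apply: eq_integral => r _; congr EFin.
  have [r0|r0] := ltP r 0.
    by rewrite /rhoz patchE mem_setE in_itv/= andbT ifT// subr_gt0 (lt_trans r0).
  by rewrite /f test_fun_out ?mul0r//; right; exact: le_trans r0.
transitivity (\int[pushforward lebesgue_measure frefl]_r K r)%E; last first.
  by apply: eq_measure_integral => A mA _; exact: refl.
rewrite ge0_integral_pushforward//; last first.
transitivity (\int[lebesgue_measure]_(r in `]0%R, +oo[) (f (z - r) * rho z r)%:E)%E; last first.
  rewrite preimage_setT [LHS]integral_mkcond; apply: eq_integral => r _.
  rewrite patchE /K /= subKr /rhoz patchE.
  by case: ifPn => // _; rewrite mulr0.
rewrite EFinN /D_infty /Rintegral fineK; last first.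
  apply: integrable_fin_num => //.
  exact: (integrable_D_infty_integrand (@is_derive_test_fun _ a b n)
  (@continuous_dtest_fun _ a b n) (@test_fun_ge0 _ a b n) (@test_fun_le1 _ a b n)
  (@dtest_fun_out _ a b n)).
rewrite -[RHS]oppeK; congr (- _)%E; rewrite -integral_ge0N; last first.
  move=> r; rewrite /= in_itv/= andbT => r0.
  by rewrite lee_fin; apply: mulr_ge0; [exact: test_fun_ge0|exact: (H0_ge0 rho_H0)].
apply: eq_integral => r _.
by rewrite fz sub0r mulNr EFinN.
Qed.

Lemma D_infty_test_fun_le0 (z : R) : b <= 0 -> 0 < z -> 0 <= - D_infty rho f z.
Proof.
move=> b0 z0; rewrite -lee_fin D_infty_test_funE//.
apply: integral_ge0 => r _; rewrite lee_fin; apply: mulr_ge0; first exact: test_fun_ge0.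
by case: ifPn => // r0; rewrite (H0_ge0 rho_H0)// subr_gt0 (lt_trans r0).
Qed.

End test_fun_operator.

(** * Killed paths and averages over shrinking windows *)

Lemma within_right_continuous (R : realType) (T : topologicalType) (f : R -> T) (u : R) :
  {within `[0, +oo[, continuous f} -> 0 <= u -> f v @[v --> u^'+] --> f u.
Proof.
move=> cf u0; move/subspace_continuousP : cf => /(_ u).
have u0' : `[0, +oo[%classic u by rewrite /= in_itv/= u0.
move=> /(_ u0') cfu A /cfu hA.
have {}hA : \forall v \near u, `[0, +oo[%classic v -> A (f v) := hA.
suff : \forall v \near u, u < v -> A (f v) by [].
apply: filterS hA => v Av uv; apply: Av.
by rewrite /= in_itv/= andbT (le_trans u0)// ltW.
Qed.

Section killed_path.
Context {R : realType} {d} {W : measurableType d} {n : nat}.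
Variables (X : R -> W -> 'rV[R]_n) (U : set 'rV[R]_n).
Hypothesis oU : open U.
Hypothesis mX : forall s : R, 0 <= s -> measurable_fun setT (X s).
Hypothesis cX : forall w : W, {within `[0, +oo[, continuous (X^~ w)}.
Hypothesis X0 : forall w, U (X 0 w).
Variable h : 'rV[R]_n -> R.
Hypothesis ch : continuous h.
Hypothesis mh : measurable_fun setT h.
Variable S : R.

(** The horizon [S] confines the later time integrals to a bounded interval. The strict inequality
    makes the indicator, hence the path, right-continuous. *)
Definition killed_path (u : R) (w : W) : R :=
  h (X u w) * (u%:E < Order.min (hitting_time X (~` U) w) S%:E)%E%:R.

Lemma measurable_killed_path u : 0 <= u -> measurable_fun setT (killed_path u).
Proof.
move=> u0; apply: measurable_funM.
  by apply: measurableT_comp => //; exact: mX.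
rewrite (_ : (fun w => _) =
  (\1_([set w | (u%:E < hitting_time X (~` U) w)%E] `&` [set w | u < S]) : W -> R)).
  apply: measurable_indic; apply: measurableI.
    exact: measurable_lt_exit_time.
  have [uS|uS] := boolP (u < S).
    by rewrite (_ : [set w | _] = setT)//; apply/seteqP; split.
  by rewrite (_ : [set w | _] = set0)//; apply/seteqP; split.
apply/funext => w; rewrite indicE lt_min lte_fin; congr (nat_of_bool _)%:R.
by apply/andP/idP; rewrite inE.
Qed.

Lemma right_continuous_killed_path w u : 0 <= u ->
  killed_path v w @[v --> u^'+] --> killed_path u w.
Proof.
move=> u0; apply: cvgM; last exact: right_continuous_indicator_lt.
apply: (@cvg_comp _ _ _ (X^~ w) h _ (nbhs (X u w))); last exact: ch.
exact: within_right_continuous.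
Qed.

Lemma killed_path_ge_end u w : S <= u -> killed_path u w = 0.
Proof.
by move=> Su; rewrite /killed_path lt_min lte_fin (ltNge u S) Su/= andbF mulr0.
Qed.

Hypothesis h_ge0 : forall y, 0 <= h y.
Hypothesis h_le1 : forall y, h y <= 1.

Lemma killed_path_ge0 u w : 0 <= killed_path u w.
Proof. by rewrite /killed_path mulr_ge0. Qed.

Lemma killed_path_le1 u w : killed_path u w <= 1.
Proof. by rewrite /killed_path; case: (_ < _)%E; rewrite ?mulr1 ?mulr0. Qed.

End killed_path.

(** The indicator selects [s] in [t0 - e n, t0[, an interval of length e n, and [F] is then read at
    s + e n in [t0, t0 + e n[: only right continuity at [t0] matters. The bounds 0 < t0 < S keep the
    window inside [0, S] for small e n. *)
Lemma cvg_right_average (R : realType) (F : R -> R) (t0 S : R) (e : R^nat) :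
  0 < t0 < S -> (forall n, 0 < e n) -> e n @[n --> \oo] --> 0 ->
  (forall s, 0 <= F s) -> F v @[v --> t0^'+] --> F t0 ->
  measurable_fun setT (fun s : R => F (Num.max 0 s)) ->
  (\int[lebesgue_measure]_(s in `[0%R, S])
     ((s < t0 <= s + e n)%R%:R * F (s + e n) / e n)%R%:E)%E
    @[n --> \oo] --> (F t0)%:E.
Proof.
move=> /andP[t00 t0S] e0 ce F0 rcF mF.
pose J n := (\int[lebesgue_measure]_(s in `[0%R, S])
     ((s < t0 <= s + e n)%R%:R * F (s + e n) / e n)%R%:E)%E.
(* These bounds for all [k] give the limit, and with k = 1 the finiteness of the integrals. *)
suff H : forall k : R, 0 < k -> \forall n \near \oo,
    ((F t0 - k)%:E <= J n <= (F t0 + k)%:E)%E.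
  apply/fine_cvgP; split.
    have := H 1 ltr01; apply: filterS => m /andP[h1 h2].
    by rewrite fin_numElt (lt_le_trans _ h1) ?ltNyr// (le_lt_trans h2) ?ltry.
  apply/cvgrPdist_le => k k0; have := H k k0; apply: filterS => m /andP[h1 h2].
  have Jfin : J m \is a fin_num.
    by rewrite fin_numElt (lt_le_trans _ h1) ?ltNyr// (le_lt_trans h2) ?ltry.
  rewrite -(fineK Jfin) !lee_fin in h1 h2.
  by rewrite /= ler_norml; apply/andP; split; lra.
move=> k k0.
have [eta /= eta0 Heta] : \forall v \near t0^'+, `|F t0 - F v| <= k.
  by move/cvgrPdist_le : rcF; exact.
have Hk v : t0 <= v < t0 + eta -> F t0 - k <= F v <= F t0 + k.
  move=> /andP[]; rewrite le_eqVlt => /predU1P[<- _|tv vt].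
    by rewrite gerBl lerDl ltW.
  have := Heta v; rewrite /= distrC gtr0_norm ?subr_gt0// ltrBlDl.
  by move=> /(_ vt tv); rewrite ler_norml => /andP[? ?]; apply/andP; split; lra.
near=> m.
have em : 0 < e m by exact: e0.
have et : e m < t0 by near: m; exact: (cvgr_lt _ ce).
have eeta : e m < eta by near: m; exact: (cvgr_lt _ ce).
have JE : J m = (\int[lebesgue_measure]_(s in `[(t0 - e m)%R, t0[)
    (F (Num.max 0 (s + e m)) / e m)%R%:E)%E.
  rewrite /J integral_mkcond [RHS]integral_mkcond; apply: eq_integral => s _.
  rewrite !patchE !mem_setE !in_itv/=.
  have -> : (t0 - e m <= s < t0) = (s < t0 <= s + e m) by rewrite andbC lerBlDr.
  case: ifPn => [/andP[s0 sS]|]; case: ifPn => //.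
  - by move=> /andP[_ ts]; rewrite mul1r max_r// (le_trans _ ts)// ltW.
  - by move=> _; rewrite !mul0r.
  - move=> /andP[st ts]; rewrite negb_and -!ltNge => /orP[s0|Ss]; exfalso; lra.
have lI : lebesgue_measure (`[(t0 - e m)%R, t0[%classic : set R) = (e m)%:E.
  rewrite lebesgue_measure_itv/= lte_fin gtrBl em -EFinB; congr EFin; lra.
have mFe : measurable_fun (`[(t0 - e m)%R, t0[ : set R)
    (fun s : R => (F (Num.max 0 (s + e m)) / e m)%:E).
  apply/measurable_EFinP; apply: measurable_funM => //.
  apply: measurable_funTS.
  apply: (@measurableT_comp _ _ _ _ _ _ (fun s : R => F (Num.max 0 s)) _ (fun s : R => s + e m)) => //.
  exact: measurable_funD.
have bd s : `[(t0 - e m)%R, t0[%classic s ->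
    F t0 - k <= F (Num.max 0 (s + e m)) <= F t0 + k.
  rewrite /= in_itv/= => /andP[s1 s2]; rewrite max_r; last lra.
  by apply: Hk; apply/andP; split; lra.
have cE (c : R) : (\int[lebesgue_measure]_(s in (`[(t0 - e m)%R, t0[ : set R))
    (c / e m)%:E = c%:E)%E.
  transitivity ((c / e m)%:E * (e m)%:E)%E.
    by rewrite integral_cst//; congr (_ * _)%E; exact: lI.
  by rewrite -EFinM divfK// gt_eqF.
apply/andP; split; rewrite JE.
  (* The lower bound is raised to 0, because the comparison of integrals is between nonnegative
     functions. *)
  apply: (@le_trans _ _ (Num.max 0 (F t0 - k))%:E).
    by rewrite lee_fin le_max lexx orbT.
  rewrite -(cE (Num.max 0 (F t0 - k))); apply: ge0_le_integral => //.
  - by move=> s _; rewrite lee_fin divr_ge0 ?le_max ?lexx// ltW.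
  - move=> s /bd /andP[h1 _]; rewrite lee_fin ler_pM2r ?invr_gt0//.
    by rewrite ge_max F0.
rewrite -(cE (F t0 + k)); apply: ge0_le_integral => //.
- by move=> s _; rewrite lee_fin divr_ge0// ltW.
- by move=> s /bd /andP[_ h2]; rewrite lee_fin ler_pM2r ?invr_gt0.
Unshelve. all: by end_near. Qed.

Lemma cvg_at_right_shift (R : realType) (F : R -> R) (e s : R) :
  F v @[v --> (s + e)^'+] --> F (s + e) -> F (v + e) @[v --> s^'+] --> F (s + e).
Proof.
move=> /cvg_at_rightP c; apply/cvg_at_rightP => u [us cu]; apply: c; split.
  by move=> m; rewrite ltrD2r.
by apply: cvgD => //; exact: cvg_cst.
Qed.

(** * Events determined by a process *)

Section process_sigma_measurability.
Context {R : realType} {d d'} {W : measurableType d} {E : measurableType d'}.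
Variables (I : set R) (X : R -> W -> E).

(** The sample space with the sigma-algebra of the process: a measurability lemma valid over any
    sample space, applied to this one, yields events of [process_sigma]. *)
Definition process_space :=
  g_sigma_algebraType (\bigcup_(s in I) preimage_set_system setT (X s) measurable).

Lemma measurable_process_space (s : R) : I s ->
  measurable_fun setT (X s : process_space -> E).
Proof.
move=> Is _ A mA; rewrite setTI; apply: sub_sigma_algebra.
by exists s => //; exists A => //; rewrite setTI.
Qed.

Lemma process_sigma_preimage d2 (T : measurableType d2) (f : W -> T) (A : set T) :
  measurable_fun setT (f : process_space -> T) -> measurable A ->
  process_sigma I X (f @^-1` A).
Proof. by move=> mf mA; have := mf measurableT A mA; rewrite setTI. Qed.

End process_sigma_measurability.

(** * The first-passage identity up to a finite horizon *)

Section first_passage.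
Context {R : realType} {dW} {W : measurableType dW} (P : probability W R).
Variables (T t : R) (t_gt0 : 0 < t) (t_leT : t <= T).
Variables (rho : R -> R -> R) (rho_H0 : hypothesis_H0 rho).
Variables (Q : R -> (R -> R) -> (R -> R))
  (Q_generated : generated_by_closure T Q (fun u t => - D_infty rho u t) (C1_infty T)).
Variables (Y : R -> W -> R) (Y_feller : feller_process P T Q t Y).
Variables (n : nat) (U : set 'rV[R]_n) (oU : open U) (X : R -> W -> 'rV[R]_n).
Hypothesis mX : forall s : R, 0 <= s -> measurable_fun setT (X s).
Hypothesis cX : forall w : W, {within `[0, +oo[, continuous (X^~ w)}.
Hypothesis X0 : forall w, U (X 0 w).
Hypothesis YX_independent : independent_processes P Y X.
Variables (h : 'rV[R]_n -> R) (ch : continuous h) (mh : measurable_fun setT h).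
Hypothesis h_ge0 : forall y, 0 <= h y.
Hypothesis h_le1 : forall y, h y <= 1.
Variables (a b : R) (b_le0 : b <= 0) (k : nat) (S : R).
Let f := test_fun a b k.
Let G := killed_path X U h S.
Let tau := hitting_time Y `]-oo, 0].
Let F (u : R) (w : W) : R := f (Y u w) * G u w.
(** The approximating integrand. Its integral over [s] along a path is [J], which tends to the value
    at passage; its expectation at fixed [s] is [K], which factorises. Tonelli's theorem compares
    the two. *)
Let Z (e s : R) (w : W) : R := (s%:E < tau w)%E%:R * F (s + e) w / e.

Let mY (s : R) : 0 <= s -> measurable_fun setT (Y s).
Proof. exact: feller_measurable Y_feller _. Qed.

Let rcY w (s : R) : 0 <= s -> Y v w @[v --> s^'+] --> Y s w.
Proof. exact: feller_right_continuous Y_feller _ _. Qed.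

Let niY w (s s' : R) : 0 <= s -> s <= s' -> Y s' w <= Y s w.
Proof. exact: feller_nonincreasing Y_feller _ _ _. Qed.

Let Y0 w : 0 < Y 0 w.
Proof. by rewrite (feller_start Y_feller). Qed.

Let Y_leT w (s : R) : 0 <= s -> Y s w <= T.
Proof.
by move=> s0; rewrite (le_trans (niY w (lexx _) s0))// (feller_start Y_feller).
Qed.

Let lt_tau w (s : R) : 0 <= s -> (s%:E < tau w)%E = (0 < Y s w).
Proof.
move=> s0; apply: lt_hitting_time_nonincreasing => //.
- by move=> u; exact: rcY.
- by move=> u v; exact: niY.
Qed.

Let f_pos (z : R) : 0 <= z -> f z = 0.
Proof. by move=> z0; apply: test_fun_out; right; exact: le_trans z0. Qed.

Let F_ge0 u w : 0 <= F u w.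
Proof. by rewrite mulr_ge0// ?test_fun_ge0// killed_path_ge0. Qed.

Let F_le1 u w : F u w <= 1.
Proof.
by rewrite mulr_ile1// ?test_fun_ge0 ?test_fun_le1 ?killed_path_ge0 ?killed_path_le1.
Qed.

Let mf : measurable_fun setT f.
Proof. by apply: continuous_measurable_fun => z; exact: continuous_test_fun. Qed.

Let mF (u : R) : 0 <= u -> measurable_fun setT (F u).
Proof.
move=> u0; apply: measurable_funM; last exact: measurable_killed_path.
by apply: measurableT_comp => //; exact: mY.
Qed.

Let rcF w (u : R) : 0 <= u -> F v w @[v --> u^'+] --> F u w.
Proof.
move=> u0; apply: cvgM; last exact: right_continuous_killed_path.
have cfu : f z @[z --> Y u w] --> f (Y u w) by exact: continuous_test_fun.
apply: (@cvg_comp _ _ _ (Y ^~ w) f _ (nbhs (Y u w))).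
  exact: rcY.
exact: cfu.
Qed.

Let measurable_tau (s : R) : 0 <= s -> measurable [set w | (s%:E < tau w)%E].
Proof.
move=> s0; rewrite (_ : [set w | _] = Y s @^-1` `]0, +oo[).
  by rewrite -[X in measurable X]setTI; exact: mY.
by apply/seteqP; split => w /=; rewrite lt_tau// in_itv/= andbT.
Qed.

Let Z_ge0 (e s : R) w : 0 < e -> 0 <= Z e s w.
Proof. by move=> e0; apply: divr_ge0; [exact: mulr_ge0|exact: ltW]. Qed.

Let mZ (e : R) : 0 < e ->
  measurable_fun setT (fun q : R * W => Z e (Num.max 0 q.1) q.2).
Proof.
move=> e0; apply: right_continuous_nneg_jointly_measurable => [s s0|w s s0].
  apply: measurable_funM => //; apply: measurable_funM.
    rewrite (_ : (fun w => _) = (\1_[set w | (s%:E < tau w)%E] : W -> R)).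
      by apply: measurable_indic; exact: measurable_tau.
    by apply/funext => w; rewrite indicE; congr (nat_of_bool _)%:R; apply/idP/idP; rewrite inE.
  by apply: mF; rewrite addr_ge0// ltW.
apply: cvgM; last exact: cvg_cst.
apply: cvgM; first exact: right_continuous_indicator_lt.
apply: (@cvg_at_right_shift _ (F ^~ w)); apply: rcF.
by rewrite addr_ge0// ltW.
Qed.

(** [f] vanishes on [0, +oo[, so passage must have occurred by time s + e; only [s] in [tau - e,
    tau[ contributes. *)
Let Zpath (e s : R) w : 0 < e -> 0 <= s ->
  Z e s w = (s%:E < tau w <= (s + e)%:E)%E%:R * F (s + e) w / e.
Proof.
move=> e0 s0; have se0 : 0 <= s + e by rewrite addr_ge0// ltW.
rewrite /Z; have [ts|st] := leP (tau w) (s + e)%:E; first by rewrite andbT.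
rewrite andbF mul0r mul0r /F f_pos ?mul0r ?mulr0 ?mul0r//.
by apply: ltW; rewrite -lt_tau.
Qed.

Let J (e : R) (w : W) : \bar R := \int[lebesgue_measure]_(s in `[0, S]) (Z e s w)%:E.

Let F_tau (w : W) : R := if (tau w < +oo)%E then F (fine (tau w)) w else 0.

(** If [tau] is at least [S], both sides vanish, since the killed path is 0 from [S] on; otherwise
    this is the window average at [tau]. *)
Let J_cvg (e : R^nat) w : (forall m, 0 < e m) -> e m @[m --> \oo] --> 0 ->
  J (e m) w @[m --> \oo] --> (F_tau w)%:E.
Proof.
move=> e0 ce.
have t0 : (0 < tau w)%E by rewrite lt_tau.
have [St|tS] := leP S%:E (tau w).
  rewrite (_ : F_tau w = 0); last first.
    rewrite /F_tau; case: ifPn => // ty; rewrite /F /G killed_path_ge_end ?mulr0//.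
    by rewrite -lee_fin fineK// ge0_fin_numE// ltW.
  rewrite (_ : (fun m => _) = cst 0%E); first exact: cvg_cst.
  apply/funext => m; rewrite /J integral0_eq// => s /=; rewrite in_itv/= => /andP[s0 _].
  rewrite Zpath//; have [ts|st] := leP (tau w) (s + e m)%:E; last by rewrite andbF !mul0r.
  have Sse : S <= s + e m by rewrite -lee_fin (le_trans St).
  by rewrite /F /G killed_path_ge_end// !mulr0 mul0r.
have tf : tau w \is a fin_num by rewrite fin_numElt (lt_trans _ t0) ?ltNyr// (lt_trans tS) ?ltry.
have := @cvg_right_average R (F ^~ w) (fine (tau w)) S e _ e0 ce (F_ge0 ^~ w) _ _.
rewrite /F_tau (lt_trans tS) ?ltry//.
have -> : (fun m => J (e m) w) = (fun m => (\int[lebesgue_measure]_(s in `[0%R, S])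
  ((s < fine (tau w) <= s + e m)%R%:R * F (s + e m) w / e m)%:E)%E).
  apply/funext => m; apply: eq_integral => s; rewrite inE/= in_itv/= => /andP[s0 sS].
  by rewrite Zpath// -!lte_fin -!lee_fin fineK.
apply.
- by rewrite -!lte_fin fineK// t0.
- by apply: rcF; rewrite fine_ge0// ltW.
- have := @right_continuous_nneg_jointly_measurable R _ W F mF rcF.
  move=> mFF; exact: (measurableT_comp mFF (measurable_fun_pair (@measurable_id _ _ _) (@measurable_cst _ _ _ _ _ w))).
Qed.

Let J_ge0 (e : R) w : 0 < e -> (0 <= J e w)%E.
Proof. by move=> e0; apply: integral_ge0 => s _; rewrite lee_fin Z_ge0. Qed.

Let mZw (e : R) w : 0 < e -> measurable_fun setT (fun s : R => Z e (Num.max 0 s) w).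
Proof.
move=> e0.
exact: (measurableT_comp (mZ e0) (measurable_fun_pair (@measurable_id _ _ _)
  (@measurable_cst _ _ _ _ _ w))).
Qed.

Let J_le1 (e : R) w : 0 < e -> (J e w <= 1)%E.
Proof.
move=> e0; have t0 : (0 < tau w)%E by rewrite lt_tau.
have [toy|ty] := eqVneq (tau w) +oo%E.
  rewrite /J integral0_eq// => s /=; rewrite in_itv/= => /andP[s0 _].
  by rewrite Zpath// toy leye_eq andbF !mul0r.
have tf : tau w \is a fin_num by rewrite ge0_fin_numE ?ltW// ltey.
set t1 := fine (tau w).
(* The bound 1 is the integral of 1/e over the window [t1 - e, t1[ of length e. *)
have -> : (1 = \int[lebesgue_measure]_(s in (`[(t1 - e)%R, t1[ : set R)) (e^-1)%:E)%E.
  have lI : lebesgue_measure (`[(t1 - e)%R, t1[%classic : set R) = e%:E.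
    by rewrite lebesgue_measure_itv/= lte_fin gtrBl e0 -EFinB; congr EFin; lra.
  transitivity ((e^-1)%:E * e%:E)%E; first by rewrite -EFinM mulVf// gt_eqF.
  by rewrite integral_cst//; congr (_ * _)%E; exact/esym/lI.
rewrite /J [leLHS]integral_mkcond [leRHS]integral_mkcond; apply: ge0_le_integral => //.
- by move=> s _; rewrite erestrict_ge0// => ? _; rewrite lee_fin Z_ge0.
- apply/(measurable_restrictT _ _).1 => //.
  apply: (@eq_measurable_fun _ _ _ _ _ (fun s : R => (Z e (Num.max 0 s) w)%:E)).
    by move=> s; rewrite inE/= in_itv/= => /andP[s0 _]; rewrite max_r.
  by apply/measurable_EFinP; apply: measurable_funTS; exact: mZw.
- by apply/(measurable_restrictT _ _).1 => //; exact: measurable_cst.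
- move=> s _; rewrite !patchE !mem_setE !in_itv/=.
  case: ifPn => [/andP[s0 sS]|_]; last by case: ifP => // _; rewrite lee_fin invr_ge0 ltW.
  rewrite Zpath// -[tau w]fineK// -/t1 lte_fin lee_fin.
  rewrite (_ : (t1 - e <= s < t1) = (s < t1 <= s + e)); last by rewrite andbC lerBlDr.
  case: ifP => _; last by rewrite !mul0r.
  by rewrite mul1r lee_fin -[leRHS]mul1r ler_pM2r ?invr_gt0.
Qed.

Let K (e s : R) : \bar R := \int[P]_w (Z e s w)%:E.

(** [Z] extended to the whole line by 0 off [0, S], so that Tonelli's theorem applies to full
    spaces. *)
Let zz (e s : R) (w : W) : \bar R :=
  ((\1_(`[0, S]%classic : set R) s : R) * Z e (Num.max 0 s) w)%:E.

Let JE e w : J e w = (\int[lebesgue_measure]_s zz e s w)%E.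
Proof.
rewrite /J integral_mkcond; apply: eq_integral => s _.
rewrite patchE /zz indicE; case: ifPn => [|_]; last by rewrite mul0r.
by rewrite inE/= in_itv/= => /andP[s0 _]; rewrite mul1r max_r.
Qed.

Let KE0 e : (fun s => \int[P]_w zz e s w)%E = (K e) \_ `[0, S].
Proof.
apply/funext => s; rewrite patchE /K /zz indicE; case: ifPn => [|_].
  rewrite inE/= in_itv/= => /andP[s0 _]; rewrite max_r//.
  by apply: eq_integral => w _; rewrite mul1r.
by rewrite integral0_eq// => w _; rewrite mul0r.
Qed.

Let zz_ge0 e s w : 0 < e -> (0 <= zz e s w)%E.
Proof. by move=> e0; rewrite lee_fin mulr_ge0// Z_ge0. Qed.

Let mzz e : 0 < e -> measurable_fun setT (fun q : R * W => zz e q.1 q.2).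
Proof.
move=> e0; apply/measurable_EFinP; apply: measurable_funM; last exact: mZ.
have m1 : measurable_fun setT (\1_(`[0, S]%classic : set R) : R -> R).
  by apply: measurable_indic; exact: measurable_itv.
exact: (measurableT_comp m1 measurable_fst).
Qed.

Let mzz' e : 0 < e -> measurable_fun setT (fun q : W * R => zz e q.2 q.1).
Proof.
move=> e0.
exact: (measurableT_comp (mzz e0) (measurable_fun_pair measurable_snd measurable_fst)).
Qed.

Let mJ e : 0 < e -> measurable_fun setT (J e).
Proof.
move=> e0; rewrite (funext (JE e)).
apply: (@measurable_tonelli R _ _ W _ lebesgue_measure (fun w s => zz e s w)) => //.
  exact: mzz'.
by move=> *; exact: zz_ge0.
Qed.

Let mK e : 0 < e -> measurable_fun (`[0, S]%classic : set R) (K e).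
Proof.
move=> e0; apply/(measurable_restrictT _ _).2 => //; rewrite -KE0.
apply: (@measurable_tonelli R _ _ _ W P (zz e)).
  exact: mzz.
by move=> *; exact: zz_ge0.
Qed.

Let int_J e : 0 < e ->
  (\int[P]_w J e w = \int[lebesgue_measure]_(s in `[0%R, S]) K e s)%E.
Proof.
move=> e0; rewrite [RHS]integral_mkcond -KE0.
transitivity (\int[P]_w \int[lebesgue_measure]_s zz e s w)%E.
  by apply: eq_integral => w _; exact: JE.
apply: (@tonelli_swap R _ _ W _ P lebesgue_measure (fun w s => zz e s w)).
  exact: mzz'.
by move=> *; exact: zz_ge0.
Qed.

Let g (u : R) : \bar R := \int[P]_w (G u w)%:E.

Let A (e s : R) : \bar R :=
  \int[P]_(w in [set w | 0 < Y s w]) (Q e f (Y s w) / e)%:E.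

Let mYpos (s : R) : 0 <= s -> measurable [set w | 0 < Y s w].
Proof.
move=> s0; rewrite (_ : [set w | _] = Y s @^-1` `]0, +oo[).
  by rewrite -[X in measurable X]setTI; exact: mY.
by apply/seteqP; split => w /=; rewrite in_itv/= andbT.
Qed.

Let mQ (e s : R) : 0 <= e -> 0 <= s -> measurable_fun setT (fun w => Q e f (Y s w)).
Proof.
move=> e0 s0.
have [cQ _] := feller_stable Q_generated.1 e0 (C_infty_test_fun a b k T).
apply: (@measurable_comp _ _ _ _ _ _ (`]-oo, T]%classic : set R) (Q e f) _ (Y s)).
- exact: measurable_itv.
- by move=> _ [w _ <-]; rewrite /= in_itv/= Y_leT.
- by apply: subspace_continuous_measurable_fun => //; exact: measurable_itv.
- exact: mY.
Qed.

Let Q_ge0 (e z : R) : 0 <= e -> z <= T -> 0 <= Q e f z.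
Proof.
move=> e0 zT; apply: (feller_positive Q_generated.1) => //.
  exact: C_infty_test_fun.
by move=> *; exact: test_fun_ge0.
Qed.

(** Independence splits off the factor in [X]; the Markov property at time [s], on the event
    [0 < Y s w], replaces [f (Y (s + e) w)] by [Q e f (Y s w)]. *)
Let KE (e s : R) : 0 < e -> 0 <= s -> K e s = (A e s * g (s + e))%E.
Proof.
move=> e0 s0; have se0 : 0 <= s + e by rewrite addr_ge0// ltW.
pose V (w : W) : R := (0 < Y s w)%R%:R * f (Y (s + e) w) / e.
(* Stated over any sample space: it is used on the given one and on the one that carries the
   sigma-algebra of [Y]. *)
have mVg d' (W' : measurableType d') (Y' : R -> W' -> R) :
    (forall u : R, 0 <= u -> measurable_fun setT (Y' u)) ->
    measurable_fun setT (fun w => (0 < Y' s w)%R%:R * f (Y' (s + e) w) / e).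
  move=> mY'; apply: measurable_funM => //; apply: measurable_funM.
    rewrite (_ : (fun w => _) = (\1_(Y' s @^-1` `]0, +oo[) : W' -> R)).
      apply: measurable_indic; rewrite -[X in measurable X]setTI.
      by apply: mY' => //; exact: measurable_itv.
    apply/funext => w; rewrite indicE; congr (nat_of_bool _)%:R.
    by apply/idP/idP; rewrite inE/= in_itv/= andbT.
  by apply: measurableT_comp => //; exact: mY'.
have V_ge0 w : 0 <= V w.
  by apply: divr_ge0; [apply: mulr_ge0 => //; exact: test_fun_ge0|exact: ltW].
transitivity ((\int[P]_w (V w)%:E) * g (s + e))%E.
  rewrite -ge0_integral_independentM//.
  - apply: eq_integral => w _; congr EFin.
    by rewrite /Z /F /V lt_tau//; ring.
  - exact: mVg.
  - exact: measurable_killed_path.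
  - by move=> w; exact: killed_path_ge0.
  - move=> B1 B2 mB1 mB2; apply: YX_independent.
      apply: process_sigma_preimage mB1.
      apply: (mVg _ (process_space `[0, +oo[ Y) Y) => u u0.
      by apply: measurable_process_space; rewrite /= in_itv/= u0.
    apply: process_sigma_preimage mB2.
    apply: (@measurable_killed_path _ _ (process_space `[0, +oo[ X)) => // u u0.
    by apply: measurable_process_space; rewrite /= in_itv/= u0.
congr (_ * _)%E.
transitivity (\int[P]_(w in [set w | (0 < Y s w)%R]) ((e^-1)%:E * (f (Y (s + e) w))%:E))%E.
  rewrite [RHS]integral_mkcond; apply: eq_integral => w _.
  rewrite patchE /V; case: ifPn; rewrite ?inE ?notin_setE /= => h0.
    by rewrite h0 mul1r mulrC EFinM.
  by rewrite (negbTE (introN idP h0)) !mul0r.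
rewrite ge0_integralZl//; last 4 first.
- exact: mYpos.
- apply/measurable_EFinP; apply: measurable_funTS; apply: measurableT_comp => //.
  exact: mY.
- by move=> w _; rewrite lee_fin test_fun_ge0.
- by rewrite lee_fin invr_ge0 ltW.
rewrite (feller_markov Y_feller s0 (ltW e0) (C_infty_test_fun a b k T)); last first.
  rewrite (_ : [set w | _] = Y s @^-1` `]0, +oo[%classic); last first.
    by apply/seteqP; split => w /=; rewrite in_itv/= andbT.
  apply: process_sigma_preimage; last exact: measurable_itv.
  by apply: measurable_process_space; rewrite /= in_itv/= s0 lexx.
rewrite -ge0_integralZl//; last 4 first.
- exact: mYpos.
- by apply/measurable_EFinP; apply: measurable_funTS; apply: mQ => //; exact: ltW.
- by move=> w _; rewrite lee_fin Q_ge0 ?Y_leT// ltW.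
- by rewrite lee_fin invr_ge0 ltW.
by apply: eq_integral => w _; rewrite mulrC EFinM.
Qed.

Let a_ (s : R) : \bar R :=
  \int[P]_(w in [set w | 0 < Y s w]) (- D_infty rho f (Y s w))%:E.

Let Qf_div (e z : R) : 0 < z -> (Q e f z - f z) / e = Q e f z / e.
Proof. by move=> z0; rewrite f_pos ?subr0// ltW. Qed.

(** On z > 0 this is the difference quotient of the generator, as [f] vanishes there. It stays
    uniformly within 1 of [- D_infty rho f], which is continuous on the compact interval [0, T]. *)
Let Q_bounded : exists2 d0 : R, 0 < d0 & exists C : R, 0 <= C /\
  forall e z : R, 0 < e < d0 -> 0 < z <= T -> Q e f z / e <= C.
Proof.
have [d0 d00 hd0] := test_fun_generator rho_H0 a b k Q_generated ltr01.
have cD : {within `[0, T], continuous (fun z => - D_infty rho f z)}.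
  apply: continuous_subspaceT => z; apply: continuousN.
  exact: continuous_D_infty_test_fun.
have [c _ hc] := EVT_max (le_trans (ltW t_gt0) t_leT) cD.
exists d0 => //; exists (`|- D_infty rho f c| + 1); split; first by rewrite addr_ge0.
move=> e z ed0 /andP[z0 zT].
have := hd0 e z ed0 zT; rewrite Qf_div// ltr_norml => /andP[_].
have := hc z; rewrite in_itv/= (ltW z0) zT => /(_ isT).
have := ler_norm (- D_infty rho f c); rewrite -/f; lra.
Qed.

Let mD : measurable_fun setT (fun z => - D_infty rho f z).
Proof.
apply: measurable_funN; apply: continuous_measurable_fun => z.
exact: continuous_D_infty_test_fun.
Qed.

(** Dominated convergence with the constant [C]. Finiteness of the limit is recorded for the product
    of extended limits taken later. *)
Let A_cvg (e : R^nat) (d0 C s : R) : 0 <= s -> 0 <= C ->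
  (forall e z : R, 0 < e < d0 -> 0 < z <= T -> Q e f z / e <= C) ->
  (forall m, 0 < e m < d0) -> e m @[m --> \oo] --> 0 ->
  A (e m) s @[m --> \oo] --> a_ s /\ a_ s \is a fin_num.
Proof.
move=> s0 C0 hC he ce.
have [] := @dominated_convergence _ _ R P _ (mYpos s0)
  (fun m w => (Q (e m) f (Y s w) / e m)%:E) (fun w => (- D_infty rho f (Y s w))%:E)
  (fun=> C%:E).
- move=> m; apply/measurable_EFinP; apply: measurable_funTS; apply: measurable_funM => //.
  by apply: mQ => //; have /andP[/ltW] := he m.
- apply/measurable_EFinP; apply: measurable_funTS.
  by apply: (measurableT_comp mD); exact: mY.
- apply: aeW => w /= Yw; apply/fine_cvgP; split; first exact: nearW.
  apply/cvgrPdist_lt => r r0.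
  have [d1 d10 hd1] := test_fun_generator rho_H0 a b k Q_generated r0.
  near=> m; rewrite /= distrC -Qf_div//; apply: hd1; last exact: Y_leT.
  have /andP[-> _] /= := he m.
  by near: m; exact: (cvgr_lt _ ce).
- by apply: finite_measure_integrable_cst; exact: mYpos.
- apply: aeW => w m /= Yw; rewrite lee_fin ger0_norm; last first.
    by rewrite divr_ge0 ?Q_ge0 ?Y_leT//; have /andP[/ltW] := he m.
  by apply: hC => //; rewrite Yw Y_leT.
- move=> ia _ ca; split; first exact: ca.
  by apply: integrable_fin_num => //; exact: mYpos.
Unshelve. all: by end_near. Qed.

Let g_cvg (e : R^nat) (s : R) : 0 <= s ->
  (forall m, 0 < e m) -> e m @[m --> \oo] --> 0 ->
  g (s + e m) @[m --> \oo] --> g s /\ g s \is a fin_num.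
Proof.
move=> s0 e0 ce.
have G1 u w : (`|(G u w)%:E| <= 1)%E.
  by rewrite lee_fin ger0_norm ?killed_path_ge0// killed_path_le1.
have [] := @dominated_convergence _ _ R P _ measurableT
  (fun m w => (G (s + e m) w)%:E) (fun w => (G s w)%:E) (cst 1%E).
- move=> m; apply/measurable_EFinP; apply: measurable_killed_path => //.
  by rewrite addr_ge0// ltW.
- by apply/measurable_EFinP; exact: measurable_killed_path.
- apply: aeW => w _; apply/fine_cvgP; split; first exact: nearW.
  have /cvg_at_rightP := @right_continuous_killed_path _ _ _ _ X U cX h ch S w _ s0.
  move=> /(_ (fun m => s + e m)); apply; split; first by move=> m; rewrite ltrDl.
  by rewrite -[X in _ --> X]addr0; apply: cvgD => //; exact: cvg_cst.
- exact: finite_measure_integrable_cst.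
- by apply: aeW => w m _; exact: G1.
- move=> ia _ ca; split; first exact: ca.
  by apply: integrable_fin_num.
Qed.

(** The value at the random time is the pointwise limit of the window averages [J], each of them
    measurable by Tonelli's theorem. *)
Lemma measurable_first_passage : measurable_fun setT F_tau.
Proof.
apply/measurable_EFinP.
apply: (@emeasurable_fun_cvg _ _ _ _ (fun m : nat => J m.+1%:R^-1)) => [m|w _].
  by apply: mJ; rewrite invr_gt0.
by apply: (@J_cvg (fun m => m.+1%:R^-1)) => [m|]; [rewrite invr_gt0|exact: cvg_harmonic].
Qed.

(** Both sides are limits of the same sequence, the expectation of [J] and the time integral of [K],
    dominated by 1 on the sample space and by [C] on [0, S]. *)
Theorem first_passage_integral :
  (\int[P]_w (F_tau w)%:E = \int[lebesgue_measure]_(s in `[0%R, S]) (a_ s * g s))%E.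
Proof.
have [d0 d00 [C [C0 hC]]] := Q_bounded.
(* The denominator m + 2 keeps e m strictly below [d0] already at m = 0. *)
pose e (m : nat) : R := d0 / m.+2%:R.
have e0 m : 0 < e m by rewrite divr_gt0.
have ed0 m : 0 < e m < d0.
  by rewrite e0/= ltr_pdivrMr// -[ltLHS]mulr1 ltr_pM2l// ltr1n.
have ce : e m @[m --> \oo] --> 0.
  rewrite -[X in _ --> X](mulr0 d0); apply: cvgMr.
  by have := @cvg_harmonic R; rewrite -cvg_shiftS.
have mFt : measurable_fun setT (fun w => (F_tau w)%:E).
  exact/measurable_EFinP/measurable_first_passage.
have [_ _ cJ] := @dominated_convergence _ _ R P _ measurableT (fun m => J (e m))
  (fun w => (F_tau w)%:E) (cst 1%E) (fun m => mJ (e0 m)) mFt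
  ltac:(by apply: aeW => w _; exact: J_cvg)
  ltac:(exact: finite_measure_integrable_cst)
  ltac:(by apply: aeW => w m _; rewrite gee0_abs ?J_ge0 ?J_le1).
have mI : measurable (`[0, S]%classic : set (measurableTypeR R)) by exact: measurable_itv.
have cK s : `[0, S]%classic s -> K (e m) s @[m --> \oo] --> (a_ s * g s)%E.
  rewrite /= in_itv/= => /andP[s0 _].
  have [cA af] := A_cvg s0 C0 hC ed0 ce.
  have [cg gf] := g_cvg s0 e0 ce.
  rewrite (_ : (fun m => _) = (fun m => A (e m) s * g (s + e m))%E); last first.
    by apply/funext => m; exact: KE.
  by apply: cvgeM => //; exact: mule_def_fin.
have mag : measurable_fun (`[0, S]%classic : set (measurableTypeR R)) (fun s => a_ s * g s)%E.
  by apply: (@emeasurable_fun_cvg _ _ _ _ (fun m => K (e m))) => // m; exact: mK.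
(* In the factorisation, [A] is at most [C] and the killed mean [g] at most 1. *)
have K_le s m : `[0, S]%classic s -> (`|K (e m) s| <= C%:E)%E.
  rewrite /= in_itv/= => /andP[s0 _].
  have K0 : (0 <= K (e m) s)%E by apply: integral_ge0 => w _; rewrite lee_fin Z_ge0.
  rewrite gee0_abs// KE// -[leRHS]mule1.
  apply: lee_pmul.
  - apply: integral_ge0 => w _; rewrite lee_fin divr_ge0 ?Q_ge0 ?Y_leT//; exact: ltW.
  - by apply: integral_ge0 => w _; rewrite lee_fin killed_path_ge0.
  - have Pl1 := probability_le1 P (mYpos s0).
    apply: (@le_trans _ _ (C%:E * P [set w | (0 < Y s w)%R])%E); last first.
      by rewrite -[leRHS]mule1; apply: lee_wpmul2l; rewrite ?lee_fin.
    rewrite -integral_cst//; last exact: mYpos.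
    apply: ge0_le_integral => //.
    + exact: mYpos.
    + by move=> w _; rewrite lee_fin divr_ge0 ?Q_ge0 ?Y_leT//; exact: ltW.
    + apply/measurable_EFinP; apply: measurable_funTS; apply: measurable_funM => //.
      by apply: mQ => //; exact: ltW.
    + by move=> w Yw; rewrite lee_fin hC// Y_leT// andbT.
  - apply: (@le_trans _ _ (\int[P]_w (cst 1%E) w)%E); last first.
      by rewrite integral_cst//= mul1e; exact: probability_le1.
    apply: ge0_le_integral => //.
    + by move=> w _; rewrite lee_fin killed_path_ge0.
    + apply/measurable_EFinP; apply: measurable_killed_path => //.
      by rewrite addr_ge0// ltW.
    + by move=> w _; rewrite lee_fin killed_path_le1.
have iC : lebesgue_measure.-integrable (`[0%R, S]%classic : set R) (cst C%:E).
  apply/integrableP; split; first exact: measurable_cst.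
  rewrite integral_cst//= lebesgue_measure_itv/=.
  by case: ifP => _; rewrite ?mule0 ?ltry// -EFinB -EFinM ltry.
have [_ _ cI] := @dominated_convergence _ _ R lebesgue_measure _ mI (fun m => K (e m))
  (fun s => a_ s * g s)%E (cst C%:E) (fun m => mK (e0 m)) mag
  ltac:(by apply: aeW => s Is; exact: cK)
  iC
  ltac:(by apply: aeW => s m Is; exact: K_le).
have cI' : (\int[P]_w J (e m) w)%E @[m --> \oo] -->
    (\int[lebesgue_measure]_(s in `[0%R, S]) (a_ s * g s))%E.
  by rewrite (funext (fun m => int_J (e0 m))).
exact: cvg_unique cJ cI'.
Qed.

End first_passage.

(** * Equality of measures from a pi-system *)

(** The hypotheses are arguments of the definition so that the structure of measure can be attached
    to it. *)
Definition weighted_image {R : realType} d' d (T' : measurableType d')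
    (T : measurableType d) (mu : {measure set T' -> \bar R}) (Z : T' -> T)
    (p : T' -> \bar R) & measurable_fun setT Z & measurable_fun setT p &
    (forall x, (0 <= p x)%E) : set T -> \bar R :=
  fun A => (\int[mu]_(x in Z @^-1` A) p x)%E.

Section weighted_image_measure.
Local Open Scope ereal_scope.
Context {R : realType} d' d (T' : measurableType d') (T : measurableType d).
Variables (mu : {measure set T' -> \bar R}) (Z : T' -> T) (p : T' -> \bar R).
Hypotheses (mZ : measurable_fun setT Z) (mp : measurable_fun setT p).
Hypothesis p0 : forall x, 0 <= p x.
Let wi := weighted_image mu mZ mp p0.

Let wi0 : wi set0 = 0.
Proof. by rewrite /wi /weighted_image preimage_set0 integral_set0. Qed.

Let wi_ge0 A : 0 <= wi A.
Proof. exact: integral_ge0. Qed.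

Let wi_sigma_additive : semi_sigma_additive wi.
Proof.
move=> F mF tF mUF; rewrite /wi /weighted_image preimage_bigcup; apply: cvg_toP.
  apply: ereal_nondecreasing_is_cvgn => m n mn.
  by apply: lee_sum_nneg_natr => // k _ _; exact: integral_ge0.
rewrite ge0_integral_bigcup//=.
- by move=> k; rewrite -[X in measurable X]setTI; exact: mZ.
- exact: measurable_funTS.
- apply/trivIsetP => /= i j _ _ ij; rewrite -preimage_setI.
  by move/trivIsetP : tF => /(_ _ _ _ _ ij) ->//; rewrite preimage_set0.
Qed.

HB.instance Definition _ := isMeasure.Build _ _ _ (weighted_image mu mZ mp p0)
  wi0 wi_ge0 wi_sigma_additive.

Lemma ge0_integral_weighted_image (F : T -> \bar R) :
  measurable_fun setT F -> (forall x, 0 <= F x) ->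
  \int[weighted_image mu mZ mp p0]_x F x = \int[mu]_x (F (Z x) * p x).
Proof. by move=> mF F0; exact: ge0_integral_density. Qed.

End weighted_image_measure.

(** Both sides integrate [F] against weighted images. Two measures that agree on a generating
    pi-system coincide once they are finite on members of it that cover the space; the finite total
    mass of the first ensures this. *)
Lemma ge0_integral_pi_system (R : realType) d d1 d2 (T : measurableType d)
    (T1 : measurableType d1) (T2 : measurableType d2)
    (mu1 : {measure set T1 -> \bar R}) (mu2 : {measure set T2 -> \bar R})
    (Z1 : T1 -> T) (Z2 : T2 -> T) (p1 : T1 -> \bar R) (p2 : T2 -> \bar R)
    (G : set (set T)) (g : (set T)^nat) :
  measurable_fun setT Z1 -> measurable_fun setT Z2 ->
  measurable_fun setT p1 -> measurable_fun setT p2 ->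
  (forall x, (0 <= p1 x)%E) -> (forall x, (0 <= p2 x)%E) ->
  measurable = <<s G >> -> setI_closed G ->
  (forall i, G (g i)) -> \bigcup_k g k = setT ->
  (\int[mu1]_x p1 x < +oo)%E ->
  (forall A, G A -> \int[mu1]_(x in Z1 @^-1` A) p1 x = \int[mu2]_(x in Z2 @^-1` A) p2 x)%E ->
  forall F : T -> \bar R, measurable_fun setT F -> (forall x, (0 <= F x)%E) ->
  (\int[mu1]_x (F (Z1 x) * p1 x) = \int[mu2]_x (F (Z2 x) * p2 x))%E.
Proof.
move=> mZ1 mZ2 mp1 mp2 p10 p20 mG IG Gg gT fin E F mF F0.
rewrite -(ge0_integral_weighted_image mu1 mZ1 mp1 p10)//.
rewrite -(ge0_integral_weighted_image mu2 mZ2 mp2 p20)//.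
apply: eq_measure_integral => A mA _.
apply: (measure_unique G g) => // k.
apply: le_lt_trans fin; apply: ge0_subset_integral => //.
rewrite -[X in measurable X]setTI; apply: mZ1 => //.
by rewrite mG; apply: sub_sigma_algebra.
Qed.

(** * The kernel as an iterated integral of functions extended by zero *)

Section passage_kernel.
Local Open Scope ereal_scope.
Context {R : realType} {n : nat}.
Variables (rho : R -> R -> R) (q : R -> R -> R) (pU : R -> 'rV[R]_n -> R).
Variables (t : R) (U : set 'rV[R]_n).

(** Extension by 0, here and for the next two factors, makes them total, nonnegative and jointly
    measurable, so that Tonelli's theorem applies to full spaces. *)
Definition ext_killed_density (s : R) (y : 'rV[R]_n) : \bar R :=
  if `[< (0 < s)%R /\ U y >] then (pU s y)%:E else 0.

Definition ext_density (s z : R) : \bar R :=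
  if (0 < s)%R then (q s z)%:E else 0.

(** r < 0 encodes a jump across zero, and 0 < z < t is the range of the outer integral of
    [kernel_H]. *)
Definition ext_jump_rate (z r : R) : \bar R :=
  if ((0 < z < t) && (r < 0))%R then (rho z (z - r))%:E else 0.

(** [kernel_H] written with the extended factors; the two agree for r < 0 and [y] in [U]. *)
Definition passage_kernel (r : R) (y : 'rV[R]_n) : \bar R :=
  \int[lebesgue_measure]_z (ext_jump_rate z r *
    \int[lebesgue_measure]_s (ext_killed_density s y * ext_density s z)).

Hypothesis rho_H0 : hypothesis_H0 rho.
Hypothesis q_ge0 : forall s z : R, (0 < s)%R -> (0 <= q s z)%R.
Hypothesis mq : measurable_fun ((`]0%R, +oo[ : set R) `*` [set: R])
  (fun u : R * R => q u.1 u.2).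
Hypothesis pU_ge0 : forall (s : R) y, (0 < s)%R -> U y -> (0 <= pU s y)%R.
Hypothesis mpU : measurable_fun ((`]0%R, +oo[ : set R) `*` U)
  (fun u : R * 'rV[R]_n => pU u.1 u.2).
Hypothesis mU : measurable U.

Lemma ext_killed_density_ge0 s y : 0 <= ext_killed_density s y.
Proof.
rewrite /ext_killed_density; case: ifPn => // /asboolP[s0 Uy].
by rewrite lee_fin pU_ge0.
Qed.

Lemma ext_density_ge0 s z : 0 <= ext_density s z.
Proof. by rewrite /ext_density; case: ifPn => // s0; rewrite lee_fin q_ge0. Qed.

Lemma ext_jump_rate_ge0 z r : 0 <= ext_jump_rate z r.
Proof.
rewrite /ext_jump_rate; case: ifPn => // /andP[/andP[z0 _] r0].
by rewrite lee_fin (H0_ge0 rho_H0)// subr_gt0 (lt_trans r0).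
Qed.

Lemma measurable_ext_killed_density :
  measurable_fun setT (fun u : R * 'rV[R]_n => ext_killed_density u.1 u.2).
Proof.
have mD : measurable ((`]0%R, +oo[ : set R) `*` U).
  by apply: measurableX => //; exact: measurable_itv.
rewrite (_ : (fun _ => _) = (EFin \o (fun u : R * 'rV[R]_n => pU u.1 u.2)) \_
    ((`]0%R, +oo[ : set R) `*` U)).
  by move/measurable_EFinP : mpU => /(measurable_restrictT _ mD).
apply/funext => -[s y]; rewrite patchE /ext_killed_density /=.
congr (if _ then _ else _); apply/asboolP/idP; rewrite inE/= in_itv/= andbT.
  by [].
by [].
Qed.

Lemma measurable_ext_density :
  measurable_fun setT (fun u : R * R => ext_density u.1 u.2).
Proof.
have mD : measurable ((`]0%R, +oo[ : set R) `*` [set: R]).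
  by apply: measurableX => //; exact: measurable_itv.
rewrite (_ : (fun _ => _) = (EFin \o (fun u : R * R => q u.1 u.2)) \_
    ((`]0%R, +oo[ : set R) `*` [set: R])).
  by move/measurable_EFinP : mq => /(measurable_restrictT _ mD).
apply/funext => -[s y]; rewrite patchE /ext_density /=.
congr (if _ then _ else _); apply/idP/idP; rewrite inE/= in_itv/= andbT.
  by [].
by case.
Qed.

(** [rho z (z - r)] is treated as a right-continuous process with time [z] and sample point [r]: for
    r < 0 the jump size z - r is positive for every z >= 0, and [rho] is continuous there. *)
Lemma measurable_ext_jump_rate :
  measurable_fun setT (fun u : R * R => ext_jump_rate u.1 u.2).
Proof.
pose X (z r : R) : R := if (r < 0)%R then rho z (z - r) else 0%R.
have mX : measurable_fun setT (fun u : R * R => X (Num.max 0%R u.1) u.2).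
  apply: right_continuous_nneg_jointly_measurable => [z z0|r z z0].
    rewrite (_ : X z = fun r => ((r < 0)%R%:R * (rho z \_ `]0%R, +oo[) (z - r))%R).
      apply: measurable_funM.
        rewrite (_ : (fun _ => _) = (\1_(`]-oo, 0%R[) : R -> R)).
          by apply: measurable_indic; exact: measurable_itv.
        apply/funext => r; rewrite indicE; congr (nat_of_bool _)%:R.
        by rewrite mem_setE in_itv.
      apply: measurableT_comp; last exact: measurable_funB.
      apply/(measurable_restrictT _ _).1 => //; exact: H0_measurable_jump.
    apply/funext => r; rewrite /X; case: ifPn => r0; last by rewrite mul0r.
    by rewrite mul1r patchE mem_setE in_itv/= andbT subr_gt0 (lt_le_trans r0).
  rewrite /X; case: ifPn => r0; last exact: cvg_cst.
  have zr : (0 < z - r)%R by rewrite subr_gt0 (lt_le_trans r0).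
  have c2 : (v, v - r)%R @[v --> z^'+] --> (z, (z - r)%R).
    apply: (@cvg_pair _ _ _ _ (nbhs z) (nbhs (z - r)%R)).
      by apply: cvg_at_right_filter; exact: cvg_id.
    by apply: cvg_at_right_filter; apply: cvgB; [exact: cvg_id|exact: cvg_cst].
  exact: (cvg_comp _ (fun u : R * R => rho u.1 u.2) c2 (H0_continuous_at rho_H0 zr)).
rewrite (_ : (fun _ => _) = (fun u : R * R =>
    ((\1_(`]0%R, t[) u.1 : R) * X (Num.max 0 u.1) u.2)%R%:E)).
  apply/measurable_EFinP; apply: measurable_funM => //.
  have m1 : measurable_fun setT (\1_(`]0%R, t[%classic : set R) : R -> R).
    by apply: measurable_indic; exact: measurable_itv.
  exact: (measurableT_comp m1 measurable_fst).
apply/funext => -[z r]; rewrite /ext_jump_rate /X/= indicE mem_setE in_itv/=.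
case: ifPn => [/andP[/andP[z0 zt] r0]|].
  by rewrite z0 zt r0 mul1r max_r// ltW.
rewrite negb_and => /orP[/negbTE ->|/negbTE ->]; first by rewrite mul0r.
by rewrite mulr0.
Qed.

Lemma passage_kernel_ge0 r y : 0 <= passage_kernel r y.
Proof.
apply: integral_ge0 => z _; apply: mule_ge0; first exact: ext_jump_rate_ge0.
apply: integral_ge0 => s _; apply: mule_ge0; first exact: ext_killed_density_ge0.
exact: ext_density_ge0.
Qed.

Lemma measurable_passage_kernel :
  measurable_fun setT (fun u : R * 'rV[R]_n => passage_kernel u.1 u.2).
Proof.
have [+ _] := @tonelli_kernel R _ _ _ _ _ _ _ _ lebesgue_measure (lebesgue_rV n)
  lebesgue_measure lebesgue_measure
  _ _ _ measurable_ext_killed_density ext_killed_density_ge0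
  measurable_ext_density ext_density_ge0
  measurable_ext_jump_rate ext_jump_rate_ge0.
exact.
Qed.

(** [h] and [f] are absorbed into the first and last factors of the iterated kernel, then taken out
    of the inner integrals again. *)
Lemma passage_kernel_tonelli (f : R -> R) (h : 'rV[R]_n -> R) :
  measurable_fun setT f -> (forall r, (0 <= f r)%R) ->
  measurable_fun setT h -> (forall y, (0 <= h y)%R) ->
  \int[lebesgue_measure]_s ((\int[lebesgue_rV n]_y ((h y)%:E * ext_killed_density s y)) *
    \int[lebesgue_measure]_z (ext_density s z *
      \int[lebesgue_measure]_r ((f r)%:E * ext_jump_rate z r))) =
  \int[lebesgue_measure]_r \int[lebesgue_rV n]_y
    ((f r * h y)%:E * passage_kernel r y).
Proof.
move=> mf f0 mh h0.
have [_ ->] := @tonelli_kernel R _ _ _ _ _ _ _ _ lebesgue_measure (lebesgue_rV n)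
  lebesgue_measure lebesgue_measure
  (fun s y => (h y)%:E * ext_killed_density s y) ext_density
  (fun z r => (f r)%:E * ext_jump_rate z r)
  ltac:(by apply: emeasurable_funM; [apply/measurable_EFinP; exact: (measurableT_comp mh measurable_snd)|exact: measurable_ext_killed_density])
  ltac:(by move=> *; rewrite mule_ge0 ?lee_fin ?ext_killed_density_ge0)
  measurable_ext_density ext_density_ge0
  ltac:(by apply: emeasurable_funM; [apply/measurable_EFinP; exact: (measurableT_comp mf measurable_snd)|exact: measurable_ext_jump_rate])
  ltac:(by move=> *; rewrite mule_ge0 ?lee_fin ?ext_jump_rate_ge0).
have mK (y : 'rV[R]_n) : measurable_fun setT (fun z : R =>
    \int[lebesgue_measure]_s (ext_killed_density s y * ext_density s z)).
  apply: (@measurable_tonelli R _ _ _ _ lebesgue_measure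
    (fun z s => ext_killed_density s y * ext_density s z)) => [|z s].
    apply: emeasurable_funM.
      exact: (measurableT_comp measurable_ext_killed_density
        (measurable_fun_pair measurable_snd (@measurable_cst _ _ _ _ _ y))).
    exact: (measurableT_comp measurable_ext_density
        (measurable_fun_pair measurable_snd measurable_fst)).
  by rewrite mule_ge0 ?ext_killed_density_ge0 ?ext_density_ge0.
apply: eq_integral => r _; apply: eq_integral => y _.
have mC : measurable_fun setT (fun z : R => ext_jump_rate z r).
  exact: (measurableT_comp measurable_ext_jump_rate
        (measurable_fun_pair (@measurable_id _ _ _) (@measurable_cst _ _ _ _ _ r))).
have Kge0 (z : R) : 0 <= \int[lebesgue_measure]_s (ext_killed_density s y * ext_density s z).
  by apply: integral_ge0 => s _; rewrite mule_ge0 ?ext_killed_density_ge0 ?ext_density_ge0.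
rewrite /passage_kernel -ge0_integralZl//; last 3 first.
- exact: (emeasurable_funM mC (mK y)).
- by move=> z _; rewrite mule_ge0 ?ext_jump_rate_ge0.
- by rewrite lee_fin mulr_ge0.
apply: eq_integral => z _.
have mAB : measurable_fun setT (fun s : R => ext_killed_density s y * ext_density s z).
  apply: emeasurable_funM.
    exact: (measurableT_comp measurable_ext_killed_density
      (measurable_fun_pair (@measurable_id _ _ _) (@measurable_cst _ _ _ _ _ y))).
  exact: (measurableT_comp measurable_ext_density
    (measurable_fun_pair (@measurable_id _ _ _) (@measurable_cst _ _ _ _ _ z))).
transitivity ((f r)%:E * ext_jump_rate z r * ((h y)%:E *
    \int[lebesgue_measure]_s (ext_killed_density s y * ext_density s z))).
  congr (_ * _); rewrite -ge0_integralZl//; last 2 first.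
  - by move=> s _; rewrite mule_ge0 ?ext_killed_density_ge0 ?ext_density_ge0.
  - by rewrite lee_fin.
  by apply: eq_integral => s _; rewrite muleA.
by rewrite EFinM -!muleA; congr (_ * _); rewrite muleCA.
Qed.

End passage_kernel.

(** * Space-time boxes and their approximation *)

Section boxes.
Context {R : realType} {n : nat}.

(** Open intervals, because the test functions increase to indicators of such intervals. *)
Definition space_time_box : set (set (R * 'rV[R]_n)) :=
  [set A | exists c : R * R, exists e : 'I_n -> R * R,
    A = `]c.1, c.2[%classic `*`
        [set v : 'rV[R]_n | forall i, (e i).1 < v ord0 i < (e i).2]].

Lemma coord_bound (r : R) (v : 'rV[R]_n) : exists k : nat,
  - k.+1%:R < r < k.+1%:R /\ forall i, - k.+1%:R < v ord0 i < k.+1%:R.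
Proof.
pose M := `|r| + \sum_(i < n) `|v ord0 i|.
have M0 : 0 <= M by rewrite addr_ge0// sumr_ge0.
have Mk : M < (Num.bound M).+1%:R by rewrite (lt_trans (archi_boundP M0))// ltr_nat.
exists (Num.bound M); split; first rewrite -ltr_norml.
  by rewrite (le_lt_trans _ Mk)// lerDl sumr_ge0.
move=> i; rewrite -ltr_norml (le_lt_trans _ Mk)// /M (bigD1 i)//= addrCA lerDl.
by rewrite addr_ge0// sumr_ge0.
Qed.

Lemma measurable_space_time_box A : space_time_box A -> measurable A.
Proof.
move=> [c [e ->]]; apply: measurableX; first exact: measurable_itv.
rewrite (_ : [set v | _] = \bigcap_(i in [set: 'I_n])
    ((fun v : 'rV[R]_n => v ord0 i) @^-1` `](e i).1, (e i).2[%classic)).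
  apply: fin_bigcap_measurable => // i _.
  by rewrite -[X in measurable X]setTI; apply: measurable_coord_rV.
apply/seteqP; split=> v /= h i; first by move=> _; rewrite /= in_itv/= h.
by have := h i I; rewrite /= in_itv.
Qed.

Lemma setI_closed_space_time_box : setI_closed space_time_box.
Proof.
move=> _ _ [c [e ->]] [c' [e' ->]].
exists (Num.max c.1 c'.1, Num.min c.2 c'.2).
exists (fun i => (Num.max (e i).1 (e' i).1, Num.min (e i).2 (e' i).2)).
apply/seteqP; split => -[r v] /=; rewrite !in_itv/= !gt_max !lt_min.
  move=> [[/andP[h1 h2] h3] [/andP[h4 h5] h6]]; split.
    by rewrite h1 h2 h4 h5.
  move=> i; rewrite gt_max lt_min; have /andP[-> ->] := h3 i.
  by have /andP[-> ->] := h6 i.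
move=> [/andP[/andP[h1 h2] /andP[h3 h4]] h5]; rewrite h1 h2 h3 h4; do 2 split => //.
  by move=> i; have := h5 i; rewrite gt_max lt_min => /andP[/andP[-> _] /andP[-> _]].
by move=> i; have := h5 i; rewrite gt_max lt_min => /andP[/andP[_ ->] /andP[_ ->]].
Qed.

Lemma bigcup_space_time_box :
  exists g : (set (R * 'rV[R]_n))^nat, (forall k, space_time_box (g k)) /\ \bigcup_k g k = setT.
Proof.
exists (fun k => `]- k.+1%:R, k.+1%:R[%classic `*`
  [set v : 'rV[R]_n | forall i, - k.+1%:R < v ord0 i < k.+1%:R]); split.
  move=> k; exists (- k.+1%:R, k.+1%:R).
  by exists (fun=> (- k.+1%:R, k.+1%:R)).
apply/seteqP; split => // -[r v] _; have [k [kr kv]] := coord_bound r v.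
by exists k => //=; rewrite in_itv.
Qed.

(** Both projections are measurable for the sigma-algebra of boxes, because the preimage of a
    half-line under one coordinate is a countable union of growing boxes. *)
Lemma measurable_space_time_boxE :
  @measurable _ (R * 'rV[R]_n)%type = <<s space_time_box >>.
Proof.
apply/seteqP; split; last first.
  by apply: smallest_sub; [exact: sigma_algebra_measurable|exact: measurable_space_time_box].
pose T' := g_sigma_algebraType space_time_box.
have mbox (A : set T') : space_time_box A -> measurable A by exact: sub_sigma_algebra.
have m1 : measurable_fun setT (fst : T' -> R).
  apply: (measurability _ (RGenOInfty.measurableE R)) => /= _ [_ [c ->]] <-.
  rewrite setTI (_ : _ @^-1` _ = \bigcup_k (`]c, k.+1%:R[%classic `*`
      [set v : 'rV[R]_n | forall i, - k.+1%:R < v ord0 i < k.+1%:R])).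
    apply: bigcupT_measurable => k; apply: mbox; exists (c, k.+1%:R).
    by exists (fun=> (- k.+1%:R, k.+1%:R)).
  apply/seteqP; split => -[r v] /=; rewrite !in_itv/= ?andbT.
    move=> cr; have [k [/andP[_ kr] kv]] := coord_bound r v.
    by exists k => //; split => //=; rewrite in_itv/= cr kr.
  by move=> [k _ [/=]]; rewrite in_itv/= => /andP[].
have m2 : measurable_fun setT (snd : T' -> 'rV[R]_n).
  apply/measurable_fun_rVP => i.
  apply: (measurability _ (RGenOInfty.measurableE R)) => /= _ [_ [c ->]] <-.
  rewrite setTI (_ : _ @^-1` _ = \bigcup_k (`]- k.+1%:R, k.+1%:R[%classic `*`
      [set v : 'rV[R]_n | forall j,
        (if j == i then c else - k.+1%:R) < v ord0 j < k.+1%:R])).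
    apply: bigcupT_measurable => k; apply: mbox; exists (- k.+1%:R, k.+1%:R).
    by exists (fun j => (if j == i then c else - k.+1%:R, k.+1%:R)).
  apply/seteqP; split => -[r v] /=; rewrite !in_itv/= ?andbT.
    move=> cr; have [k [kr kv]] := coord_bound r v.
    exists k => //; split => /=; first by rewrite in_itv.
    by move=> j; have := kv j; case: eqP => [->|] // /andP[_ ->]; rewrite cr.
  by move=> [k _ [/= _]] /(_ i); rewrite eqxx => /andP[].
have mid : measurable_fun setT (id : T' -> R * 'rV[R]_n).
  by apply/measurable_fun_pairP; split.
by move=> A mA; have := mid measurableT A mA; rewrite setTI.
Qed.

Definition box_test (e : 'I_n -> R * R) (k : nat) (v : 'rV[R]_n) : R :=
  \prod_(i < n) test_fun (e i).1 (e i).2 k (v ord0 i).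

Lemma box_test_ge0 e k v : 0 <= box_test e k v.
Proof. by apply: prodr_ge0 => i _; exact: test_fun_ge0. Qed.

Lemma box_test_le1 e k v : box_test e k v <= 1.
Proof. by apply: prodr_ile1 => i _; rewrite test_fun_ge0 test_fun_le1. Qed.

Lemma box_test_nd e v : nondecreasing_seq (box_test e ^~ v).
Proof.
by move=> k m km; apply: ler_prod => i _; rewrite test_fun_ge0/= test_fun_nd.
Qed.

Let cvg_prod_ord {T : Type} (F : set_system T) {FF : Filter F} (f : 'I_n -> T -> R) (l : 'I_n -> R) :
  (forall i, f i x @[x --> F] --> l i) ->
  \prod_(i < n) f i x @[x --> F] --> \prod_(i < n) l i.
Proof.
move=> fl; elim: (index_enum _) => [|i s IH].
  by under eq_fun do rewrite big_nil; rewrite big_nil; exact: cvg_cst.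
by under eq_fun do rewrite big_cons; rewrite big_cons; exact: cvgM.
Qed.

Lemma box_test_cvg e v : box_test e k v @[k --> \oo] -->
  (\1_[set v : 'rV[R]_n | forall i, (e i).1 < v ord0 i < (e i).2] v : R).
Proof.
have <- : \prod_(i < n) (\1_(`](e i).1, (e i).2[%classic : set R) (v ord0 i) : R) =
    \1_[set v : 'rV[R]_n | forall i, (e i).1 < v ord0 i < (e i).2] v.
  rewrite [RHS]indicE.
  have [h|h] := pselect (forall i, (e i).1 < v ord0 i < (e i).2).
    rewrite mem_set//= big1// => i _; rewrite indicE mem_setE in_itv/= h//.
  rewrite memNset//=; move/existsNP : h => [i /negP hi].
  by rewrite (bigD1 i)//= indicE mem_setE in_itv/= (negbTE hi) mul0r.
by apply: cvg_prod_ord => i; exact: test_fun_cvg.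
Qed.

Lemma continuous_box_test e k : continuous (box_test e k).
Proof.
move=> v; apply: (@cvg_prod_ord _ (nbhs v) (nbhs_filter v)
  (fun i u => test_fun (e i).1 (e i).2 k (u ord0 i))) => i.
apply: (@cvg_comp _ _ _ (fun u : 'rV[R]_n => u ord0 i) (test_fun (e i).1 (e i).2 k) _ (nbhs (v ord0 i))).
  exact: coord_continuous.
exact: continuous_test_fun.
Qed.

Lemma measurable_box_test e k : measurable_fun setT (box_test e k).
Proof.
apply: measurable_prod => i _; apply: measurableT_comp; last exact: measurable_coord_rV.
by apply: continuous_measurable_fun => z; exact: continuous_test_fun.
Qed.

End boxes.

(** * The joint law at the passage time *)

Section passage_law.
Context {R : realType} {dW} {W : measurableType dW} (P : probability W R).
Variables (T t : R) (t_gt0 : 0 < t) (t_leT : t <= T).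
Variables (rho : R -> R -> R) (rho_H0 : hypothesis_H0 rho).
Variables (Q : R -> (R -> R) -> (R -> R))
  (Q_generated : generated_by_closure T Q (fun u t => - D_infty rho u t) (C1_infty T)).
Variables (Y : R -> W -> R) (Y_feller : feller_process P T Q t Y).
Variables (n : nat) (U : set 'rV[R]_n) (oU : open U) (X : R -> W -> 'rV[R]_n).
Hypothesis mX : forall s : R, 0 <= s -> measurable_fun setT (X s).
Hypothesis cX : forall w : W, {within `[0, +oo[, continuous (X^~ w)}.
Hypothesis X0 : forall w, U (X 0 w).
Hypothesis YX_independent : independent_processes P Y X.
Variables (q : R -> R -> R) (pU : R -> 'rV[R]_n -> R).
Hypothesis q_ge0 : forall s z : R, 0 < s -> 0 <= q s z.
Hypothesis mq : measurable_fun ((`]0, +oo[ : set R) `*` [set: R])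
  (fun u : R * R => q u.1 u.2).
Hypothesis qE : forall (s : R) A, 0 < s -> measurable A ->
  P (Y s @^-1` A) = (\int[lebesgue_measure]_(z in A) (q s z)%:E)%E.
Hypothesis pU_ge0 : forall (s : R) y, 0 < s -> U y -> 0 <= pU s y.
Hypothesis mpU : measurable_fun ((`]0, +oo[ : set R) `*` U)
  (fun u : R * 'rV[R]_n => pU u.1 u.2).
Hypothesis pUE : forall (s : R) (h : 'rV[R]_n -> R), 0 < s ->
  measurable_fun U h -> [bounded h y | y in U] ->
  ('E_P[fun w => (h (X s w) * \1_[set w | (s%:E < hitting_time X (~` U) w)%E] w)%R] =
   \int[lebesgue_rV n]_(y in U) (h y * pU s y)%:E)%E.
Let tau := hitting_time Y `]-oo, 0].
Let tauU := hitting_time X (~` U).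
Let H := passage_kernel rho q pU t U.

Let tau_gt0 w : (0 < tau w)%E.
Proof.
apply: hitting_time_nonincreasing_gt0 => [|s s0|s s' s0 ss'].
- by rewrite (feller_start Y_feller).
- exact: feller_right_continuous Y_feller _ _ s0.
- exact: feller_nonincreasing Y_feller _ _ _ s0 ss'.
Qed.

Let mU : measurable U. Proof. exact: open_measurable_rV. Qed.

Let mq1 (s : R) : 0 < s -> measurable_fun setT (q s).
Proof.
move=> s0.
have : measurable_fun setT (fun z : R => fine (ext_density q s z)).
  apply: (@measurableT_comp _ _ _ _ _ _ fine); first exact: fine_measurable.
  exact: (measurableT_comp (measurable_ext_density mq)
    (measurable_fun_pair (@measurable_cst _ _ _ _ _ s) (@measurable_id _ _ _))).
by rewrite /ext_density s0.
Qed.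

Section test.
Variables (h : 'rV[R]_n -> R) (ch : continuous h) (mh : measurable_fun setT h).
Hypothesis h_ge0 : forall y, 0 <= h y.
Hypothesis h_le1 : forall y, h y <= 1.
Variables (a b : R) (b_le0 : b <= 0) (k : nat).
Let f := test_fun a b k.

Let mf : measurable_fun setT f.
Proof. by apply: continuous_measurable_fun => z; exact: continuous_test_fun. Qed.

(** The intensity of landing, weighted by [f], from position z: it is [- D_infty rho f z] for 0 < z
    < t and 0 elsewhere. *)
Let Gf (z : R) : \bar R :=
  (\int[lebesgue_measure]_r ((f r)%:E * ext_jump_rate rho t z r))%E.

Let mGf : measurable_fun setT Gf.
Proof.
apply: (@measurable_tonelli R _ _ _ _ lebesgue_measure
    (fun z r => (f r)%:E * ext_jump_rate rho t z r)%E) => [|z r].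
  apply: emeasurable_funM; last exact: measurable_ext_jump_rate.
  apply/measurable_EFinP; exact: (measurableT_comp mf measurable_snd).
by rewrite mule_ge0 ?ext_jump_rate_ge0// lee_fin test_fun_ge0.
Qed.

Let Gf_ge0 z : (0 <= Gf z)%E.
Proof.
by apply: integral_ge0 => r _; rewrite mule_ge0 ?ext_jump_rate_ge0// lee_fin test_fun_ge0.
Qed.

Let GfE (z : R) : 0 < z < t -> Gf z = (- D_infty rho f z)%:E.
Proof.
move=> zt; have /andP[z0 _] := zt.
rewrite (D_infty_test_funE rho_H0)//; apply: eq_integral => r _.
by rewrite /ext_jump_rate zt/=; case: ifPn => _; rewrite ?mule0 ?mulr0// EFinM.
Qed.

Let Gf_out (z : R) : ~~ (0 < z < t) -> Gf z = 0%E.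
Proof.
move=> zt; rewrite /Gf integral0_eq// => r _.
by rewrite /ext_jump_rate (negbTE zt)/= mule0.
Qed.

Let mY (s : R) : 0 <= s -> measurable_fun setT (Y s).
Proof. exact: feller_measurable Y_feller _. Qed.

Let Y_let w (s : R) : 0 <= s -> Y s w <= t.
Proof.
move=> s0; rewrite (le_trans (feller_nonincreasing Y_feller w (lexx _) s0))//.
by rewrite (feller_start Y_feller).
Qed.

(** The law of [Y s] has density [q s]. [Gf] and [- D_infty rho f] may disagree at z = t, a bound
    for the process that a law with a density does not charge. *)
Let jump_intensityE (s : R) : 0 < s ->
  (\int[P]_(w in [set w | (0 < Y s w)%R]) (- D_infty rho f (Y s w))%:E =
   \int[lebesgue_measure]_z (ext_density q s z * Gf z))%E.
Proof.
move=> s0; have s0' := ltW s0.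
have mYs := mY s0'.
pose fY : {mfun W >-> R} := HB.pack (Y s) (isMeasurableFun.Build _ _ _ _ _ mYs).
transitivity (\int[P]_w Gf (Y s w))%E.
  rewrite integral_mkcond; apply: ge0_ae_eq_integral => //.
  - apply/(measurable_restrictT _ _).1.
      rewrite (_ : [set w | _] = Y s @^-1` `]0, +oo[%classic).
        by rewrite -[X in measurable X]setTI; apply: (mY s0') => //; exact: measurable_itv.
      by apply/seteqP; split => w /=; rewrite in_itv/= andbT.
    apply/measurable_EFinP; apply: measurable_funTS.
    apply: measurable_funN; apply: (measurableT_comp _ mYs).
    by apply: continuous_measurable_fun => z; exact: continuous_D_infty_test_fun.
  - exact: measurableT_comp.
  - by move=> w _; rewrite erestrict_ge0// => v /= Yv; rewrite lee_fin D_infty_test_fun_le0.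
  - exists (Y s @^-1` [set t]); split.
    + by rewrite -[X in measurable X]setTI; apply: (mY s0').
    + apply: etrans (qE s0 (measurable_set1 t)) _; exact: integral_set1.
    + move=> w /= nw; apply: contrapT => Yt; apply: nw => _.
      rewrite patchE; case: ifPn; rewrite ?inE ?notin_setE/=.
        move=> Y0; rewrite GfE// Y0/= lt_neqAle Y_let// andbT; exact/eqP.
      by move=> /negP Y0; rewrite Gf_out// (negbTE Y0).
transitivity (\int[distribution P fY]_z Gf z)%E.
  by rewrite ge0_integral_distribution.
rewrite (@ge0_integral_density _ _ _ _ _ (distribution P fY) lebesgue_measure id
  (fun z => (q s z)%:E))//.
- by apply: eq_integral => z _; rewrite /ext_density s0 muleC.
- by apply/measurable_EFinP; exact: mq1.
- by move=> z; rewrite lee_fin q_ge0.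
- by move=> A mA; rewrite -qE.
Qed.

Let killed_meanE (S s : R) : 0 < s < S ->
  (\int[P]_w (killed_path X U h S s w)%:E =
   \int[lebesgue_rV n]_y ((h y)%:E * ext_killed_density pU U s y))%E.
Proof.
move=> /andP[s0 sS].
transitivity (\int[lebesgue_rV n]_(y in U) (h y * pU s y)%:E)%E.
  rewrite -pUE//; last 2 first.
  - exact: measurable_funTS.
  - by exists 1; split => // M M1 y _ /=; rewrite ger0_norm// (le_trans (h_le1 y))// ltW.
  rewrite unlock; apply: eq_integral => w _; congr EFin; rewrite /killed_path.
  congr (_ * _); rewrite indicE lt_min lte_fin sS andbT; congr (nat_of_bool _)%:R.
  by apply/idP/idP; rewrite inE.
rewrite integral_mkcond; apply: eq_integral => y _.
rewrite patchE /ext_killed_density; case: ifPn; rewrite ?inE ?notin_setE => Uy.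
  by rewrite ifT ?EFinM//; exact/asboolP.
by rewrite ifF ?mule0//; apply/asboolP => -[].
Qed.

Let stopped (w : W) : R := if (tau w < +oo)%E then f (Y (fine (tau w)) w) *
    (h (X (fine (tau w)) w) * (tau w < tauU w)%E%:R) else 0.

(** The horizon S = m + 1 is sent to infinity: the left side converges by domination by 1, the right
    side because the sets ]0, m + 1[ increase; Tonelli's theorem then turns the time integral into
    the kernel. *)
Theorem passage_test :
  (\int[P]_w (stopped w)%:E =
   \int[lebesgue_measure]_r \int[lebesgue_rV n]_y ((f r * h y)%:E * H r y))%E.
Proof.
pose Ft (S : R) (w : W) : R := if (tau w < +oo)%E then f (Y (fine (tau w)) w) *
  killed_path X U h S (fine (tau w)) w else 0.
pose Psi (s : R) : \bar R :=
  ((\int[lebesgue_rV n]_y ((h y)%:E * ext_killed_density pU U s y)) *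
    \int[lebesgue_measure]_z (ext_density q s z * Gf z))%E.
have Psi_ge0 s : (0 <= Psi s)%E.
  apply: mule_ge0; apply: integral_ge0 => y _; apply: mule_ge0.
  - by rewrite lee_fin.
  - exact: ext_killed_density_ge0.
  - exact: ext_density_ge0.
  - exact: Gf_ge0.
have mPsi : measurable_fun setT Psi.
  apply: emeasurable_funM.
    apply: (@measurable_tonelli R _ _ _ _ (lebesgue_rV n)
      (fun s y => (h y)%:E * ext_killed_density pU U s y)%E) => [|s y].
      apply: emeasurable_funM; last exact: measurable_ext_killed_density.
      by apply/measurable_EFinP; exact: (measurableT_comp mh measurable_snd).
    by apply: mule_ge0; [rewrite lee_fin|exact: ext_killed_density_ge0].
  apply: (@measurable_tonelli R _ _ _ _ lebesgue_measure
      (fun s z => ext_density q s z * Gf z)%E) => [|s z].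
    apply: emeasurable_funM; first exact: measurable_ext_density.
    exact: (measurableT_comp mGf measurable_snd).
  by apply: mule_ge0; [exact: ext_density_ge0|exact: Gf_ge0].
have FtE (S : R) : 0 < S ->
    (\int[P]_w (Ft S w)%:E = \int[lebesgue_measure]_(s in `]0%R, S[) Psi s)%E.
  move=> S0.
  rewrite (first_passage_integral t_gt0 t_leT rho_H0 Q_generated Y_feller oU mX cX X0
    YX_independent ch mh h_ge0 h_le1 a b_le0 k S).
  have agE (s : R) : `]0, S[%classic s ->
      (\int[P]_(w in [set w | (0 < Y s w)%R]) (- D_infty rho f (Y s w))%:E *
       \int[P]_w (killed_path X U h S s w)%:E = Psi s)%E.
    rewrite /= in_itv/= => sS; have /andP[s0 _] := sS.
    by rewrite jump_intensityE// killed_meanE// muleC.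
  (* The endpoints are dropped because the density formulas are available only for 0 < s < S. *)
  rewrite integral_itv_bndoo.
    by apply: eq_integral => s; rewrite inE => /agE.
  apply: (@eq_measurable_fun _ _ _ _ _ Psi).
    by move=> s; rewrite inE => /agE.
  exact: measurable_funTS.
have mFt (S : R) : measurable_fun setT (Ft S).
  exact: (measurable_first_passage t_gt0 Y_feller oU mX cX X0 ch mh h_ge0 a b_le0 k S).
have h01 y (c : bool) : 0 <= h y * c%:R <= 1.
  by case: c; rewrite ?mulr1 ?mulr0 ?h_ge0 ?h_le1 ?lexx ?ler01.
have Ft_le1 S w : `|Ft S w| <= 1.
  rewrite /Ft; case: ifPn => _; last by rewrite normr0.
  have /andP[k0 k1] := h01 (X (fine (tau w)) w)
    ((fine (tau w))%:E < Order.min (tauU w) S%:E)%E.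
  rewrite ger0_norm; last by apply: mulr_ge0 => //; exact: test_fun_ge0.
  by apply: mulr_ile1 => //; [exact: test_fun_ge0|exact: test_fun_le1].
have cFt : forall w, (Ft m.+1%:R w)%:E @[m --> \oo] --> (stopped w)%:E.
  move=> w.
  apply/fine_cvgP; split; first exact: nearW.
  (* For each path the sequence is eventually constant: a horizon beyond a finite [tau] no longer
     acts. *)
  apply: cvg_near_cst; rewrite /Ft /stopped; case: ifPn => [ty|_]; last exact: nearW.
  have tf : tau w \is a fin_num.
    by rewrite ge0_fin_numE// ltW.
  near=> m; rewrite /= /killed_path lt_min fineK// -[X in (X < m.+1%:R%:E)%E](fineK tf).
  rewrite lte_fin (_ : (fine (tau w) < m.+1%:R) = true) ?andbT//.
  near: m; exists (Num.bound (fine (tau w))) => // m /= bm.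
  apply: lt_le_trans (archi_boundP _) _; first by rewrite fine_ge0// ltW.
  by rewrite ler_nat leqW.
have mst : measurable_fun setT (fun w => (stopped w)%:E).
  apply: (@emeasurable_fun_cvg _ _ _ _ (fun m w => (Ft m.+1%:R w)%:E)) => [m|w _].
    by apply/measurable_EFinP.
  exact: cFt.
have [_ _ c1] := @dominated_convergence _ _ R P _ measurableT
  (fun m w => (Ft m.+1%:R w)%:E) (fun w => (stopped w)%:E) (cst 1%E)
  ltac:(by move=> m; apply/measurable_EFinP) mst
  ltac:(by apply: aeW => w _; exact: cFt)
  ltac:(exact: finite_measure_integrable_cst)
  ltac:(by apply: aeW => w m _; rewrite lee_fin).
pose I (m : nat) : set (measurableTypeR R) := `]0, m.+1%:R[%classic.
have c2 := @ge0_nondecreasing_set_cvg_integral _ (measurableTypeR R) R I Psi lebesgue_measure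
  ltac:(by move=> i j ij; apply/subsetPset => s; rewrite /I/= !in_itv/= => /andP[-> /lt_le_trans->//]; rewrite ler_nat ltnS)
  ltac:(by move=> i; exact: measurable_itv)
  ltac:(by move=> i; exact: measurable_funTS)
  (fun i s _ => Psi_ge0 s).
have UI : \bigcup_i I i = `]0, +oo[%classic.
  apply/seteqP; split => s; rewrite /I/=.
    by move=> [i _]; rewrite /= !in_itv/= => /andP[-> _].
  rewrite in_itv/= andbT => s0; exists (Num.bound s) => //=.
  by rewrite in_itv/= s0/= (lt_trans (archi_boundP (ltW s0)))// ltr_nat.
rewrite UI in c2.
have c1' : (\int[lebesgue_measure]_(s in I m) Psi s)%E @[m --> \oo] -->
    (\int[P]_w (stopped w)%:E)%E.
  by rewrite -(funext (fun m => FtE m.+1%:R (ltr0Sn R m))).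
rewrite (cvg_unique _ c1' c2)//.
rewrite -(passage_kernel_tonelli t rho_H0 q_ge0 mq pU_ge0 mpU mU mf (test_fun_ge0 a b k) mh h_ge0).
rewrite integral_mkcond; apply: eq_integral => s _.
rewrite patchE mem_setE in_itv/= andbT; case: ifPn => // s0.
rewrite [X in (_ * X)%E]integral0_eq ?mule0// => z _.
by rewrite /ext_density (negbTE s0) mul0e.
Unshelve. all: by end_near. Qed.

End test.

Let Z (w : W) : R * 'rV[R]_n := (Y (fine (tau w)) w, X (fine (tau w)) w).

(** The strict inequality leaves out the value 0, which test functions with b <= 0 do not see. For
    infinite [tau] the first condition fails, so the default time 0 given by [fine] has no
    effect. *)
Let p (w : W) : \bar R :=
  (((tau w < tauU w)%E && (Y (fine (tau w)) w < 0)%R)%:R)%:E.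

Let p_ge0 w : (0 <= p w)%E. Proof. by rewrite lee_fin. Qed.

Let mY (s : R) : 0 <= s -> measurable_fun setT (Y s).
Proof. exact: feller_measurable Y_feller _. Qed.

Let measurable_hit (E : W -> \bar R) : (forall w, 0 < E w)%E ->
  (forall s : R, 0 <= s -> measurable [set w | (s%:E < E w)%E]) ->
  measurable_fun setT E.
Proof.
move=> E0 mE; apply: (measurability _ (ErealGenOInfty.measurableE R)).
move=> /= _ [_ [c ->]] <-; rewrite setTI preimage_itvoy.
have [c0|c0] := leP 0 c; first exact: mE.
rewrite (_ : [set w | _] = setT)//; apply/seteqP; split => // w _ /=.
by rewrite (lt_trans _ (E0 w))// lte_fin.
Qed.

Let tau_ltE w (s : R) : 0 <= s -> (s%:E < tau w)%E = (0 < Y s w).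
Proof.
move=> s0; apply: lt_hitting_time_nonincreasing s0 => [|u u0|u v u0 uv].
- by rewrite (feller_start Y_feller).
- exact: feller_right_continuous Y_feller _ _ u0.
- exact: feller_nonincreasing Y_feller _ _ _ u0 uv.
Qed.

Let Ytau_le0 w : (tau w < +oo)%E -> Y (fine (tau w)) w <= 0.
Proof.
apply: hitting_time_nonincreasing_le0 => [|s s0|s s' s0 ss'].
- by rewrite (feller_start Y_feller).
- exact: feller_right_continuous Y_feller _ _ s0.
- exact: feller_nonincreasing Y_feller _ _ _ s0 ss'.
Qed.

Let mtau : measurable_fun setT tau.
Proof.
apply: measurable_hit => [w|s s0]; first exact: tau_gt0.
rewrite (_ : [set w | _] = Y s @^-1` `]0, +oo[).
  by rewrite -[X in measurable X]setTI; exact: mY.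
by apply/seteqP; split => w /=; rewrite tau_ltE// in_itv/= andbT.
Qed.

Let mtauU : measurable_fun setT tauU.
Proof.
apply: measurable_hit => [w|s s0]; first exact: exit_time_gt0.
exact: measurable_lt_exit_time.
Qed.

Let mftau : measurable_fun setT (fun w => (fine (tau w), w)).
Proof.
apply: measurable_fun_pair => //.
by apply: (@measurableT_comp _ _ _ _ _ _ fine) => //; exact: fine_measurable.
Qed.

Let max_ftau w : Num.max 0 (fine (tau w)) = fine (tau w).
Proof. by rewrite max_r// fine_ge0// ltW. Qed.

(** Joint measurability is composed with the random time; an infinite [tau] is read as time 0. *)
Let mYtau : measurable_fun setT (fun w => Y (fine (tau w)) w).
Proof.
have := right_continuous_nneg_jointly_measurable mY
  (fun w s => @feller_right_continuous _ _ _ _ _ _ _ _ Y_feller w s).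
move=> /(fun m => measurableT_comp m mftau); apply: eq_measurable_fun => w _ /=.
by rewrite max_ftau.
Qed.

Let mXtau : measurable_fun setT (fun w => X (fine (tau w)) w).
Proof.
apply/measurable_fun_rVP => i.
have mXi (s : R) : 0 <= s -> measurable_fun setT (fun w => X s w ord0 i).
  by move=> s0; exact: (measurableT_comp (measurable_coord_rV i) (mX s0)).
have rcXi w (s : R) : 0 <= s -> X v w ord0 i @[v --> s^'+] --> X s w ord0 i.
  move=> s0; apply: (@cvg_comp _ _ _ (X^~ w) (fun u : 'rV[R]_n => u ord0 i) _ (nbhs (X s w))).
    exact: within_right_continuous.
  exact: coord_continuous.
have := right_continuous_nneg_jointly_measurable mXi rcXi.
move=> /(fun m => measurableT_comp m mftau); apply: eq_measurable_fun => w _ /=.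
by rewrite max_ftau.
Qed.

Let mlt : measurable_fun setT (fun w => (tau w < tauU w)%E%:R : R).
Proof.
rewrite (_ : (fun _ => _) = (\1_[set w | (tau w < tauU w)%E] : W -> R)).
  by apply: measurable_indic; have := measurable_lte measurableT mtau mtauU; rewrite setTI.
by apply/funext => w; rewrite indicE; congr (nat_of_bool _)%:R; apply/idP/idP; rewrite inE.
Qed.

Let mZ : measurable_fun setT Z.
Proof. exact: measurable_fun_pair. Qed.

Let mp : measurable_fun setT p.
Proof.
apply/measurable_EFinP.
rewrite (_ : (fun _ => _) = (\1_([set w | (tau w < tauU w)%E] `&`
    (fun w => Y (fine (tau w)) w) @^-1` `]-oo, 0[%classic) : W -> R)).
  apply: measurable_indic; apply: measurableI.
    by have := measurable_lte measurableT mtau mtauU; rewrite setTI.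
  by rewrite -[X in measurable X]setTI; apply: mYtau => //; exact: measurable_itv.
apply/funext => w; rewrite indicE; congr (nat_of_bool _)%:R.
by apply/andP/idP; rewrite inE/= in_itv.
Qed.

Let box_identity A : space_time_box A ->
  (\int[P]_(w in Z @^-1` A) p w =
   \int[lebesgue_measure \x lebesgue_rV n]_(u in id @^-1` A) H u.1 u.2)%E.
Proof.
move=> [c [e ->]].
(* Cutting at 0 meets the requirement b <= 0 on test functions and loses nothing, since [p] and [H]
   both vanish where the first coordinate is >= 0. *)
pose a := c.1. pose b := Num.min c.2 0.
have b0 : b <= 0 by rewrite ge_min lexx orbT.
pose f k := test_fun a b k. pose h k := box_test e k.
have eqk k := passage_test (@continuous_box_test _ _ e k)
  (@measurable_box_test _ _ e k) (@box_test_ge0 _ _ e k) (@box_test_le1 _ _ e k) a b0 k.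
pose box := [set v : 'rV[R]_n | forall i, (e i).1 < v ord0 i < (e i).2].
pose phi k (u : R * 'rV[R]_n) : R := f k u.1 * h k u.2.
pose phi_ (u : R * 'rV[R]_n) : R := \1_(`]a, b[%classic : set R) u.1 * \1_box u.2.
have phi_ge0 k u : 0 <= phi k u.
  by apply: mulr_ge0; [exact: test_fun_ge0|exact: box_test_ge0].
have phi_le1 k u : phi k u <= 1.
  apply: mulr_ile1; [exact: test_fun_ge0|exact: box_test_ge0|exact: test_fun_le1|exact: box_test_le1].
have phi_nd u : nondecreasing_seq (phi ^~ u).
  move=> k m km; apply: ler_pM; [exact: test_fun_ge0|exact: box_test_ge0| |].
    exact: test_fun_nd.
  exact: box_test_nd.
have cphi u : phi k u @[k --> \oo] --> phi_ u.
  by apply: cvgM; [exact: test_fun_cvg|exact: box_test_cvg].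
have mphi k : measurable_fun setT (phi k).
  apply: measurable_funM.
    apply: (measurableT_comp _ measurable_fst).
    by apply: continuous_measurable_fun => z; exact: continuous_test_fun.
  exact: (measurableT_comp (measurable_box_test e k) measurable_snd).
have mH := measurable_passage_kernel t rho_H0 q_ge0 mq pU_ge0 mpU mU.
have H0 r y : (0 <= H r y)%E by exact: passage_kernel_ge0.
have phi_E (u : R * 'rV[R]_n) : phi_ u =
    ((u \in `]c.1, c.2[%classic `*` box) && (u.1 < 0))%:R.
  rewrite /phi_ !indicE -natrM mulnb; congr (nat_of_bool _)%:R.
  rewrite mem_setE in_itv/= /b lt_min; apply/idP/idP.
    move=> /andP[/andP[h1 /andP[h2 h3]] h4]; rewrite h3 andbT inE; split => /=.
      by rewrite in_itv/= h1.
    by move: h4; rewrite inE.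
  move=> /andP[]; rewrite inE => -[/=]; rewrite in_itv/= => /andP[h1 h2] h4 h3.
  by rewrite /a h1 h2 h3/= inE.
have mphi_ : measurable_fun setT phi_.
  by apply: (measurable_fun_cvg mphi) => u _; exact: cphi.
have phi_pos u : 0 <= phi_ u by rewrite phi_E.
have c1 : (\int[P]_w (phi k (Z w) * (tau w < tauU w)%E%:R)%:E)%E @[k --> \oo] -->
    (\int[P]_w (phi_ (Z w) * (tau w < tauU w)%E%:R)%:E)%E.
  have cvgw w : (phi k (Z w) * (tau w < tauU w)%E%:R)%:E @[k --> \oo] -->
      (phi_ (Z w) * (tau w < tauU w)%E%:R)%:E.
    apply/fine_cvgP; split; first exact: nearW.
    by apply: cvgM; [exact: cphi|exact: cvg_cst].
  have bdw k w : (`|(phi k (Z w) * (tau w < tauU w)%E%:R)%:E| <= 1)%E.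
    rewrite lee_fin ger0_norm; last by apply: mulr_ge0.
    by case: (_ < _)%E; rewrite ?mulr1 ?mulr0.
  have [_ _ cc] := @dominated_convergence _ _ R P _ measurableT
    (fun k w => (phi k (Z w) * (tau w < tauU w)%E%:R)%:E)
    (fun w => (phi_ (Z w) * (tau w < tauU w)%E%:R)%:E) (cst 1%E)
    (fun k => (measurable_EFinP _ _).2 (measurable_funM (measurableT_comp (mphi k) mZ) mlt))
    ((measurable_EFinP _ _).2 (measurable_funM (measurableT_comp mphi_ mZ) mlt))
    (aeW _ (fun w _ => cvgw w))
    ltac:(exact: finite_measure_integrable_cst)
    (aeW _ (fun w k _ => bdw k w)).
  exact: cc.
have c2 : (\int[lebesgue_measure \x lebesgue_rV n]_u ((phi k u)%:E * H u.1 u.2))%E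
    @[k --> \oo] -->
    (\int[lebesgue_measure \x lebesgue_rV n]_u ((phi_ u)%:E * H u.1 u.2))%E.
  have -> : (\int[lebesgue_measure \x lebesgue_rV n]_u ((phi_ u)%:E * H u.1 u.2))%E =
    (\int[lebesgue_measure \x lebesgue_rV n]_u
      (limn (fun k => (phi k u)%:E * H u.1 u.2)))%E.
    apply: eq_integral => u _; apply/esym/cvg_lim => //.
    (* [H] may be +oo, so a zero of [phi_] needs its own argument: the nonnegative increasing
       sequence [phi k u] is then identically 0. *)
    have [phi0|phi0] := eqVneq (phi_ u) 0.
      rewrite phi0 mul0e (_ : (fun _ => _) = cst 0%E); first exact: cvg_cst.
      apply/funext => k; rewrite (_ : phi k u = 0) ?mul0e//.
      apply/eqP; rewrite eq_le phi_ge0 andbT -phi0.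
      have cu : phi k u @[k --> \oo] --> phi_ u := cphi u.
      rewrite -(cvg_lim _ cu)//; apply: nondecreasing_cvgn_le => //.
      by apply/cvg_ex; exists (phi_ u).
    apply: cvgeM; [|by apply/fine_cvgP; split; [exact: nearW|exact: cphi]|exact: cvg_cst].
    by rewrite mule_defE eqe (negbTE phi0)/= andbF.
  apply: cvg_monotone_convergence => //.
  - by move=> k; apply: emeasurable_funM => //; apply/measurable_EFinP; exact: mphi.
  - by move=> k u _; apply: mule_ge0 => //; rewrite lee_fin.
  - by move=> u _ k m km; apply: lee_wpmul2r => //; rewrite lee_fin phi_nd.
have c1' : (\int[lebesgue_measure \x lebesgue_rV n]_u ((phi k u)%:E * H u.1 u.2))%E
    @[k --> \oo] --> (\int[P]_w (phi_ (Z w) * (tau w < tauU w)%E%:R)%:E)%E.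
  rewrite (_ : (fun _ => _) =
      (fun k => \int[P]_w (phi k (Z w) * (tau w < tauU w)%E%:R)%:E)%E)//.
  apply/funext => k; rewrite fubini_tonelli1/=; last 2 first.
  - by apply: emeasurable_funM => //; apply/measurable_EFinP; exact: mphi.
  - by move=> u; apply: mule_ge0 => //; rewrite lee_fin.
  rewrite -[LHS]eqk; apply: eq_integral => w _; congr EFin.
  case: ifPn => [_|]; first by rewrite mulrA.
  by rewrite -leNgt leye_eq => /eqP ->; rewrite ltNge leey mulr0.
have eq12 := cvg_unique (@ereal_hausdorff R) c1' c2.
rewrite [LHS]integral_mkcond [RHS]integral_mkcond.
transitivity (\int[P]_w (phi_ (Z w) * (tau w < tauU w)%E%:R)%:E)%E.
  apply: eq_integral => w _; rewrite patchE phi_E /p.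
  rewrite (_ : (w \in _) = (Z w \in `]c.1, c.2[%classic `*` box)); last first.
    by apply/idP/idP; rewrite !inE.
  case: (Z w \in _); last by rewrite mul0r.
  by rewrite -natrM mulnb andbC.
rewrite eq12; apply: eq_integral => u _; rewrite patchE phi_E preimage_id.
case: (u \in _); last by rewrite mul0e.
rewrite /=; have [u0|u0] := ltP u.1 0; first by rewrite mul1e.
rewrite mul0e /H /passage_kernel integral0_eq// => z _.
by rewrite /ext_jump_rate (ltNge u.1 0) u0/= andbF mul0e.
Qed.

(** [p] is at most 1 under a probability, so the mass is finite and agreement on boxes suffices. *)
Theorem passage_law (F : R * 'rV[R]_n -> \bar R) :
  measurable_fun setT F -> (forall u, 0 <= F u)%E ->
  (\int[P]_w (F (Z w) * p w) =
   \int[lebesgue_measure \x lebesgue_rV n]_u (F u * H u.1 u.2))%E.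
Proof.
move=> mF F0; have [g [gbox gT]] := @bigcup_space_time_box R n.
have mH := measurable_passage_kernel t rho_H0 q_ge0 mq pU_ge0 mpU mU.
have H0 u : (0 <= H u.1 u.2)%E by exact: passage_kernel_ge0.
have fin : (\int[P]_w p w < +oo)%E.
  apply: (@le_lt_trans _ _ (\int[P]_w (cst 1%E w))%E).
    apply: ge0_le_integral => //.
    by move=> w _; rewrite lee_fin; case: (_ && _).
  by rewrite integral_cst//= mul1e (le_lt_trans (probability_le1 _ _))// ltry.
have mid : measurable_fun setT (id : measurableTypeR R * 'rV[R]_n -> R * 'rV[R]_n) by exact: measurable_id.
exact: (ge0_integral_pi_system mZ mid mp mH p_ge0 H0
  measurable_space_time_boxE setI_closed_space_time_box gbox gT fin box_identity mF F0).
Qed.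

Let mH : measurable_fun setT (fun u : R * 'rV[R]_n => H u.1 u.2).
Proof. exact: (measurable_passage_kernel t rho_H0 q_ge0 mq pU_ge0 mpU mU). Qed.

Let H_ge0 r y : (0 <= H r y)%E. Proof. exact: passage_kernel_ge0. Qed.

(** The weights are nonnegative, so the positive and negative parts of each product are those of
    [Phi] times the weight, and the nonnegative case applies to each. *)
Let signed_passage_law (Phi : R * 'rV[R]_n -> R) : measurable_fun setT Phi ->
  (\int[P]_w ((Phi (Z w))%:E * p w) =
   \int[lebesgue_measure \x lebesgue_rV n]_u ((Phi u)%:E * H u.1 u.2))%E.
Proof.
move=> mPhi.
have posM (c : R) (v : \bar R) : (0 <= v)%E ->
    (maxe (c%:E * v) 0 = (Num.max c 0)%:E * v)%E.
  move=> v0; have [c0|c0] := leP 0 c.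
    by rewrite max_l ?mule_ge0 ?lee_fin// max_l.
  by rewrite max_r ?mul0e// mule_le0_ge0// lee_fin ltW.
have negM (c : R) (v : \bar R) : (0 <= v)%E ->
    (maxe (- (c%:E * v)) 0 = (Num.max (- c) 0)%:E * v)%E.
  by move=> v0; rewrite -mulNe -EFinN posM.
have mpos : measurable_fun setT (fun u => (Num.max (Phi u) 0)%:E).
  by apply/measurable_EFinP; apply: measurable_maxr.
have mneg : measurable_fun setT (fun u => (Num.max (- Phi u) 0)%:E).
  by apply/measurable_EFinP; apply: measurable_maxr => //; exact: measurable_funN.
have max0 (c : R) : (0 <= (Num.max c 0)%:E)%E by rewrite lee_fin le_max lexx orbT.
rewrite [LHS]integralE [RHS]integralE; congr (_ - _)%E.
  transitivity (\int[P]_w ((Num.max (Phi (Z w)) 0)%:E * p w))%E.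
    by apply: eq_integral => w _; rewrite funeposE posM.
  rewrite (passage_law mpos)//.
  by apply: eq_integral => u _; rewrite funeposE posM.
transitivity (\int[P]_w ((Num.max (- Phi (Z w)) 0)%:E * p w))%E.
  by apply: eq_integral => w _; rewrite funenegE negM.
rewrite (passage_law mneg)//.
by apply: eq_integral => u _; rewrite funenegE negM.
Qed.

(** [K] is any version of the kernel that agrees with [H] for r < 0 and [y] in [U]; this lets
    [kernel_H] enter only through that agreement. *)
Theorem expectation_passage (phi : R * 'rV[R]_n -> R) (K : R -> 'rV[R]_n -> \bar R) :
  measurable_fun ((`]-oo, 0] : set R) `*` U) phi ->
  [bounded phi u | u in (`]-oo, 0] : set R) `*` U] ->
  P [set w | (tau w < +oo)%E /\ Y (fine (tau w)) w = 0] = 0%E ->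
  (forall r y, r < 0 -> U y -> K r y = H r y) ->
  ('E_P[fun w => (phi (Y (fine (tau w)) w, X (fine (tau w)) w) *
                 \1_[set w | (tau w < tauU w)%E] w)%R] =
   \int[lebesgue_measure]_(r in `]-oo, 0%R])
     \int[lebesgue_rV n]_(y in U) ((phi (r, y))%:E * K r y))%E.
Proof.
move=> mphi [M [_ hM]] PN KH.
pose D := (`]-oo, 0]%classic : set R) `*` U.
have mD : measurable D by apply: measurableX => //; exact: measurable_itv.
pose Phi := phi \_ D.
have mPhi : measurable_fun setT Phi by move/(measurable_restrictT _ mD) : mphi.
(* The bound in the hypothesis holds for every constant above [M], hence for |M| + 1. *)
have Phi_le u : `|Phi u| <= `|M| + 1.
  rewrite /Phi patchE; case: ifPn => [|_]; last by rewrite normr0.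
  by rewrite inE => Du; apply: hM Du; rewrite (le_lt_trans (ler_norm M))// ltrDl.
have LE : ('E_P[fun w => (phi (Y (fine (tau w)) w, X (fine (tau w)) w) *
    \1_[set w | (tau w < tauU w)%E] w)%R] = \int[P]_w ((Phi (Z w))%:E * p w))%E.
  rewrite unlock.
  transitivity (\int[P]_w (Phi (Z w) * (tau w < tauU w)%E%:R)%:E)%E.
    apply: eq_integral => w _; congr EFin; rewrite indicE.
    rewrite (_ : (w \in _) = (tau w < tauU w)%E); last by apply/idP/idP; rewrite inE.
    (* On this event the sampled point lies in [D]: [Y] is <= 0 at passage and the path has not left
       [U], so extending [phi] by 0 changes nothing. *)
    have [tt|] := boolP (tau w < tauU w)%E; last by rewrite !mulr0.
    have ty : (tau w < +oo)%E by rewrite (lt_le_trans tt)// leey.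
    have tf : tau w \is a fin_num by rewrite ge0_fin_numE// ltW.
    rewrite !mulr1 /Phi patchE mem_set//; split => /=.
      by rewrite in_itv/= Ytau_le0.
    by apply: (@lt_exit_time _ _ _ _ X U w); rewrite ?fineK// fine_gt0// tau_gt0.
  have mN : measurable [set w | (tau w < +oo)%E /\ Y (fine (tau w)) w = 0].
    rewrite (_ : [set w | _] = [set w | (tau w < cst +oo w)%E] `&`
        (fun w => Y (fine (tau w)) w) @^-1` [set 0]); last by apply/seteqP; split.
    apply: measurableI.
      by have := measurable_lte measurableT mtau (measurable_cst +oo%E); rewrite setTI.
    by rewrite -[X in measurable X]setTI; exact: mYtau.
  apply: ae_eq_integral => //.
  - apply/measurable_EFinP; apply: measurable_funM; last exact: mlt.
    exact: (measurableT_comp mPhi mZ).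
  - apply: emeasurable_funM; last exact: mp.
    by apply/measurable_EFinP; exact: (measurableT_comp mPhi mZ).
  (* The two integrands differ only where passage ends exactly at 0, a null event by hypothesis. *)
  - exists [set w | (tau w < +oo)%E /\ Y (fine (tau w)) w = 0]; split => //.
    move=> w /= nw; apply: contrapT => nN; apply: nw => _.
    rewrite EFinM /p; congr (_ * _%:R%:E)%E.
    have [tt|] //= := boolP (tau w < tauU w)%E.
    have ty : (tau w < +oo)%E by rewrite (lt_le_trans tt)// leey.
    suff -> : Y (fine (tau w)) w < 0 by [].
    by rewrite lt_neqAle Ytau_le0// andbT; apply/eqP => Y00; apply: nN.
(* [passage_law] with the constant 1 bounds the total mass of [H] by 1, whence the integrability
   that Fubini's theorem requires for a signed integrand. *)
have int1 : (\int[lebesgue_measure \x lebesgue_rV n]_u H u.1 u.2 <= 1)%E.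
  have pl := @passage_law (cst 1%E) (measurable_cst _) (fun=> lee01).
  have -> : (\int[lebesgue_measure \x lebesgue_rV n]_u H u.1 u.2 =
      \int[lebesgue_measure \x lebesgue_rV n]_u (cst 1 u * H u.1 u.2))%E.
    by apply: eq_integral => u _; rewrite mul1e.
  rewrite -pl; apply: (@le_trans _ _ (\int[P]_w (cst 1%E w))%E).
    apply: ge0_le_integral => //.
    + by move=> w _; rewrite mul1e.
    + by apply: emeasurable_funM.
    + by move=> w _; rewrite mul1e lee_fin; case: (_ && _).
  by rewrite integral_cst//= mul1e probability_le1.
pose PH (u : R * 'rV[R]_n) : \bar R := ((Phi u)%:E * H u.1 u.2)%E.
have mPH : measurable_fun setT PH.
  by apply: emeasurable_funM => //; exact/measurable_EFinP.
have iPH : (lebesgue_measure \x lebesgue_rV n)%E.-integrable setT PH.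
  apply/integrableP; split => //.
  apply: (@le_lt_trans _ _ (\int[lebesgue_measure \x lebesgue_rV n]_u
      ((`|M| + 1)%:E * H u.1 u.2))%E).
    apply: ge0_le_integral => //.
    + exact: measurableT_comp.
    + by apply: emeasurable_funM.
    + move=> u _; rewrite /PH abseM (gee0_abs (H_ge0 _ _)).
      by apply: lee_wpmul2r => //; rewrite lee_fin.
  rewrite ge0_integralZl//.
  apply: (@le_lt_trans _ _ ((`|M| + 1)%:E * 1)%E); last by rewrite mule1 ltry.
  by apply: lee_wpmul2l => //; rewrite lee_fin addr_ge0.
rewrite LE signed_passage_law// -(integral12_prod_meas1 iPH).
have inner r : r < 0 -> (\int[lebesgue_rV n]_(y in U) ((phi (r, y))%:E * K r y) =
    fubini_F (lebesgue_rV n) PH r)%E.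
  move=> r0; rewrite integral_mkcond /fubini_F; apply: eq_integral => y _.
  rewrite patchE /PH /Phi patchE; case: ifPn => [|]; rewrite ?inE ?notin_setE => Uy.
    by rewrite mem_set ?KH//; split => //=; rewrite in_itv/= ltW.
  by rewrite memNset ?mul0e// => -[].
(* The point r = 0 is removed as a null set, because [K] and [H] are compared only for r < 0. *)
rewrite -[RHS]integral_itv_bndo_bndc; last first.
  apply: (@eq_measurable_fun _ _ _ _ _ (fubini_F (lebesgue_rV n) PH)).
    by move=> r; rewrite inE/= in_itv/= => /inner ->.
  by apply: measurable_funTS; exact: measurable_fubini_F iPH.
rewrite [RHS]integral_mkcond; apply: eq_integral => r _.
rewrite patchE mem_setE in_itv/=; case: ifPn => r0; first by rewrite inner.
(* For r >= 0 the extended jump rate is 0, so the integral over the line reduces to r < 0. *)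
rewrite /fubini_F integral0_eq// => y _.
rewrite /PH /H /passage_kernel [X in (_ * X)%E]integral0_eq ?mule0// => z _.
by rewrite /ext_jump_rate/= (negbTE r0) andbF mul0e.
Qed.

End passage_law.

(** * Application to the shifted Brownian motion *)

Theorem proposition3p13 (R : realType) (dW : measure_display)
  (W : measurableType dW) (P : probability W R)
  (d : nat) (d_gt0 : (0 < d)%N) (T : R) (T_gt0 : 0 < T)
  (Omega : set 'rV[R]_d) (Omega_bounded : bounded_set Omega)
  (Omega_open : open Omega) (Omega_regular : regular_domain Omega)
  (rho : R -> R -> R) (rho_H0 : hypothesis_H0 rho)
  (Q : R -> (R -> R) -> (R -> R))
  (Q_generated : generated_by_closure T Q (fun u t => - D_infty rho u t) (C1_infty T))
  (* Y t = - X^{t,(rho)} *)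
  (Y : R -> R -> W -> R) (Y_feller : forall t, t <= T -> feller_process P T Q t (Y t))
  (pY : R -> R -> R -> R) (rho_H1 : hypothesis_H1 P T Y pY)
  (B : R -> W -> 'rV[R]_d) (B_brownian : brownian_motion P B)
  (YB_independent : forall t, t <= T -> independent_processes P (Y t) B)
  (pOmega : R -> 'rV[R]_d -> 'rV[R]_d -> R)
  (pOmega_density : killed_density P Omega (shifted_brownian B) pOmega)
  (t : R) (t_gt0 : 0 < t) (t_leT : t <= T)
  (x : 'rV[R]_d) (x_Omega : Omega x)
  (phi : R * 'rV[R]_d -> R)
  (phi_measurable : measurable_fun ((`]-oo, 0] : set R) `*` Omega) phi)
  (phi_bounded : [bounded phi q | q in (`]-oo, 0] : set R) `*` Omega]) :
  let Bx := shifted_brownian B x in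
  let tau0 := hitting_time (Y t) `]-oo, 0] in
  let tauOmega := hitting_time Bx (~` Omega) in
  ('E_P[fun w => (phi (Y t (fine (tau0 w)) w, Bx (fine (tau0 w)) w) *
                 \1_[set w | (tau0 w < tauOmega w)%E] w)%R] =
   \int[lebesgue_measure]_(r in `]-oo, 0%R])
     \int[lebesgue_rV d]_(y in Omega)
       ((phi (r, y))%:E * kernel_H rho pY pOmega t x r y))%E.
Proof.
move=> Bx tau0 tauOmega.
have t0T : 0 <= t <= T by rewrite ltW.
have mB s := @brownian_measurable _ _ _ _ _ _ B_brownian s.
(* Over any sample space, to be reused below with the sigma-algebra generated by [B]. *)
have mBx d' (W' : measurableType d') (B' : R -> W' -> 'rV[R]_d) :
    (forall s : R, 0 <= s -> measurable_fun setT (B' s)) ->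
    forall s : R, 0 <= s -> measurable_fun setT (shifted_brownian B' x s).
  move=> mB' s s0; apply/measurable_fun_rVP => i.
  rewrite (_ : (fun _ => _) = (fun w => x ord0 i + B' (2 * s) w ord0 i)).
    apply: measurable_funD => //.
    apply: (measurableT_comp (measurable_coord_rV i)); apply: mB'.
    by rewrite mulr_ge0.
  by apply/funext => w; rewrite /shifted_brownian mxE.
have cBx w : {within `[0, +oo[, continuous (Bx^~ w)}.
  apply/subspace_continuousP => s s0.
  apply: cvgD; first exact: cvg_cst.
  have cBw : {within `[0, +oo[, continuous (B^~ w)} by exact: (brownian_continuous B_brownian).
  move/subspace_continuousP : cBw => /(_ (2 * s)).
  have s20 : `[0, +oo[%classic (2 * s).
    by move: s0; rewrite /= !in_itv/= !andbT => s0; rewrite mulr_ge0.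
  move=> /(_ s20) cB A /cB hA.
  have {}hA : \forall v \near 2 * s, `[0, +oo[%classic v -> A (B v w) := hA.
  suff : \forall v \near s, `[0, +oo[%classic v -> A (B (2 * v) w) by [].
  have c2 : 2 * v @[v --> s] --> 2 * s by apply: cvgMr; exact: cvg_id.
  have {}hA : \forall v \near s, `[0, +oo[%classic (2 * v) -> A (B (2 * v) w).
    exact: c2 hA.
  move: hA; apply: filterS => v h v0; apply: h.
  by move: v0; rewrite /= !in_itv/= !andbT => v0; rewrite mulr_ge0.
have Bx0 w : Omega (Bx 0 w).
  by rewrite /Bx /shifted_brownian mulr0 (brownian_start B_brownian) addr0.
(* [Bx] at time [s] is a function of [B] at time 2 s, so the events of [Bx] are among those of
   [B]. *)
have indep : independent_processes P (Y t) Bx.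
  move=> A A' sA sA'; apply: (YB_independent t t_leT) => //.
  apply: (smallest_sub _ _ sA'); first exact: smallest_sigma_algebra.
  move=> C [s s0 [V mV <-]]; rewrite setTI.
  apply: process_sigma_preimage mV.
  apply: (mBx _ (process_space `[0, +oo[ B)) => [u u0|].
    by apply: measurable_process_space; rewrite /= in_itv/= u0.
  by move: s0; rewrite /= in_itv/= andbT.
apply: (@expectation_passage _ _ _ P T t t_gt0 t_leT rho rho_H0 Q Q_generated (Y t)
  (Y_feller t t_leT) d Omega Omega_open Bx (mBx _ _ _ mB) cBx Bx0 indep
  (fun s z => pY s t z) (fun s y => pOmega s x y)) => //.
- by move=> s z s0; exact: (H1_density_ge0 rho_H1).
- exact: (H1_density_measurable rho_H1).
- by move=> s A s0 mA; exact: (H1_density rho_H1).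
- by move=> s y s0 Oy; exact: (killed_density_ge0 pOmega_density).
- exact: (killed_density_measurable pOmega_density).
- by move=> s h s0 mh bh; exact: (killed_densityE pOmega_density).
- by apply: (H1_jump rho_H1); rewrite t_gt0.
(* The kernels agree because, for r < 0 and [y] in [Omega], the extended factors are the original
   ones on ]0, t[ and ]0, +oo[ and vanish outside. *)
move=> r y r0 Oy; rewrite /kernel_H /passage_kernel [LHS]integral_mkcond.
apply: eq_integral => z _; rewrite patchE mem_setE in_itv/= /ext_jump_rate r0 andbT.
case: ifPn => _; last by rewrite mul0e.
congr (_ * _)%E; rewrite integral_mkcond; apply: eq_integral => s _.
rewrite patchE mem_setE in_itv/= andbT /ext_killed_density /ext_density.
case: ifPn => s0; last by rewrite mule0.
by rewrite EFinM ifT//; exact/asboolP.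
Qed.
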